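(* Let $i\in\mathbb{S}$. The function $|\cdot|_{*,i}$ given by $$|f|_{*,i}^2=\sup_{a\in\mathbb{D}_i}\frac1{2\pi}\int_{-\pi}^{\pi}\left|(f\circ_iT_a)(e^{i\theta})-f(a)\right|^2\,d\theta$$ is a semi-norm on $\mathrm{BMOSH}(\mathbb{D})$ that satisfies $$|f\circ_iT_a|_{*,i}=|f|_{*,i}\qquad\text{for all }a\in\mathbb{D}_i,\ f\in\mathrm{BMOSH}(\mathbb{D}).$$ Moreover, the norm $\|f\|_{*,i}:=|f(0)|+|f|_{*,i}$ is equivalent to $\|\cdot\|_{\mathrm{BMOSH}(\mathbb{D})}$ on $\mathrm{BMOSH}(\mathbb{D})$.
   Context: Let $\mathbb{H}$ be the quaternions, $\mathbb{S}=\{x\in\mathbb{H}:\mathrm{Re}(x)=0,|x|=1\}$, $\mathbb{C}_i=\{x_0+ix_1:x_0,x_1\in\mathbb{R}\}$ for $i\in\mathbb{S}$, $\mathbb{D}$ the open unit ball of $\mathbb{H}$, $\mathbb{D}_i=\mathbb{D}\cap\mathbb{C}_i$. Every $x\in\mathbb{H}$ is written $x=x_0+i_xx_1$ with $x_0=\mathrm{Re}(x)$, $x_1=|\mathrm{Im}(x)|\ge 0$, $i_x\in\mathbb{S}$. A real differentiable $f:\mathbb{D}\to\mathbb{H}$ is (left) slice hyperholomorphic, $f\in\mathcal{SH}_L(\mathbb{D})$, if $f(x)=\alpha(x_0,x_1)+i_x\beta(x_0,x_1)$ for all $x\in\mathbb{D}$, where the $\mathbb{H}$-valued functions $\alpha,\beta$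 satisfy $\alpha(x_0,-x_1)=\alpha(x_0,x_1)$, $\beta(x_0,-x_1)=-\beta(x_0,x_1)$, $\partial_{x_0}\alpha=\partial_{x_1}\beta$, $\partial_{x_0}\beta=-\partial_{x_1}\alpha$. For $g:\mathbb{D}_i\to\mathbb{H}$ with $\partial_{x_0}g+i\,\partial_{x_1}g=0$, $\mathrm{ext}(g)$ is the unique slice hyperholomorphic function on $\mathbb{D}$ whose restriction to $\mathbb{D}_i$ is $g$; explicitly $\mathrm{ext}(g)(x)=\frac12(1-i_xi)g(x_0+ix_1)+\frac12(1+i_xi)g(x_0-ix_1)$. For $f\in\mathcal{SH}_L(\mathbb{D})$ write $f_i=f|_{\mathbb{D}_i}$. For $f,g\in\mathcal{SH}_L(\mathbb{D})$ with $g(\mathbb{D}_i)\subset\mathbb{D}_i$, the $i$-composition is $f\circ_ig=\mathrm{ext}(f_i\circ g_i)$. For $a\in\mathbb{D}_i$, the slice hyperholomorphic Möbius transformation is $T_a=\mathrm{ext}(T_{a,\mathbb{C}})$, where $T_{a,\mathbb{C}}(z)=(z+a)/(1+\overline{a}z)$ for $z\in\mathbb{D}_i$; thus $f\circ_iT_a=\mathrm{ext}(f_i\circ T_{a,\mathbb{C}})$. $\mathcal{H}^2(\mathbb{D})$ is the set of $f\in\mathcal{SH}_L(\mathbb{D})$ with $\sup_{i\in\mathbb{S}}\lim_{r\nearrow1}\frac1{2\pi}\int_0^{2\pi}|f(re^{i\theta})|^2\,d\theta<\infty$; boundary values at $e^{i\theta}$ are radial limits (existing for almost every $\theta$). For $f\in\mathcal{H}^2(\mathbb{D})$,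 $i\in\mathbb{S}$ and an interval $I=(\alpha,\beta)\subset\mathbb{R}$ with $|I|=\beta-\alpha\le2\pi$, let $f_{I,i}=\frac1{|I|}\int_If(e^{i\theta})\,d\theta$, and put $|f|_{\mathrm{BMOSH}(\mathbb{D}_i)}^2=\sup_{|I|\le2\pi}\frac1{|I|}\int_I|f(e^{i\theta})-f_{I,i}|^2\,d\theta$, $|f|_{\mathrm{BMOSH}(\mathbb{D})}=\sup_{i\in\mathbb{S}}|f|_{\mathrm{BMOSH}(\mathbb{D}_i)}$. $\mathrm{BMOSH}(\mathbb{D})$ is the right $\mathbb{H}$-vector space of $f\in\mathcal{H}^2(\mathbb{D})$ with $|f|_{\mathrm{BMOSH}(\mathbb{D})}<\infty$, with norm $\|f\|_{\mathrm{BMOSH}(\mathbb{D})}=|f(0)|+|f|_{\mathrm{BMOSH}(\mathbb{D})}$. *)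

(* Defs.v *)
From HB Require Import structures.
From mathcomp Require Import all_boot all_order all_algebra.
From mathcomp Require Import all_classical all_reals all_analysis.
From mathcomp Require Import ring.

Set Implicit Arguments.
Unset Strict Implicit.
Unset Printing Implicit Defensive.

Import Order.TTheory GRing.Theory Num.Theory.
Import numFieldNormedType.Exports.

Local Open Scope classical_set_scope.
Local Open Scope ring_scope.

(* [Quat a b c d] is a + b e1 + c e2 + d e3 with e1 e2 = e3, etc. *)
Record quat (R : realType) := Quat { qRe : R; qi : R; qj : R; qk : R }.

Section Quaternions.
Variable R : realType.
Implicit Types x y z : quat R.

Definition quat_pack (t : R * R * R * R) : quat R :=
  let: (a, b, c, d) := t in Quat a b c d.
Definition quat_unpack x := (qRe x, qi x, qj x, qk x).

Lemma quat_unpackK : cancel quat_unpack quat_pack.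
Proof. by case. Qed.

HB.instance Definition _ := Choice.copy (quat R) (can_type quat_unpackK).

Lemma quat_eq x y :
  qRe x = qRe y -> qi x = qi y -> qj x = qj y -> qk x = qk y -> x = y.
Proof. by case: x => ? ? ? ?; case: y => ? ? ? ? /= -> -> -> ->. Qed.

Definition qadd x y :=
  Quat (qRe x + qRe y) (qi x + qi y) (qj x + qj y) (qk x + qk y).
Definition qopp x := Quat (- qRe x) (- qi x) (- qj x) (- qk x).
Definition qscale (k : R) x := Quat (k * qRe x) (k * qi x) (k * qj x) (k * qk x).
Definition qmul x y := Quat
  (qRe x * qRe y - qi x * qi y - qj x * qj y - qk x * qk y)
  (qRe x * qi y + qi x * qRe y + qj x * qk y - qk x * qj y)
  (qRe x * qj y - qi x * qk y + qj x * qRe y + qk x * qi y)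
  (qRe x * qk y + qi x * qj y - qj x * qi y + qk x * qRe y).

Lemma qaddA : associative qadd.
Proof. by move=> x y z; apply: quat_eq => /=; ring. Qed.
Lemma qaddC : commutative qadd.
Proof. by move=> x y; apply: quat_eq => /=; ring. Qed.
Lemma qadd0 : left_id (Quat 0 0 0 0) qadd.
Proof. by move=> x; apply: quat_eq => /=; ring. Qed.
Lemma qaddN : left_inverse (Quat 0 0 0 0) qopp qadd.
Proof. by move=> x; apply: quat_eq => /=; ring. Qed.

HB.instance Definition _ :=
  GRing.isZmodule.Build (quat R) qaddA qaddC qadd0 qaddN.

Lemma qmulA : associative qmul.
Proof. by move=> x y z; apply: quat_eq => /=; ring. Qed.
Lemma qmul1l : left_id (Quat 1 0 0 0) qmul.
Proof. by move=> x; apply: quat_eq => /=; ring. Qed.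
Lemma qmul1r : right_id (Quat 1 0 0 0) qmul.
Proof. by move=> x; apply: quat_eq => /=; ring. Qed.
Lemma qmulDl : left_distributive qmul +%R.
Proof. by move=> x y z; apply: quat_eq => /=; ring. Qed.
Lemma qmulDr : right_distributive qmul +%R.
Proof. by move=> x y z; apply: quat_eq => /=; ring. Qed.
Lemma qone_neq0 : Quat 1 0 0 0 != 0 :> quat R.
Proof. by apply/eqP => -[/eqP]; rewrite oner_eq0. Qed.

HB.instance Definition _ := GRing.Zmodule_isNzRing.Build (quat R)
  qmulA qmul1l qmul1r qmulDl qmulDr qone_neq0.

Lemma qscaleA a b x : qscale a (qscale b x) = qscale (a * b) x.
Proof. by apply: quat_eq => /=; ring. Qed.
Lemma qscale1 : left_id 1 qscale.
Proof. by move=> x; apply: quat_eq => /=; ring. Qed.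
Lemma qscaleDr : right_distributive qscale +%R.
Proof. by move=> k x y; apply: quat_eq => /=; ring. Qed.
Lemma qscaleDl x : {morph qscale^~ x : a b / a + b}.
Proof. by move=> a b; apply: quat_eq => /=; ring. Qed.

HB.instance Definition _ := GRing.Zmodule_isLmodule.Build R (quat R)
  qscaleA qscale1 qscaleDr qscaleDl.

Lemma qscaleAl (k : R) x y : k *: (x * y) = (k *: x) * y.
Proof. by apply: quat_eq => /=; ring. Qed.
HB.instance Definition _ := GRing.Lmodule_isLalgebra.Build R (quat R) qscaleAl.

Lemma qscaleAr (k : R) x y : k *: (x * y) = x * (k *: y).
Proof. by apply: quat_eq => /=; ring. Qed.
HB.instance Definition _ := GRing.Lalgebra_isAlgebra.Build R (quat R) qscaleAr.

Definition qsqnorm x : R :=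
  qRe x ^+ 2 + qi x ^+ 2 + qj x ^+ 2 + qk x ^+ 2.
Definition qnorm x : R := Num.sqrt (qsqnorm x).
Definition qconj x : quat R := Quat (qRe x) (- qi x) (- qj x) (- qk x).
Definition qIm x : quat R := Quat 0 (qi x) (qj x) (qk x).

Lemma qsqnorm_ge0 x : 0 <= qsqnorm x.
Proof. by rewrite /qsqnorm !addr_ge0// sqr_ge0. Qed.

Lemma qsqnorm_eq0 x : (qsqnorm x == 0) = (x == 0).
Proof.
apply/idP/eqP => [|->]; last by rewrite /qsqnorm /= expr0n /= !addr0.
rewrite /qsqnorm !paddr_eq0 ?addr_ge0 ?sqr_ge0// !sqrf_eq0.
by move=> /andP[/andP[/andP[/eqP ? /eqP ?] /eqP ?] /eqP ?]; apply: quat_eq.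
Qed.

Lemma ler_qnormD x y : qnorm (x + y) <= qnorm x + qnorm y.
Proof.
have p0 : 0 <= qnorm x + qnorm y by rewrite addr_ge0 ?sqrtr_ge0.
rewrite -[leRHS]ger0_norm // -sqrtr_sqr; apply: ler_wsqrtr.
set s := qRe x * qRe y + qi x * qi y + qj x * qj y + qk x * qk y.
have -> : qsqnorm (x + y) = qsqnorm x + qsqnorm y + s *+ 2.
  by rewrite /qsqnorm /s /=; ring.
rewrite /qnorm sqrrD !sqr_sqrtr ?qsqnorm_ge0// [leRHS]addrAC lerD2l lerMn2r /=.
rewrite -sqrtrM ?qsqnorm_ge0//; apply: le_trans (ler_norm _) _.
rewrite -sqrtr_sqr; apply: ler_wsqrtr; rewrite -subr_ge0.
have -> : qsqnorm x * qsqnorm y - s ^+ 2 =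
    (qRe x * qi y - qi x * qRe y) ^+ 2 + (qRe x * qj y - qj x * qRe y) ^+ 2 +
    (qRe x * qk y - qk x * qRe y) ^+ 2 + (qi x * qj y - qj x * qi y) ^+ 2 +
    (qi x * qk y - qk x * qi y) ^+ 2 + (qj x * qk y - qk x * qj y) ^+ 2.
  by rewrite /qsqnorm /s; ring.
by rewrite !addr_ge0// sqr_ge0.
Qed.

Lemma qnormZ (k : R) x : qnorm (k *: x) = `|k| * qnorm x.
Proof.
rewrite /qnorm; have -> : qsqnorm (k *: x) = k ^+ 2 * qsqnorm x.
  by rewrite /qsqnorm /=; ring.
by rewrite sqrtrM ?sqr_ge0// sqrtr_sqr.
Qed.

Lemma qnorm0_eq0 x : qnorm x = 0 -> x = 0.
Proof.
by move=> /eqP; rewrite sqrtr_eq0 => h; apply/eqP; rewrite -qsqnorm_eq0 eq_le h qsqnorm_ge0.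
Qed.

(* The norm [`|x|] on [quat R], hence its topology, is the Euclidean one. *)
HB.instance Definition _ :=
  @Lmodule_isNormed.Build R (quat R) qnorm ler_qnormD qnormZ qnorm0_eq0.

Definition qinv x : quat R := (qsqnorm x)^-1 *: qconj x.

Lemma qmulV : {in [pred x : quat R | x != 0], left_inverse 1 qinv *%R}.
Proof.
move=> x; rewrite inE -qsqnorm_eq0 => x0; rewrite /qinv -qscaleAl.
have -> : qconj x * x = qsqnorm x *: 1.
  by apply: quat_eq; rewrite /qsqnorm /=; ring.
by rewrite scalerA mulVf // scale1r.
Qed.

Lemma qmulVr : {in [pred x : quat R | x != 0], right_inverse 1 qinv *%R}.
Proof.
move=> x; rewrite inE -qsqnorm_eq0 => x0; rewrite /qinv -qscaleAr.
have -> : x * qconj x = qsqnorm x *: 1.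
  by apply: quat_eq; rewrite /qsqnorm /=; ring.
by rewrite scalerA mulVf // scale1r.
Qed.

Lemma qunitP x y : y * x = 1 /\ x * y = 1 -> x \in [pred x : quat R | x != 0].
Proof.
case=> h _; rewrite inE; apply/eqP => x0.
by move: h; rewrite x0 mulr0 => /esym/eqP; rewrite oner_eq0.
Qed.

Lemma qinv_out : {in [predC [pred x : quat R | x != 0]], qinv =1 id}.
Proof. by move=> x; rewrite !inE negbK => /eqP ->; apply: quat_eq; rewrite /= ?oppr0 mulr0. Qed.

HB.instance Definition _ :=
  GRing.NzRing_hasMulInverse.Build (quat R) qmulV qmulVr qunitP qinv_out.

End Quaternions.

Section SliceHyperholomorphic.
Variable R : realType.
Local Notation H := (quat R).
Local Notation mu := (@lebesgue_measure R).
Implicit Types (i x a q : H) (f g : H -> H).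

Definition qsphere : set H := [set i | qRe i = 0 /\ `|i| = 1].

Definition slice i (u v : R) : H := u%:A + v *: i.

Definition Cplane i : set H := [set x | exists u v : R, x = slice i u v].

Definition qdisc : set H := [set x | `|x| < 1].

Definition qdisc_slice i : set H := qdisc `&` Cplane i.

(* The i_x in x = x_0 + i_x x_1; for real x it is arbitrary, and taken to be
   e1, which does not affect any notion below. *)
Definition idir x : H :=
  if qIm x == 0 then Quat 0 1 0 0 else `|qIm x|^-1 *: qIm x.

(* Functions on [qdisc] are represented by total functions H -> H, and their
   values outside [qdisc] are never used. *)
Definition slice_hyperholomorphic f : Prop :=
  (forall x, qdisc x -> differentiable f x) /\
  exists al be : R -> R -> H,
    (forall x, qdisc x ->
      f x = al (qRe x) `|qIm x| + idir x * be (qRe x) `|qIm x|) /\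
    forall u v : R, u ^+ 2 + v ^+ 2 < 1 ->
      [/\ al u (- v) = al u v /\ be u (- v) = - be u v,
          derivable (al^~ v) u 1 /\ derivable (al u) v 1,
          derivable (be^~ v) u 1 /\ derivable (be u) v 1,
          derive1 (al^~ v) u = derive1 (be u) v &
          derive1 (be^~ v) u = - derive1 (al u) v].

(* Only the values of [g] on [qdisc_slice i] matter for x in [qdisc]. *)
Definition ext i g : H -> H := fun x =>
  2^-1 *: ((1 - idir x * i) * g (slice i (qRe x) `|qIm x|)) +
  2^-1 *: ((1 + idir x * i) * g (slice i (qRe x) (- `|qIm x|))).

Definition icomp i f g : H -> H := ext i (f \o g).

(* On C_i (a, z in the disc) numerator and denominator commute and the
   denominator is nonzero. *)
Definition moebiusC a : H -> H := fun z => (z + a) / (1 + qconj a * z).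

Definition moebius i a : H -> H := ext i (moebiusC a).

Definition qexp i (t : R) : H := slice i (cos t) (sin t).

(* Boundary value at e^{it}: the radial limit, where it exists. *)
Definition bval f i (t : R) : H := lim (f (r *: qexp i t) @[r --> (1 : R)^'-]).

Definition hardy2 f : Prop :=
  slice_hyperholomorphic f /\
  (ereal_sup [set lim ((((2 * pi)^-1)%:E *
      \int[mu]_(t in `[0%R, (2 * pi)%R]) (`|f (r *: qexp i t)| ^+ 2)%:E)%E
      @[r --> (1 : R)^'-]) | i in qsphere] < +oo)%E.

Definition qRintegral (A : set R) (F : R -> H) : H :=
  Quat (\int[mu]_(t in A) qRe (F t)) (\int[mu]_(t in A) qi (F t))
       (\int[mu]_(t in A) qj (F t)) (\int[mu]_(t in A) qk (F t)).

Definition bmean f i (s t : R) : H :=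
  (t - s)^-1 *: qRintegral `]s, t[ (bval f i).

Definition osc2 f i (s t : R) : \bar R :=
  (((t - s)^-1)%:E * \int[mu]_(u in `]s, t[)
     (`|bval f i u - bmean f i s t| ^+ 2)%:E)%E.

Definition bmosh_slice f i : \bar R :=
  poweR (ereal_sup [set osc2 f i I.1 I.2
    | I in [set I : R * R | I.1 < I.2 /\ I.2 - I.1 <= 2 * pi]]) 2^-1.

Definition bmosh_seminorm f : \bar R :=
  ereal_sup [set bmosh_slice f i | i in qsphere].

Definition BMOSH : set (H -> H) :=
  [set f | hardy2 f /\ (bmosh_seminorm f < +oo)%E].

Definition bmosh_norm f : \bar R := (`|f 0|%:E + bmosh_seminorm f)%E.

Definition star_seminorm i f : \bar R :=
  poweR (ereal_sup [set (((2 * pi)^-1)%:E * \int[mu]_(t in `[(- pi)%R, pi])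
       (`|bval (icomp i f (moebius i a)) i t - f a| ^+ 2)%:E)%E
     | a in qdisc_slice i]) 2^-1.

Definition star_norm i f : \bar R := (`|f 0|%:E + star_seminorm i f)%E.

(* Finite-valued seminorms on a right H-vector space V of functions on [qdisc]. *)
Definition is_seminorm_on (V : set (H -> H)) (N : (H -> H) -> \bar R) : Prop :=
  [/\ forall f, V f -> (0 <= N f < +oo)%E,
      forall f g, V f -> V g -> (N (f \+ g)%R <= N f + N g)%E &
      forall f q, V f -> N (fun x => f x * q) = (N f * `|q|%:E)%E].

(* Definiteness is up to equality on [qdisc]. *)
Definition is_norm_on (V : set (H -> H)) (N : (H -> H) -> \bar R) : Prop :=
  is_seminorm_on V N /\
  forall f, V f -> N f = 0%E -> forall x, qdisc x -> f x = 0.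

Definition equivalent_on (V : set (H -> H)) (N M : (H -> H) -> \bar R) : Prop :=
  exists c C : R, [/\ 0 < c, 0 < C &
    forall f, V f -> (c%:E * M f <= N f <= C%:E * M f)%E].

End SliceHyperholomorphic.

Arguments qsphere R : clear implicits.
Arguments BMOSH R : clear implicits.

(* Main.v *)
(* On a slice C_i a slice hyperholomorphic function f is holomorphic for the left
   multiplication by C_i (Goursat's bisection replaces continuity of the
   derivative), so its real coordinates u satisfy the Poisson formula on smaller
   discs. The operators sending u on the circle of radius r to u on the circle of
   radius rp are self-adjoint and commute; hence for f in H^2 the circle functions
   are Cauchy in L^2, u is the Poisson integral of a boundary function F, and the
   radial limit of u is F at every Lebesgue point.

   Changing variables along the circle map induced by T_a turns the mean of
   |f o_i T_a - f(a)|^2 into the integral of |F - f(a)|^2 against the Poisson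
   kernel at a. The seminorm axioms are then Minkowski's inequality, and
   T_a T_b = T_(T_a b) up to a rotation, so replacing f by f o_i T_a only permutes
   the points over which the supremum is taken.

   The kernel at a is at least a constant over |I| on the arc I centred at a/|a| of
   length comparable to 1 - |a|, which bounds the mean oscillation. Conversely it is at most
   4 sum_(k <= n) 4^k 2^-n 1_(|x| <= pi 2^-k) when 1 - |a| is of order 2^-n, and
   the means of F over consecutive dyadic arcs differ by at most the square root
   of twice the squared BMO seminorm. Different slices are compared through
   f(x + j y) = (1 - j i) f(x + i y) / 2 + (1 + j i) f(x - i y) / 2. *)

Require Import Defs.
From HB Require Import structures.
From mathcomp Require Import all_boot all_order all_algebra.
From mathcomp Require Import all_classical all_reals all_analysis.
From mathcomp Require Import measurable_realfun.
From mathcomp Require Import ring lra.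
From mathcomp Require Import complex.

Set Implicit Arguments.
Unset Strict Implicit.
Unset Printing Implicit Defensive.

Import Order.TTheory GRing.Theory Num.Theory.
Import numFieldNormedType.Exports.

Import Normc.

Local Open Scope classical_set_scope.
Local Open Scope ring_scope.

(** * Change of variables and integrals of periodic functions *)

(** Boundary values are pointwise [lim]s, so at first neither their existence nor their
    measurability is known, although the definitions integrate them. The proof never estimates
    [bval] directly. It builds a function F on the whole line, measurable and 2 pi-periodic, such
    that every real function Re (c f) on the slice is the Poisson integral of Re (c F), and
    exchanges [bval] for F under the integral sign by a comparison valid for arbitrary functions
    that agree almost everywhere. Afterwards a bound N f <= x for either seminorm on C_i just says
    that each of a family of real integrals of F is at most x^2.

    Invariance also requires f o_i T_a to be in BMOSH again: the extension must be really
    differentiable on the whole ball, including at real points, where i_x is discontinuous, and the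
    bounds must hold on every slice. Both are recovered from data on C_i.

    Constants, for squared seminorms: on one real coordinate Garsia's integral costs 384 and the
    converse 17; four coordinates give 1536 and 68; changing the slice multiplies by 4. Finally 1536
    <= 40^2 and 4 * 68 <= 18^2. *)

Section AeIntegral.
Context d (T : measurableType d) (R : realType).
Variables (mu : {measure set T -> \bar R}).
Import HBNNSimple.
Local Open Scope ereal_scope.

(** The functions are arbitrary because one of them will be built from [bval]. The integral is a
    supremum over simple functions below f; cutting such a function to 0 on the exceptional null set
    N keeps its integral and puts it below g. *)
Lemma ge0_le_integral_ae (D : set T) (f g : T -> \bar R) :
  measurable D -> (forall x, D x -> 0 <= f x) -> (forall x, D x -> 0 <= g x) ->
  {ae mu, forall x, D x -> f x <= g x} ->
  \int[mu]_(x in D) f x <= \int[mu]_(x in D) g x.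
Proof.
move=> mD f0 g0 [N [mN N0 fgN]].
rewrite [leLHS]integral_mkcond [leRHS]integral_mkcond.
rewrite ge0_integralTE; last exact/erestrict_ge0.
rewrite (@ge0_integralTE _ _ _ _ (g \_ D)); last exact/erestrict_ge0.
apply: ge_ereal_sup => _ /= [h hf <-].
have mCN : measurable (~` N) by exact: measurableC.
pose h' := proj_nnsfun h mCN.
have -> : sintegral mu h = sintegral mu h'.
  rewrite -!integralT_nnsfun; apply: ge0_ae_eq_integral => //.
  - exact/measurable_EFinP.
  - exact/measurable_EFinP.
  - by move=> x _; rewrite lee_fin.
  - by move=> x _; rewrite lee_fin.
  - exists N; split => // x /= /not_implyP[_ hx].
    apply: contrapT => Nx; apply: hx.
    by rewrite /h' /= /proj_nnsfun /= /mindic indicE mem_set//= mulr1.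
apply: ereal_sup_ubound; exists h' => // x.
rewrite /h' /= /mindic indicE.
have [xN|xN] := boolP (x \in ~` N); last first.
  by rewrite mulr0 erestrict_ge0.
rewrite mulr1; apply: le_trans (hf x) _.
rewrite !patchE; case: ifPn => // xD.
rewrite leNgt; apply/negP => gf; move: xN; rewrite inE; apply.
by apply: fgN => /= /(_ (set_mem xD)); rewrite leNgt gf.
Qed.

Lemma ae_eq_integral_gen (D : set T) (f g : T -> \bar R) :
  measurable D -> {ae mu, forall x, D x -> f x = g x} ->
  \int[mu]_(x in D) f x = \int[mu]_(x in D) g x.
Proof.
move=> mD fg; rewrite integralE [RHS]integralE; congr (_ - _);
  apply/eqP; rewrite eq_le; apply/andP; split; apply: ge0_le_integral_ae => //;
  by apply: filterS fg => x /[apply]; rewrite ?(funeposE, funenegE) => ->.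
Qed.

End AeIntegral.

Section ChangeOfVariables.
Context {R : realType}.
Local Notation mu := (@lebesgue_measure R).

Variables (phi phi' : R -> R).
Hypothesis dphi : forall x, is_derive x (1 : R) phi (phi' x).
Hypothesis cphi' : continuous phi'.
Hypothesis phi'_gt0 : forall x, 0 < phi' x.

Lemma cv_continuous : continuous phi.
Proof. by move=> x; apply: differentiable_continuous; apply/derivable1_diffP; case: (dphi x). Qed.

Lemma cv_incr : {homo phi : x y / x < y}.
Proof.
move=> x y xy.
have [c _ ec] := MVT xy (fun z _ => dphi z) (continuous_subspaceT (@cv_continuous)).
by rewrite -subr_gt0 ec mulr_gt0// subr_gt0.
Qed.

Lemma cv_lt x y : (phi x < phi y) = (x < y).
Proof. exact: (leW_mono (le_mono cv_incr)). Qed.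

Lemma cv_le x y : (phi x <= phi y) = (x <= y).
Proof. exact: (le_mono cv_incr). Qed.

Hypothesis phi_surj : forall y, exists x, phi x = y.

Let mphi : measurable_fun setT (phi : R -> measurableTypeR R).
Proof. exact: continuous_measurable_fun cv_continuous. Qed.

Let mphi' : measurable_fun setT phi'.
Proof. exact: continuous_measurable_fun. Qed.

Local Open Scope ereal_scope.

Let nu (A : set (measurableTypeR R)) : \bar R :=
  \int[mu]_(x in phi @^-1` A) (phi' x)%:E.

Let nu0 : nu set0 = 0.
Proof. by rewrite /nu preimage_set0 integral_set0. Qed.

Let nu_ge0 A : 0 <= nu A.
Proof. by apply: integral_ge0 => x _; rewrite lee_fin ltW. Qed.

Let mpre (A : set (measurableTypeR R)) :
  measurable A -> measurable (phi @^-1` A).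
Proof. by move=> mA; rewrite -[X in measurable X]setTI; exact: mphi. Qed.

Let nu_sigma : semi_sigma_additive nu.
Proof.
move=> F mF tF mUF; rewrite /nu preimage_bigcup.
rewrite ge0_integral_bigcup//=; first last.
- apply/trivIsetP => i j _ _ ij; rewrite -preimage_setI.
  by move/trivIsetP : tF => ->//; rewrite preimage_set0.
- by move=> x _; rewrite lee_fin ltW.
- by apply/measurable_EFinP; exact: measurable_funTS.
- by move=> n; apply mpre; apply mF.
by apply: is_cvg_nneseries => n _ _; exact: (nu_ge0 (F n)).
Qed.

HB.instance Definition _ := isMeasure.Build _ _ _ nu nu0 nu_ge0 nu_sigma.

(** Lebesgue measure is determined by its values on half-open intervals, and there the fundamental
    theorem of calculus computes [nu]. The substitution rule then follows for simple functions and
    by monotone convergence. *)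
Let nuE A : measurable A -> nu A = mu A.
Proof.
move=> mA; apply/esym.
apply: (@lebesgue_measure_unique R nu) mA => X [[a b]] /= _ <-.
rewrite lebesgue_measure_itv/= lte_fin.
have [x0 ex] := phi_surj a; have [y0 ey] := phi_surj b.
have -> : nu `]a, b]%classic = \int[mu]_(x in `]x0, y0]) (phi' x)%:E.
  rewrite /nu; congr (integral _ _ _); apply/seteqP; split => x /=;
    by rewrite !in_itv/= -ex -ey cv_lt cv_le.
rewrite -ex -ey cv_lt; case: ifPn => [xy|]; last first.
  by rewrite -leNgt => yx; rewrite set_itv_ge ?integral_set0// bnd_simp -leNgt.
rewrite integral_itv_obnd_cbnd; last by apply/measurable_EFinP; exact: measurable_funTS.
rewrite (@continuous_FTC2 _ _ phi)//.
- exact: continuous_subspaceT.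
- split => [x _||]; first by case: (dphi x).
  + exact/cvg_at_right_filter/cv_continuous.
  + exact/cvg_at_left_filter/cv_continuous.
- by move=> x _; rewrite derive1E; case: (dphi x).
Qed.

Import HBNNSimple.

Let cv_nnsfun (h : {nnsfun (measurableTypeR R) >-> R}) :
  \int[mu]_x (h x)%:E = \int[mu]_x (h (phi x) * phi' x)%:E.
Proof.
under eq_integral do rewrite fimfunE -fsumEFin//.
rewrite ge0_integral_fsum//; last 2 first.
- by move=> r; exact/measurable_EFinP/measurable_funM.
- by move=> n x _; rewrite nnfun_muleindic_ge0.
have hE x : (h (phi x) * phi' x)%:E =
    \sum_(k \in range h) (k * \1_(h @^-1` [set k]) (phi x))%:E * (phi' x)%:E.
  rewrite fimfunE EFinM -fsumEFin// ge0_mule_fsuml// => r.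
  exact: nnfun_muleindic_ge0.
under [RHS]eq_integral do rewrite hE.
rewrite [RHS]ge0_integral_fsum//; last 2 first.
- move=> r; apply: emeasurable_funM; last exact/measurable_EFinP.
  apply/measurable_EFinP/measurable_funM => //.
  exact: (measurableT_comp (measurable_indic _)).
- by move=> n x _; rewrite mule_ge0 ?nnfun_muleindic_ge0// lee_fin ltW.
apply: eq_fsbigr => r _.
rewrite integralZl_indic_nnsfun// integral_indic// setIT.
transitivity (r%:E * nu (h @^-1` [set r])).
  by congr (_ * _); apply/esym; apply: nuE.
rewrite /nu.
have [r0|r0] := ltP r 0%R.
  rewrite preimage_nnfun0// preimage_set0 integral_set0 mule0 integral0_eq//.
  by move=> x _; rewrite indicE in_set0 mulr0 mul0e.
under [RHS]eq_integral do rewrite EFinM -muleA.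
rewrite [RHS]ge0_integralZl//; last 2 first.
- apply/measurable_EFinP/measurable_funM => //.
  exact: (measurableT_comp (measurable_indic _)).
- by move=> x _; rewrite lee_fin mulr_ge0// ltW.
congr (_ * _); rewrite [LHS]integral_mkcond; congr (integral _ _ _).
apply/funext => x.
rewrite patchE indicE.
have -> : (phi x \in h @^-1` [set r]) = (x \in phi @^-1` (h @^-1` [set r])).
  by apply/idP/idP => /set_mem H; apply/mem_set.
by case: ifPn => _; rewrite ?mul1e ?mul0e.
Qed.

Lemma ge0_change_of_variables (h : R -> \bar R) :
  measurable_fun [set: measurableTypeR R] h -> (forall x, 0 <= h x) ->
  \int[mu]_x h x = \int[mu]_x (h (phi x) * (phi' x)%:E).
Proof.
move=> mh h0; pose f_ := nnsfun_approx measurableT mh.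
have cvgf x : EFin \o f_^~ x @ \oo --> h x by apply: cvg_nnsfun_approx.
have ndf m n x : (m <= n)%N -> (f_ m x <= f_ n x)%R.
  by move=> mn; move: x; apply/lefP; exact: nd_nnsfun_approx.
transitivity (limn (fun n => \int[mu]_x (f_ n x)%:E)).
  rewrite -monotone_convergence//.
  - by apply: eq_integral => y _; apply/esym/cvg_lim => //; exact: cvgf.
  - move=> n; apply/measurable_EFinP.
    exact: (@measurable_funP _ _ _ _ setT (f_ n)).
  - by move=> n y _; rewrite lee_fin.
  - by move=> y _ m n mn; rewrite lee_fin; exact: ndf.
under eq_fun do rewrite cv_nnsfun.
rewrite -monotone_convergence//.
- apply: eq_integral => x _; apply/cvg_lim => //.
  under eq_fun do rewrite EFinM.
  by apply: cvgeZr => //; exact: cvgf.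
- move=> n; apply/measurable_EFinP/measurable_funM => //.
  exact: (measurableT_comp (@measurable_funP _ _ _ _ setT (f_ n)) mphi).
- by move=> n x _; rewrite lee_fin mulr_ge0// ltW.
- move=> x _ m n mn; rewrite lee_fin.
  by apply: ler_wpM2r; [exact: ltW|exact: ndf].
Qed.

End ChangeOfVariables.

Section LocalCalculus.
Context {R : realType}.
Local Notation mu := (@lebesgue_measure R).
Implicit Types (a b c s t : R) (g h : R -> R).

(** Measurability is asked on the whole line so that shifts, reflections and circle maps can be
    substituted freely, with integrals over any segment. *)
Definition lint h : Prop := measurable_fun [set: measurableTypeR R] h /\
  forall a b, mu.-integrable `[a, b] (EFin \o h).

Definition J a b h : R := \int[mu]_(t in `[a, b]) h t.

Lemma lint_int h a b : lint h -> mu.-integrable `[a, b] (EFin \o h).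
Proof. by case. Qed.

Lemma lintD g h : lint g -> lint h -> lint (fun t => g t + h t).
Proof.
move=> [mg ig] [mh ih]; split; first exact: measurable_funD.
by move=> a b; apply: (integrableD _ (ig a b) (ih a b)).
Qed.

Lemma lintZ k h : lint h -> lint (fun t => k * h t).
Proof.
move=> [mh ih]; split; first exact: measurable_funM.
by move=> a b; exact: (integrableZl _ k (ih a b)).
Qed.

Lemma lintN h : lint h -> lint (fun t => - h t).
Proof. by move=> /(lintZ (-1)); under eq_fun do rewrite mulN1r. Qed.

Lemma lintB g h : lint g -> lint h -> lint (fun t => g t - h t).
Proof. by move=> lg lh; exact: lintD lg (lintN lh). Qed.

Lemma lintMc g h : continuous g -> lint h -> lint (fun t => g t * h t).
Proof.
move=> cg [mh ih].
have mg : measurable_fun [set: measurableTypeR R] g by exact: continuous_measurable_fun.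
split; first exact: measurable_funM.
move=> a b.
rewrite (_ : EFin \o _ = ((EFin \o g) \* (EFin \o h))%E); last exact/funext.
apply: integrableMr => //.
- exact: measurable_funS mg.
- have /compact_bounded[M [Mr HM]] :=
    continuous_compact (continuous_subspaceT cg) (@segment_compact R a b).
  by exists M; split => // N MN x abx; apply: HM => //; exists x.
Qed.

Lemma lint_cst k : lint (fun=> k).
Proof.
split; first exact: measurable_cst.
move=> a b; apply: continuous_compact_integrable; first exact: segment_compact.
by apply: continuous_subspaceT => x; exact: cvg_cst.
Qed.

Lemma lint_cont h : continuous h -> lint h.
Proof.
move=> ch; have := lintMc ch (lint_cst 1).
by under eq_fun do rewrite mulr1.
Qed.

Lemma lint_norm h : lint h -> lint (fun t => `|h t|).
Proof.
move=> [mh ih]; split; first exact: measurableT_comp.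
by move=> a b; exact: integrable_norm.
Qed.

Lemma lint_le g h : measurable_fun [set: measurableTypeR R] g ->
  (forall t, `|g t| <= h t) -> lint h -> lint g.
Proof.
move=> mg gh [mh ih]; split=> // a b; apply: (le_integrable _ _ _ (ih a b)) => //.
  by apply/measurable_EFinP; exact: measurable_funS mg.
by move=> t _ /=; rewrite lee_fin (le_trans (gh t))// ler_norm.
Qed.

Lemma JE h a b : lint h -> (J a b h)%:E = (\int[mu]_(t in `[a, b]) (h t)%:E)%E.
Proof. by move=> [_ ih]; rewrite /J /Rintegral fineK//; exact: integrable_fin_num. Qed.

Lemma JD a b g h : lint g -> lint h -> J a b (fun t => g t + h t) = J a b g + J a b h.
Proof. by move=> [_ ig] [_ ih]; rewrite /J RintegralD. Qed.

Lemma JB a b g h : lint g -> lint h -> J a b (fun t => g t - h t) = J a b g - J a b h.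
Proof. by move=> [_ ig] [_ ih]; rewrite /J RintegralB. Qed.

Lemma JZ a b k h : lint h -> J a b (fun t => k * h t) = k * J a b h.
Proof. by move=> [_ ih]; rewrite /J RintegralZl. Qed.

Lemma J_cst a b k : a <= b -> J a b (fun=> k) = k * (b - a).
Proof.
move=> ab; rewrite /J Rintegral_cst//= lebesgue_measure_itv/= lte_fin.
by case: ltP => [//|ba]; rewrite (le_anti (introT andP (conj ab ba))) subrr.
Qed.

Lemma J_ge0 a b h : (forall t, 0 <= h t) -> 0 <= J a b h.
Proof. by move=> h0; apply: Rintegral_ge0. Qed.

Lemma J_le a b g h : lint g -> lint h -> (forall t, a <= t <= b -> g t <= h t) ->
  J a b g <= J a b h.
Proof.
by move=> [_ ig] [_ ih] gh; apply: le_Rintegral => // t; rewrite /= in_itv/=; exact: gh.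
Qed.

Lemma J_eq a b g h : (forall t, a <= t <= b -> g t = h t) -> J a b g = J a b h.
Proof.
by move=> gh; apply: eq_Rintegral => t /[!inE] /=; rewrite in_itv/=; exact: gh.
Qed.

Lemma J_norm a b h : lint h -> `|J a b h| <= J a b (fun t => `|h t|).
Proof. by move=> [_ ih]; exact: le_normr_Rintegral. Qed.

Lemma J_split a b c h : a <= b -> b <= c -> lint h -> J a c h = J a b h + J b c h.
Proof.
move=> ab bc [mh ih]; have := @Rintegral_itvB _ h (BLeft a) (BRight c) b (ih a c).
rewrite !bnd_simp => /(_ ab bc) E.
rewrite /J -(Rintegral_itv_obnd_cbnd (r := b)); last first.
  by apply: integrableS (ih b c) => //; apply: subset_itvr; rewrite bnd_simp.
by rewrite -E addrC subrK.
Qed.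

Lemma J_le_set a b c d h : lint h -> (forall t, 0 <= h t) -> c <= a -> a <= b -> b <= d ->
  J a b h <= J c d h.
Proof.
move=> lh h0 ca ab bd; rewrite (@J_split c a d)//; last by rewrite (le_trans ab).
rewrite (@J_split a b d)//.
by have := J_ge0 c a h0; have := J_ge0 b d h0; lra.
Qed.

End LocalCalculus.

Section CvJ.
Context {R : realType}.
Local Notation mu := (@lebesgue_measure R).
Variables (phi phi' : R -> R).
Hypothesis dphi : forall x, is_derive x (1 : R) phi (phi' x).
Hypothesis cphi' : continuous phi'.
Hypothesis phi'_gt0 : forall x, 0 < phi' x.
Hypothesis phi_surj : forall y, exists x, phi x = y.

Local Open Scope ereal_scope.

Lemma ge0_cv_itv (h : R -> \bar R) a b :
  measurable_fun [set: measurableTypeR R] h -> (forall x, 0 <= h x) ->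
  \int[mu]_(x in `[phi a, phi b]) h x =
  \int[mu]_(x in `[a, b]) (h (phi x) * (phi' x)%:E).
Proof.
move=> mh h0; rewrite integral_mkcond.
rewrite (ge0_change_of_variables dphi cphi' phi'_gt0 phi_surj); last 2 first.
- by apply/(measurable_restrictT _ _).1 => //; exact: measurable_funS mh.
- by move=> x; rewrite patchE; case: ifPn.
rewrite [RHS]integral_mkcond; congr (integral _ _ _); apply/funext => x.
rewrite !patchE.
have -> : (phi x \in `[phi a, phi b]%classic) = (x \in `[a, b]%classic).
  by rewrite !mem_setE !in_itv/= !(cv_le dphi phi'_gt0).
by case: ifPn; rewrite ?mul0e.
Qed.

Lemma cv_itv (h : R -> R) a b : measurable_fun [set: measurableTypeR R] h ->
  \int[mu]_(x in `[phi a, phi b]) (h x)%:E =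
  \int[mu]_(x in `[a, b]) (h (phi x) * phi' x)%:E.
Proof.
move=> mh; rewrite integralE [RHS]integralE; congr (_ - _).
- rewrite ge0_cv_itv//; last exact/measurable_funepos/measurable_EFinP.
  apply: eq_integral => x _; rewrite !funeposE.
  by rewrite /= -!EFin_max -EFinM maxr_pMl ?ltW// mul0r.
- rewrite ge0_cv_itv//; last exact/measurable_funeneg/measurable_EFinP.
  apply: eq_integral => x _; rewrite !funenegE.
  by rewrite /= -!EFin_max -EFinM maxr_pMl ?ltW// mul0r mulNr.
Qed.

Lemma J_cv (h : R -> R) a b : measurable_fun [set: measurableTypeR R] h ->
  (J (phi a) (phi b) h = J a b (fun t => h (phi t) * phi' t))%R.
Proof. by move=> mh; rewrite /J /Rintegral cv_itv. Qed.

Let mphi : measurable_fun [set: measurableTypeR R] phi.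
Proof. exact: continuous_measurable_fun (cv_continuous dphi). Qed.

Lemma lint_cv (h : R -> R) : lint h -> lint (fun t => h (phi t) * phi' t)%R.
Proof.
move=> [mh ih].
have mc : measurable_fun [set: measurableTypeR R] (fun t => h (phi t) * phi' t)%R.
  apply: measurable_funM; last exact: continuous_measurable_fun.
  exact: measurableT_comp mh mphi.
split=> // a b; apply/integrableP; split.
  by apply/measurable_EFinP; exact: measurable_funS mc.
have /integrableP[_] := ih (phi a) (phi b).
rewrite (ge0_cv_itv (h := fun x => `|(h x)%:E|))//; last first.
  by apply: measurableT_comp => //; exact/measurable_EFinP.
apply: le_lt_trans; rewrite le_eqVlt; apply/orP; left; apply/eqP.
apply: eq_integral => x _; rewrite /= -EFinM normrM; congr (_ * _)%:E.
by rewrite gtr0_norm.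
Qed.

(** The weight phi' from the substitution is removed by its inverse, continuous because phi' > 0. *)
Lemma lint_comp (h : R -> R) : lint h -> lint (fun t => h (phi t)).
Proof.
move=> /lint_cv lh.
have ci : continuous (fun t => (phi' t)^-1)%R.
  by move=> t; apply: cvgV; [rewrite gt_eqF|exact: cphi'].
have := lintMc ci lh.
by under eq_fun do rewrite mulrC mulfK ?gt_eqF//.
Qed.

End CvJ.

Section ShiftReflection.
Context {R : realType}.
Local Notation mu := (@lebesgue_measure R).
Implicit Types (a b c s t : R) (g h : R -> R).

Let shift_derive c x : is_derive x (1 : R) (fun t : R => t + c) (cst 1 x).
Proof. by apply: is_derive_eq; rewrite addr0. Qed.

Let cst_cont : continuous (cst 1 : R -> R).
Proof. by move=> x; exact: cvg_cst. Qed.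

Let cst_gt0 (x : R) : 0 < (cst 1 x : R).
Proof. exact: ltr01. Qed.

Let shift_surj c y : exists x : R, x + c = y.
Proof. by exists (y - c); rewrite subrK. Qed.

Lemma J_shift c a b h : measurable_fun [set: measurableTypeR R] h ->
  J (a + c) (b + c) h = J a b (fun t => h (t + c)).
Proof.
move=> mh; have -> := J_cv (shift_derive c) cst_cont cst_gt0 (shift_surj c) a b mh.
by apply: J_eq => t _; rewrite mulr1.
Qed.

Lemma lint_shift c h : lint h -> lint (fun t => h (t + c)).
Proof.
exact: (lint_comp (shift_derive c) cst_cont cst_gt0 (shift_surj c)).
Qed.

Lemma integral_opp (h : R -> \bar R) a b :
  measurable_fun [set: measurableTypeR R] h -> (forall x, 0 <= h x)%E ->
  (\int[mu]_(x in `[(- b)%R, (- a)%R]) h x = \int[mu]_(x in `[a, b]) h (- x)%R)%E.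
Proof.
move=> mh h0.
have -> : `[a, b]%classic = (-%R : _ -> measurableTypeR R) @^-1` `[- b, - a].
  by rewrite opp_preimage_itvbndbnd/= !opprK.
rewrite -ge0_integral_pushforward//=; last exact: measurable_funS mh.
by apply: eq_measure_integral => //= A mA AS; exact/esym/lebesgue_measureN.
Qed.

Lemma lint_opp h : lint h -> lint (fun t => h (- t)).
Proof.
move=> [mh ih].
have mc : measurable_fun [set: measurableTypeR R] (fun t => h (- t)).
  by apply: (measurableT_comp mh); exact: oppr_measurable.
split=> // a b; apply/integrableP; split.
  by apply/measurable_EFinP; exact: measurable_funS mc.
have /integrableP[_] := ih (- b) (- a).
rewrite integral_opp//.
by apply: measurableT_comp => //; exact/measurable_EFinP.
Qed.

Lemma J_opp a b h : measurable_fun [set: measurableTypeR R] h ->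
  J (- b) (- a) h = J a b (fun t => h (- t)).
Proof.
move=> mh; rewrite /J /Rintegral; congr fine.
rewrite integralE [RHS]integralE; congr (_ - _)%E.
- rewrite integral_opp//; last exact/measurable_funepos/measurable_EFinP.
  by apply: eq_integral => x _; rewrite !funeposE.
- rewrite integral_opp//; last exact/measurable_funeneg/measurable_EFinP.
  by apply: eq_integral => x _; rewrite !funenegE.
Qed.

Lemma periodic_int h (m : int) t : periodic h (2 * pi) -> h (t + m%:~R * (2 * pi)) = h t.
Proof.
move=> ph; have pn (n : nat) u : h (u + n%:R * (2 * pi)) = h u.
  elim: n u => [|n IH] u; first by rewrite mul0r addr0.
  by rewrite -natr1 mulrDl mul1r addrA ph IH.
case: m => n; first exact: pn.
by rewrite NegzE rmorphN/= mulNr -(pn n.+1 (t - _)) subrK.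
Qed.

Let twopi_gt0 : 0 < 2 * pi :> R.
Proof. by rewrite mulr_gt0// pi_gt0. Qed.

Lemma period_rep s : exists (m : int) (s' : R),
  s = s' + m%:~R * (2 * pi) /\ 0 <= s' < 2 * pi.
Proof.
exists (Num.floor (s / (2 * pi))), (s - (Num.floor (s / (2 * pi)))%:~R * (2 * pi)).
split; first by rewrite subrK.
have /andP[h1 h2] := floor_itv (s / (2 * pi)).
rewrite subr_ge0 -ler_pdivlMr// h1/= ltrBlDl.
by move: h2; rewrite intrD ltr_pdivrMr// mulrDl mul1r.
Qed.

Lemma J_period s h : lint h -> periodic h (2 * pi) -> J s (s + 2 * pi) h = J 0 (2 * pi) h.
Proof.
move=> lh ph; have [m [s' [-> /andP[s0 s1]]]] := period_rep s.
rewrite addrAC J_shift; last by case: lh.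
under J_eq do rewrite periodic_int//.
rewrite (@J_split _ s' (2 * pi) (s' + 2 * pi) h)//; [|exact: ltW|by rewrite lerDr].
rewrite -{2}(add0r (2 * pi)) J_shift; last by case: lh.
under [X in _ + X]J_eq do rewrite ph.
by rewrite addrC -J_split// ltW.
Qed.

Lemma lint_periodic h : measurable_fun [set: measurableTypeR R] h -> periodic h (2 * pi) ->
  mu.-integrable `[0, 2 * pi] (EFin \o h) -> lint h.
Proof.
move=> mh ph i0; split => // a b.
have ishift c u v : mu.-integrable `[u, v] (EFin \o (fun t => h (t + c))) ->
    mu.-integrable `[u + c, v + c] (EFin \o h).
  move=> /integrableP[_ H]; apply/integrableP; split.
    by apply/measurable_EFinP; exact: measurable_funS mh.
  rewrite (ge0_cv_itv (shift_derive c) cst_cont cst_gt0 (shift_surj c)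
    (h := fun x => `|(h x)%:E|%E))//; last first.
    by apply: measurableT_comp => //; exact/measurable_EFinP.
  by under eq_integral do rewrite mule1.
have iN (n : nat) : mu.-integrable `[0, n%:R * (2 * pi)] (EFin \o h).
  elim: n => [|n IH].
    by rewrite mul0r; apply: integrableS i0 => //; apply: subset_itvl; rewrite bnd_simp ltW.
  have iN1 : mu.-integrable `[n%:R * (2 * pi), n.+1%:R * (2 * pi)] (EFin \o h).
    have := @ishift (n%:R * (2 * pi)) 0 (2 * pi).
    have e : (2 * pi : R) + n%:R * (2 * pi) = n.+1%:R * (2 * pi) :> R.
      by rewrite -[n.+1]addn1 natrD; ring.
    rewrite add0r e; apply.
    rewrite (_ : (fun t => h (t + n%:R * (2 * pi))) = h)//.
    by apply/funext => t; rewrite -[RHS](periodic_int n%:Z t ph).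
  have nn : 0 <= n%:R * (2 * pi) :> R by rewrite mulr_ge0// ltW.
  rewrite (@itv_bndbnd_setU _ _ _ (BRight (n%:R * (2 * pi)))); last 2 first.
  - by rewrite bnd_simp.
  - by rewrite bnd_simp; apply: ler_wpM2r; rewrite ?ler_nat// ltW.
  apply/integrableP; split; first by apply/measurable_EFinP; exact: measurable_funS mh.
  rewrite ge0_integral_setU//=.
  - have iN2 : mu.-integrable `]n%:R * (2 * pi), n.+1%:R * (2 * pi)] (EFin \o h).
      by apply: integrableS iN1 => //; apply: subset_itvr; rewrite bnd_simp.
    by move: IH iN2 => /integrableP[_ A] /integrableP[_ B]; rewrite lte_add_pinfty.
  - apply/measurable_EFinP; apply: measurableT_comp => //.
    exact: measurable_funS mh.
  - apply/disj_setPS => y [/=]; rewrite 2!in_itv/= => /andP[_ yx] /andP[].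
    by rewrite ltNge yx.
pose n := Num.truncn (`|a| + `|b|) .
have [n1 n2] : - (n.+1%:R * (2 * pi)) <= a /\ b <= n.+1%:R * (2 * pi).
  have h1 : `|a| + `|b| < n.+1%:R by exact: truncnS_gt.
  have h2 : n.+1%:R <= n.+1%:R * (2 * pi) :> R.
    rewrite ler_peMr//; have := pi_ge2 R; lra.
  have := ler_norm b; have := ler_norm (- a); rewrite normrN.
  have := normr_ge0 a; have := normr_ge0 b; lra.
(* The choice of n makes n + 1 periods longer than |a| + |b|, so 2 (n + 1) periods moved left by n +
   1 of them cover [a, b]. *)
have : mu.-integrable `[0 - n.+1%:R * (2 * pi),
    (n.+1 + n.+1)%:R * (2 * pi) - n.+1%:R * (2 * pi)] (EFin \o h).
  apply: ishift; rewrite (_ : (fun t => h _) = h)//.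
  apply/funext => t; rewrite -[RHS](periodic_int (- n.+1%:Z) t ph).
  by rewrite rmorphN/= mulNr.
apply: integrableS => //; apply: subset_itv; rewrite bnd_simp.
  by rewrite add0r.
by rewrite natrD mulrDl addrK.
Qed.

End ShiftReflection.

(** * Goursat's lemma *)

Section Goursat.
Context {R : realType}.
Local Notation mu := (@lebesgue_measure R).
Implicit Types (P Q : R -> R -> R).

(* The form [P ds + Q dt] is differentiable at [(s, t)], without any continuity
   of the derivatives, and closed there: [B] is both dP/dt and dQ/ds. *)
Definition closed_at (D : R -> R -> Prop) P Q s t : Prop := exists A B C : R,
  forall e : R, 0 < e -> exists2 d, 0 < d &
    forall x y, D (s + x) (t + y) -> `|x| < d -> `|y| < d ->
    `|P (s + x) (t + y) - P s t - (A * x + B * y)| <= e * (`|x| + `|y|) /\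
    `|Q (s + x) (t + y) - Q s t - (B * x + C * y)| <= e * (`|x| + `|y|).

(** The integral of P ds + Q dt counterclockwise around [a, a + w] x [c, c + h], with opposite sides
    paired. *)
Definition circulation P Q a w c h : R :=
  J a (a + w) (fun x => P x c - P x (c + h)) +
  J c (c + h) (fun y => Q (a + w) y - Q a y).

Variables (P Q : R -> R -> R) (a0 c0 w0 h0 : R).
Hypotheses (w0_ge0 : 0 <= w0) (h0_ge0 : 0 <= h0).
Hypothesis Pcont : forall t, continuous (P^~ t).
Hypothesis Qcont : forall s, continuous (Q s).
Let D s t : Prop := a0 <= s <= a0 + w0 /\ c0 <= t <= c0 + h0.
Hypothesis PQ : forall s t, D s t -> closed_at D P Q s t.

Let E := circulation P Q.

Let lP t : lint (P^~ t). Proof. exact/lint_cont/Pcont. Qed.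
Let lQ s : lint (Q s). Proof. exact/lint_cont/Qcont. Qed.

Lemma circulation_split a w c h : 0 <= w -> 0 <= h ->
  E a w c h = E a (w / 2) c (h / 2) + E (a + w / 2) (w / 2) c (h / 2) +
    (E a (w / 2) (c + h / 2) (h / 2) + E (a + w / 2) (w / 2) (c + h / 2) (h / 2)).
Proof.
move=> wp hp; rewrite /E /circulation.
have e1 : a + w / 2 + w / 2 = a + w by lra.
have e2 : c + h / 2 + h / 2 = c + h by lra.
rewrite e1 e2 !JB//.
rewrite !(@J_split _ a (a + w / 2) (a + w))//; try lra.
rewrite !(@J_split _ c (c + h / 2) (c + h))//; lra.
Qed.

(** p is the lower left corner of a rectangle of half the sides carrying at least a quarter of the
    circulation; [quarter_ex] finds one by pigeonhole among the four quarters. *)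
Let quarter a c n : R * R -> Prop := fun p =>
  let w := w0 / 2 ^+ n.+1 in let h := h0 / 2 ^+ n.+1 in
  [/\ a <= p.1 <= a + w, c <= p.2 <= c + h &
    `|E a (w * 2) c (h * 2)| <= 4 * `|E p.1 w p.2 h| ].

Let half_ge0 n : 0 <= w0 / 2 ^+ n /\ 0 <= h0 / 2 ^+ n.
Proof. by rewrite !mulr_ge0// invr_ge0 exprn_ge0. Qed.

Let quarter_ex a c n : exists p, quarter a c n p.
Proof.
have [wn hn] := half_ge0 n.+1; set w := w0 / _ in wn; set h := h0 / _ in hn.
have := @circulation_split a (w * 2) c (h * 2).
rewrite !mulfK// => /(_ _ _)/wrap[]; [by rewrite mulr_ge0|by rewrite mulr_ge0|] => ES.
apply: contrapT => N.
have K x y : (x = a \/ x = a + w) -> (y = c \/ y = c + h) ->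
    4 * `|E x w y h| < `|E a (w * 2) c (h * 2)|.
  move=> hx hy; rewrite ltNge; apply/negP => H; apply: N; exists (x, y).
  rewrite /quarter /= -/w -/h; split => //.
    by case: hx => ->; apply/andP; split; lra.
  by case: hy => ->; apply/andP; split; lra.
have K1 := K a c (or_introl erefl) (or_introl erefl).
have K2 := K (a + w) c (or_intror erefl) (or_introl erefl).
have K3 := K a (c + h) (or_introl erefl) (or_intror erefl).
have K4 := K (a + w) (c + h) (or_intror erefl) (or_intror erefl).
move: ES K1 K2 K3 K4; set e := E a (w * 2) c (h * 2).
set e1 := E _ _ _ _; set e2 := E _ _ _ _; set e3 := E _ _ _ _; set e4 := E _ _ _ _.
move=> ES K1 K2 K3 K4.
have : `|e| <= `|e1| + `|e2| + (`|e3| + `|e4|).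
  by rewrite ES (le_trans (ler_normD _ _))// lerD// ler_normD.
lra.
Qed.

Let corner (n : nat) : R * R :=
  iteri n (fun k p => sval (cid (quarter_ex p.1 p.2 k))) (a0, c0).

Let cornerS n : quarter (corner n).1 (corner n).2 n (corner n.+1).
Proof. by rewrite /corner /= -/(corner n); case: (cid _). Qed.

Let w n := w0 / 2 ^+ n.
Let h n := h0 / 2 ^+ n.

Let wS n : w n = w n.+1 * 2.
Proof. by rewrite /w exprS invfM; field; rewrite expf_neq0. Qed.
Let hS n : h n = h n.+1 * 2.
Proof. by rewrite /h exprS invfM; field; rewrite expf_neq0. Qed.

Let corner_in m n : (m <= n)%N ->
  [/\ (corner m).1 <= (corner n).1, (corner n).1 + w n <= (corner m).1 + w m,
      (corner m).2 <= (corner n).2 & (corner n).2 + h n <= (corner m).2 + h m].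
Proof.
elim: n => [|n IH]; first by rewrite leqn0 => /eqP ->.
rewrite leq_eqVlt => /predU1P[-> //|]; rewrite ltnS => /IH[h1 h2 h3 h4].
have [/andP[k1 k2] /andP[k3 k4] _] := cornerS n.
rewrite -/(w n.+1) -/(h n.+1) in k2 k4.
by have := wS n; have := hS n; split; lra.
Qed.

Let E_corner n : `|E a0 w0 c0 h0| <= 4 ^+ n * `|E (corner n).1 (w n) (corner n).2 (h n)|.
Proof.
elim: n => [|n IH]; first by rewrite expr0 mul1r /w /h !expr0 !divr1.
have [_ _] := cornerS n; rewrite -/(w n.+1) -/(h n.+1) -wS -hS => H.
apply: (le_trans IH); rewrite exprSr -mulrA ler_wpM2l// exprn_ge0//.
Qed.

Let limit_corner : exists p : R * R, forall n,
  (corner n).1 <= p.1 <= (corner n).1 + w n /\ (corner n).2 <= p.2 <= (corner n).2 + h n.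
Proof.
have nest (u v : nat -> R) : (forall m n, (m <= n)%N -> u m <= u n /\ u n + v n <= u m + v m) ->
    (forall n, 0 <= v n) -> exists p, forall n, u n <= p <= u n + v n.
  move=> uv v0; exists (sup (range u)) => n; apply/andP; split.
    apply: ub_le_sup; last by exists n.
    exists (u 0 + v 0) => _ [m _ <-].
    by have [] := uv 0%N m (leq0n _); have := v0 m; lra.
  apply: ge_sup; first by exists (u 0), 0%N.
  move=> _ [m _ <-]; have [mn|nm] := leP m n.
    by have [] := uv m n mn; have := v0 n; lra.
  by have [] := uv n m (ltnW nm); have := v0 m; lra.
have [p1 H1] : exists p, forall n, (corner n).1 <= p <= (corner n).1 + w n.
  apply: nest => [m n /corner_in[]//|n]; by case: (half_ge0 n).
have [p2 H2] : exists p, forall n, (corner n).2 <= p <= (corner n).2 + h n.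
  apply: nest => [m n /corner_in[]//|n]; by case: (half_ge0 n).
by exists (p1, p2) => n; split.
Qed.

(* On a small rectangle the affine part of a closed form has no circulation. *)
Let small_circulation s t e d A B C a v c k :
  (forall x y, D (s + x) (t + y) -> `|x| < d -> `|y| < d ->
    `|P (s + x) (t + y) - P s t - (A * x + B * y)| <= e * (`|x| + `|y|) /\
    `|Q (s + x) (t + y) - Q s t - (B * x + C * y)| <= e * (`|x| + `|y|)) ->
  a0 <= a -> a + v <= a0 + w0 -> c0 <= c -> c + k <= c0 + h0 ->
  0 <= e -> a <= s <= a + v -> c <= t <= c + k -> v < d -> k < d ->
  `|E a v c k| <= 2 * e * (v + k) ^+ 2.
Proof.
move=> H in1 in2 in3 in4 e0 /andP[s1 s2] /andP[t1 t2] vd kd.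
have PB x y : a <= x <= a + v -> c <= y <= c + k ->
    `|P x y - P s t - (A * (x - s) + B * (y - t))| <= e * (v + k).
  move=> /andP[x1 x2] /andP[y1 y2].
  have [|||L _] := H (x - s) (y - t); rewrite ?ltr_norml//; try (by apply/andP; split; lra).
    by split; apply/andP; split; lra.
  rewrite !(addrC s) !(addrC t) !subrK in L; apply: (le_trans L).
  by rewrite ler_wpM2l// lerD// ler_norml; apply/andP; split; lra.
have QB x y : a <= x <= a + v -> c <= y <= c + k ->
    `|Q x y - Q s t - (B * (x - s) + C * (y - t))| <= e * (v + k).
  move=> /andP[x1 x2] /andP[y1 y2].
  have [|||_ L] := H (x - s) (y - t); rewrite ?ltr_norml//; try (by apply/andP; split; lra).
    by split; apply/andP; split; lra.
  rewrite !(addrC s) !(addrC t) !subrK in L; apply: (le_trans L).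
  by rewrite ler_wpM2l// lerD// ler_norml; apply/andP; split; lra.
have bnd (g : R -> R) (l u m z : R) : l <= u -> lint g ->
    (forall x, l <= x <= u -> `|g x - m| <= z) -> `|J l u g - m * (u - l)| <= z * (u - l).
  move=> lu lg gz; rewrite -J_cst// -JB//; last exact: lint_cst.
  apply: le_trans (J_norm _ _ _) _; first exact/lintB/lint_cst.
  rewrite -J_cst//; apply: J_le => //; last exact: lint_cst.
  exact/lint_norm/lintB/lint_cst.
have v0 : 0 <= v by lra.
have k0 : 0 <= k by lra.
have B1 : `|J a (a + v) (fun x => P x c - P x (c + k)) - - (B * k) * (a + v - a)|
    <= 2 * e * (v + k) * (a + v - a).
  apply: bnd; [by lra|exact: lintB|] => x xa.
  have c1 : c <= c <= c + k by apply/andP; split; lra.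
  have c2 : c <= c + k <= c + k by apply/andP; split; lra.
  move: (PB x c xa c1) (PB x (c + k) xa c2); rewrite !ler_norml => /andP[i1 i2] /andP[i3 i4].
  by apply/andP; split; lra.
have B2 : `|J c (c + k) (fun y => Q (a + v) y - Q a y) - (B * v) * (c + k - c)|
    <= 2 * e * (v + k) * (c + k - c).
  apply: bnd; [by lra|exact: lintB|] => y ya.
  have c1 : a <= a <= a + v by apply/andP; split; lra.
  have c2 : a <= a + v <= a + v by apply/andP; split; lra.
  move: (QB a y c1 ya) (QB (a + v) y c2 ya); rewrite !ler_norml => /andP[i1 i2] /andP[i3 i4].
  by apply/andP; split; lra.
move: B1 B2; rewrite /E /circulation; set X := J a _ _; set Y := J c _ _.
rewrite !ler_norml => /andP[i1 i2] /andP[i3 i4].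
by apply/andP; split; nra.
Qed.

Lemma goursat : circulation P Q a0 w0 c0 h0 = 0.
Proof.
have [[s t] /= stn] := limit_corner.
have [st1 st2] := stn 0%N; rewrite /w /h !expr0 !divr1 in st1 st2.
have [A [B [C H]]] := PQ (conj st1 st2).
(* A bound by every e forces 0: with e equal to |E| / (4 ((w0 + h0)^2 + 1)) it would give |E| < |E|.
   The summand 1 covers w0 = h0 = 0. *)
suff S e : 0 < e -> `|E a0 w0 c0 h0| <= 2 * e * (w0 + h0) ^+ 2.
  apply/eqP; rewrite -normr_eq0 eq_le normr_ge0 andbT -/E.
  rewrite leNgt; apply/negP => E0.
  have D0 : 0 < 4 * ((w0 + h0) ^+ 2 + 1).
    by rewrite mulr_gt0// ltr_wpDl// sqr_ge0.
  have := S (`|E a0 w0 c0 h0| / (4 * ((w0 + h0) ^+ 2 + 1))) (divr_gt0 E0 D0).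
  rewrite leNgt => /negP; apply.
  rewrite mulrAC mulrA ltr_pdivrMr// mulrAC.
  have := sqr_ge0 (w0 + h0); nra.
move=> e0; have [d d0 Hd] := H e e0.
have [n nd] : exists n : nat, w n < d /\ h n < d.
  have : (w0 + h0) * 2^-1 ^+ n @[n --> \oo] --> (0 : R).
    rewrite -[X in _ --> X](mulr0 (w0 + h0)).
    by apply: cvgM; [exact: cvg_cst|apply: cvg_expr; rewrite ger0_norm//; lra].
  move=> /cvgrPdist_lt/(_ d d0)[n _ /(_ n (leqnn n))] /=.
  rewrite sub0r normrN ger0_norm; last by rewrite mulr_ge0 ?addr_ge0 ?exprn_ge0 ?invr_ge0.
  rewrite mulrDl exprVn => Hn; exists n.
  by have := half_ge0 n; rewrite /w /h; lra.
(* The factor 4^n lost in n bisections is exactly regained, since (w n + h n)^2 = (w0 + h0)^2 /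
   4^n. *)
apply: (le_trans (E_corner n)); have [stn1 stn2] := stn n.
have [i1 i2 i3 i4] := corner_in (leq0n n).
rewrite /w /h !expr0 !divr1 -/(w n) -/(h n) /= in i1 i2 i3 i4.
have := small_circulation Hd i1 i2 i3 i4 (ltW e0) stn1 stn2 nd.1 nd.2.
move=> /(ler_wpM2l (exprn_ge0 n (ler0n R 4))) /le_trans; apply.
rewrite /w /h -mulrDl exprMn -exprVn -exprM mulnC exprM le_eqVlt; apply/orP; left; apply/eqP.
have -> : (2^-1 : R) ^+ 2 = 4^-1 by rewrite exprVn -natrX.
rewrite exprVn; field; exact: expf_neq0.
Qed.

End Goursat.

(** * Slices and Moebius maps *)

Section ComplexFacts.
Variable R : realType.
Local Notation C := (R[i]).
Implicit Types (a b z w : C) (t : R).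

Definition cis t : C := Complex (cos t) (sin t).

Lemma normc_sq z : normc z ^+ 2 = complex.Re z ^+ 2 + complex.Im z ^+ 2.
Proof. by case: z => x y /=; rewrite sqr_sqrtr// addr_ge0// sqr_ge0. Qed.

Lemma normc_ge0 z : 0 <= normc z.
Proof. by case: z => x y /=; rewrite sqrtr_ge0. Qed.

Lemma normc_conj z : normc (conjc z) = normc z.
Proof. by case: z => x y /=; rewrite sqrrN. Qed.

Lemma normc_real (r : R) : normc (r%:C%C) = `|r|.
Proof. by rewrite /= expr0n addr0 sqrtr_sqr. Qed.

Lemma normc_cis t : normc (cis t) = 1.
Proof. by rewrite /= cos2Dsin2 sqrtr1. Qed.

Lemma normc_gt0 z : (0 < normc z) = (z != 0).
Proof.
rewrite lt_def normc_ge0 andbT; congr (~~ _); apply/eqP/eqP => [/eq0_normc//|->].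
exact: normc0.
Qed.

Lemma normcB_le z w : normc z - normc w <= normc (z + w).
Proof.
have := le_normcD (z + w) (- w); rewrite addrK normcN; lra.
Qed.

Lemma normc_Re z : `|complex.Re z| <= normc z.
Proof.
rewrite -sqrtr_sqr; case: z => x y /=; apply: ler_wsqrtr.
by rewrite lerDl sqr_ge0.
Qed.

Lemma normc_le z : normc z <= `|complex.Re z| + `|complex.Im z|.
Proof.
rewrite -[leRHS]ger0_norm ?addr_ge0// -sqrtr_sqr; case: z => x y /=.
apply: ler_wsqrtr; rewrite -(real_normK (num_real x)) -(real_normK (num_real y)).
by have := normr_ge0 x; have := normr_ge0 y; nra.
Qed.

Lemma cisD s t : cis (s + t) = cis s * cis t.
Proof. by apply/eqP; rewrite eq_complex /= cosD sinD eqxx/= addrC eqxx. Qed.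

Lemma cis0 : cis 0 = 1.
Proof. by rewrite /cis cos0 sin0. Qed.

Lemma cis_2pi t : cis (t + 2 * pi) = cis t.
Proof. by rewrite /cis mulr_natl cosD2pi sinD2pi. Qed.

(** The angle is [acos] of Re z / |z|, with the sign of Im z. *)
Lemma polar z : exists s, z = (normc z)%:C%C * cis s.
Proof.
have [->|z0] := eqVneq z 0; first by exists 0; rewrite normc0 mul0r.
have n0 : 0 < normc z by rewrite normc_gt0.
have ns := normc_sq z.
set r : R := normc z in n0 ns *.
have x1 : -1 <= complex.Re z / r <= 1.
  by rewrite ler_pdivrMr// ler_pdivlMr// mul1r mulN1r -ler_norml normc_Re.
have sE : sin (acos (complex.Re z / r)) = `|complex.Im z| / r.
  have -> : `|complex.Im z| / r = Num.sqrt ((`|complex.Im z| / r) ^+ 2).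
    rewrite sqrtr_sqr [RHS]ger0_norm//; apply: divr_ge0; first exact: normr_ge0.
    exact: ltW.
  rewrite sin_acos//; congr (Num.sqrt _); rewrite !expr_div_n real_normK ?num_real//.
  apply: (mulIf (expf_neq0 2 (lt0r_neq0 n0))).
  rewrite mulrBl !divfK ?expf_neq0 ?gt_eqF// ns; ring.
have rE t : r * (t / r) = t by rewrite mulrC divfK// gt_eqF.
have [y0|y0] := leP 0 (complex.Im z).
  exists (acos (complex.Re z / r)); apply/eqP; rewrite eq_complex/= !mul0r subr0 addr0.
  by rewrite acosK ?in_itv//= sE ger0_norm// !rE !eqxx.
exists (- acos (complex.Re z / r)); apply/eqP; rewrite eq_complex/= !mul0r subr0 addr0.
rewrite cosN sinN acosK ?in_itv//= sE ltr0_norm// mulNr opprK.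
by rewrite !rE !eqxx.
Qed.

(** [moebiusC] carried to the commutative field R[i], where rational identities can be decided by
    [field]. *)
Definition Tc a z : C := (z + a) / (1 + conjc a * z).

(** The unimodular factor by which T_a T_b differs from T_c, c = T_a b; see [Tc_comp]. *)
Definition rot a b : C := (1 + a * conjc b) / (1 + conjc a * b).

Lemma Tc_den a z : normc a < 1 -> normc z <= 1 -> 1 + conjc a * z != 0.
Proof.
move=> a1 z1; apply/eqP => /eqP; rewrite addr_eq0 => /eqP/(congr1 (@normc R)).
rewrite normcN normc1 normcM normc_conj => e.
have := normc_ge0 a; have := normc_ge0 z; nra.
Qed.

(** It comes from |1 + conj(a) z|^2 - |z + a|^2 = (1 - |a|^2)(1 - |z|^2), and shows at once that T_a
    preserves both the disc and the circle. *)
Lemma Tc_normE a z : normc a < 1 -> normc z <= 1 ->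
  1 - normc (Tc a z) ^+ 2 =
  (1 - normc a ^+ 2) * (1 - normc z ^+ 2) / normc (1 + conjc a * z) ^+ 2.
Proof.
move=> a1 z1; have d0 := Tc_den a1 z1.
have n0 : normc (1 + conjc a * z) != 0 by rewrite gt_eqF// normc_gt0.
rewrite /Tc normcM normcV exprMn exprVn; apply: (canRL (mulfK _)).
  by rewrite expf_neq0.
rewrite mulrBl mul1r divfK ?expf_neq0// !normc_sq.
by case: a {a1 d0 n0} => a1 a2; case: z {z1} => x y /=; ring.
Qed.

Lemma Tc_lt1 a z : normc a < 1 -> normc z < 1 -> normc (Tc a z) < 1.
Proof.
move=> a1 z1; have := Tc_normE a1 (ltW z1).
have d0 : 0 < normc (1 + conjc a * z) by rewrite normc_gt0 Tc_den// ltW.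
move=> e; suff : 0 < 1 - normc (Tc a z) ^+ 2.
  by have := normc_ge0 (Tc a z); nra.
rewrite e divr_gt0 ?exprn_gt0// mulr_gt0//.
  by have := normc_ge0 a; nra.
by have := normc_ge0 z; nra.
Qed.

Lemma Tc_eq1 a z : normc a < 1 -> normc z = 1 -> normc (Tc a z) = 1.
Proof.
move=> a1 z1; have := Tc_normE a1 (eqbRL (le_eqVlt _ _) (introT orP (or_introl (introT eqP z1)))).
rewrite z1 expr1n subrr mulr0 mul0r => /eqP; rewrite subr_eq0 eq_sym.
by rewrite sqrf_eq1 => /orP[/eqP//|/eqP]; have := normc_ge0 (Tc a z); lra.
Qed.

Lemma Tc_le1 a z : normc a < 1 -> normc z <= 1 -> normc (Tc a z) <= 1.
Proof.
move=> a1; rewrite le_eqVlt => /predU1P[z1|z1]; first by rewrite Tc_eq1.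
by rewrite ltW// Tc_lt1.
Qed.

Lemma Tc0 a : Tc a 0 = a.
Proof. by rewrite /Tc add0r mulr0 addr0 divr1. Qed.

Lemma normc_rot a b : normc a < 1 -> normc b < 1 -> normc (rot a b) = 1.
Proof.
move=> a1 b1; rewrite /rot normcM normcV.
have -> : normc (1 + a * conjc b) = normc (1 + conjc a * b).
  rewrite -normc_conj; congr normc.
  by rewrite rmorphD rmorphM /= conjcK oppr0.
by rewrite divff// gt_eqF// normc_gt0 Tc_den// ltW.
Qed.

Lemma conjc_Tc a b : conjc (Tc a b) = (conjc b + conjc a) / (1 + a * conjc b).
Proof. by rewrite /Tc rmorphM fmorphV !rmorphD rmorph1 rmorphM /= conjcK. Qed.

Lemma Tc_comp a b z : normc a < 1 -> normc b < 1 -> normc z <= 1 ->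
  Tc a (Tc b z) = Tc (Tc a b) (rot a b * z).
Proof.
move=> a1 b1 z1.
have d1 : 1 + conjc b * z != 0 by rewrite Tc_den.
have d2 : 1 + conjc a * b != 0 by rewrite Tc_den// ltW.
have d3 : 1 + a * conjc b != 0.
  by have := Tc_den b1 (ltW a1); rewrite mulrC.
have d4 : 1 + conjc a * Tc b z != 0 by rewrite Tc_den// Tc_le1.
have d5 : 1 + conjc (Tc a b) * (rot a b * z) != 0.
  by rewrite Tc_den// ?Tc_lt1// normcM normc_rot// mul1r.
move: d4 d5; rewrite /Tc -/(Tc a b) conjc_Tc /Tc /rot => d4 d5.
have d4' : 1 + conjc b * z + conjc a * (z + b) != 0.
  apply: contraNneq d4 => d; apply/eqP.
  by rewrite mulrA -[X in X + _](divff d1) -mulrDl d mul0r.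
have d5' : 1 + conjc a * b + (conjc b + conjc a) * z != 0.
  by apply: contraNneq d4' => <-; apply/eqP; ring.
field; rewrite ?d1 ?d2 ?d3 ?d4' ?d5' //=.
Qed.

(** [Tc_comp] at b = -a, where T_a (-a) = 0 and the rotation factor is 1. *)
Lemma TcK a z : normc a < 1 -> normc z <= 1 -> Tc a (Tc (- a) z) = z.
Proof.
move=> a1 z1; have na1 : normc (- a) < 1 by rewrite normcN.
have T0 : Tc a (- a) = 0 by rewrite /Tc addNr mul0r.
rewrite Tc_comp// T0 /Tc conjc0 mul0r !addr0 divr1 /rot.
rewrite rmorphN /= !mulrN [conjc a * a]mulrC divff ?mul1r//.
by have := Tc_den na1 (ltW a1); rewrite rmorphN /= mulNr [conjc a * a]mulrC.
Qed.

Lemma Tc_sub a z w : 1 + conjc a * z != 0 -> 1 + conjc a * (z + w) != 0 ->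
  Tc a (z + w) - Tc a z =
  w * ((1 - conjc a * a) / ((1 + conjc a * z) * (1 + conjc a * (z + w)))).
Proof.
by move=> d1 d2; rewrite /Tc; field; rewrite d1 d2.
Qed.

End ComplexFacts.

Section Slices.
Variable R : realType.
Local Notation H := (quat R).
Local Notation C := (R[i]).
Implicit Types (x y q : H) (z w a b : C).

Lemma qnormM x y : `|x * y| = `|x| * `|y|.
Proof.
rewrite -[LHS]/(qnorm _) /qnorm -sqrtrM ?qsqnorm_ge0//; congr Num.sqrt.
by rewrite /qsqnorm /=; ring.
Qed.

Lemma qnorm_sqE x : `|x| ^+ 2 = qRe x ^+ 2 + qi x ^+ 2 + qj x ^+ 2 + qk x ^+ 2.
Proof. by rewrite -[`|x|]/(qnorm _) sqr_sqrtr ?qsqnorm_ge0. Qed.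

Lemma qsphere_sq i : qsphere R i -> i * i = -1.
Proof.
move=> [i0 i1]; have := qnorm_sqE i; rewrite i1 expr1n i0 => e.
by apply: quat_eq; rewrite /= i0; [lra|ring|ring|ring].
Qed.

Lemma qnorm1 : `|1 : H| = 1.
Proof. by rewrite -[LHS]/(Num.sqrt _) /qsqnorm /= expr1n expr0n !addr0 sqrtr1. Qed.

(** An isometric ring embedding of R[i] onto C_i, through which all work on a slice is done in a
    field. *)
Definition emb i z : H := slice i (complex.Re z) (complex.Im z).

Lemma embD i z w : emb i (z + w) = emb i z + emb i w.
Proof. by case: z => x y; case: w => u v; rewrite /emb /slice /= !scalerDl addrACA. Qed.

Lemma embN i z : emb i (- z) = - emb i z.
Proof. by case: z => x y; rewrite /emb /slice /= !scaleNr opprD. Qed.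

Lemma embB i z w : emb i (z - w) = emb i z - emb i w.
Proof. by rewrite embD embN. Qed.

Lemma emb_real i (r : R) : emb i (r%:C%C) = r%:A.
Proof. by rewrite /emb /slice /= scale0r addr0. Qed.

Lemma emb0 i : emb i 0 = 0.
Proof. by rewrite (emb_real i 0) scale0r. Qed.

Lemma emb1 i : emb i 1 = 1.
Proof. by rewrite (emb_real i 1) scale1r. Qed.

Lemma embM i z w : qsphere R i -> emb i (z * w) = emb i z * emb i w.
Proof.
move=> /qsphere_sq ii; case: z => x y; case: w => u v; rewrite /emb /slice /=.
rewrite mulrDl !mulrDr -!scalerAl -!scalerAr !mul1r !mulr1 ii !scalerA scalerN scalerBl scalerDl.
rewrite -!addrA; congr (_ + _).
by rewrite addrC -addrA.
Qed.

Lemma embZ i (r : R) z : emb i (r%:C%C * z) = r *: emb i z.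
Proof. by case: z => x y; rewrite /emb /slice /= !mul0r subr0 addr0 scalerDr !scalerA. Qed.

Lemma emb_conj i z : qsphere R i -> qconj (emb i z) = emb i (conjc z).
Proof.
move=> [i0 _]; case: z => x y; rewrite /emb /slice /=.
by apply: quat_eq; rewrite /= ?i0; ring.
Qed.

Lemma emb_norm i z : qsphere R i -> `|emb i z| = normc z.
Proof.
move=> [i0 i1]; case: z => x y; rewrite -[LHS]/(Num.sqrt _) /normc; congr Num.sqrt.
have := qnorm_sqE i; rewrite i1 expr1n i0 expr0n add0r => e.
rewrite /qsqnorm /emb /slice /= i0 !mulr0 !addr0 !add0r mulr1 !exprMn.
by rewrite -[y ^+ 2 in RHS]mulr1 e; ring.
Qed.

Lemma emb_inv i z : qsphere R i -> emb i z^-1 = (emb i z)^-1.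
Proof.
move=> hi; have [->|z0] := eqVneq z 0; first by rewrite invr0 emb0 invr0.
have e : emb i z * emb i z^-1 = 1 by rewrite -embM// divff// emb1.
have u : emb i z \is a GRing.unit.
  by rewrite -[is_true _]/(is_true (emb i z != 0)) -normr_eq0 emb_norm// gt_eqF// normc_gt0.
by rewrite -[LHS]mul1r -[in LHS](mulVr u) -mulrA e mulr1.
Qed.

Lemma CplaneP i x : Cplane i x <-> exists z, x = emb i z.
Proof.
split=> [[u [v ->]]|[[u v] ->]]; first by exists (Complex u v).
by exists u, v.
Qed.

Lemma qdisc_sliceP i x : qsphere R i ->
  qdisc_slice i x <-> exists2 z, x = emb i z & normc z < 1.
Proof.
move=> hi; split=> [[+ /CplaneP[z xz]]|[z -> z1]].
  by rewrite /qdisc /= xz emb_norm// => z1; exists z.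
split; last by apply/CplaneP; exists z.
by rewrite /qdisc /= emb_norm.
Qed.

Lemma emb_qRe i z : qsphere R i -> qRe (emb i z) = complex.Re z.
Proof. by move=> [i0 _]; case: z => x y; rewrite /emb /slice /= i0; ring. Qed.

Lemma emb_qIm i z : qsphere R i -> qIm (emb i z) = complex.Im z *: i.
Proof.
by move=> [i0 _]; case: z => x y; rewrite /emb /slice /=; apply: quat_eq; rewrite /= ?i0; ring.
Qed.

Lemma emb_normIm i z : qsphere R i -> `|qIm (emb i z)| = `|complex.Im z|.
Proof. by move=> hi; rewrite emb_qIm// normrZ (proj2 hi) mulr1. Qed.

(** Off the real axis i_x is i or -i, so one coefficient 1 - i_x i or 1 + i_x i vanishes and the
    other is 2. On it g is evaluated twice at the same point, and i_x cancels whatever its default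
    value. *)
Lemma ext_emb i g z : qsphere R i -> ext i g (emb i z) = g (emb i z).
Proof.
move=> hi; have ii := qsphere_sq hi; rewrite /ext emb_qRe// emb_normIm// /idir emb_qIm//.
have i0 : i != 0 by rewrite -normr_eq0 (proj2 hi) oner_eq0.
case: z => x y /=; rewrite -/(slice i x y) [emb _ _]/(slice i x y).
have half q : 2^-1 *: (2%:R * q) = q.
  by rewrite mulr_natl -[q *+ 2]scaler_nat scalerA mulVf ?scale1r.
have [->|y0] := eqVneq y 0.
  rewrite normr0 oppr0 -scalerDr -mulrDl.
  rewrite (_ : _ + _ = 2%:R); first exact: half.
  by rewrite addrACA addNr addr0.
rewrite scaler_eq0 (negbTE y0) (negbTE i0)/= normrZ (proj2 hi) mulr1.
move: y0; rewrite neq_lt => /orP[y0|y0].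
  rewrite ltr0_norm// opprK scalerA invrN mulNr mulVf ?lt_eqF// scaleN1r.
  by rewrite mulNr ii !opprK subrr mul0r scaler0 add0r -[1 + 1]/(2%:R) half.
rewrite gtr0_norm// scalerA mulVf ?gt_eqF// scale1r ii opprK subrr mul0r scaler0 addr0.
by rewrite -[1 + 1]/(2%:R) half.
Qed.

Lemma moebiusC_emb i a z : qsphere R i -> moebiusC (emb i a) (emb i z) = emb i (Tc a z).
Proof.
move=> hi; rewrite /moebiusC /Tc emb_conj// embM// emb_inv// !embD embM//.
by rewrite emb1.
Qed.

Lemma icomp_emb i f a z : qsphere R i ->
  icomp i f (moebius i (emb i a)) (emb i z) = f (emb i (Tc a z)).
Proof. by move=> hi; rewrite /icomp ext_emb//= /moebius ext_emb// moebiusC_emb. Qed.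

Lemma qexpE i t : qexp i t = emb i (cis t).
Proof. by []. Qed.

End Slices.

(** * Continuity and real differentiability of quaternion-valued maps *)

Section LinearMaps.
Variable R : realType.
Local Notation H := (quat R).

Lemma qRe_linear : linear (@qRe R : H -> R^o). Proof. by []. Qed.
HB.instance Definition _ := GRing.isLinear.Build R H R^o *:%R (@qRe R) qRe_linear.
Lemma qi_linear : linear (@qi R : H -> R^o). Proof. by []. Qed.
HB.instance Definition _ := GRing.isLinear.Build R H R^o *:%R (@qi R) qi_linear.
Lemma qj_linear : linear (@qj R : H -> R^o). Proof. by []. Qed.
HB.instance Definition _ := GRing.isLinear.Build R H R^o *:%R (@qj R) qj_linear.
Lemma qk_linear : linear (@qk R : H -> R^o). Proof. by []. Qed.
HB.instance Definition _ := GRing.isLinear.Build R H R^o *:%R (@qk R) qk_linear.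

Lemma qcoord_le (x : H) :
  [/\ `|qRe x| <= `|x|, `|qi x| <= `|x|, `|qj x| <= `|x| & `|qk x| <= `|x| ].
Proof.
have key (t : R) : t ^+ 2 <= `|x| ^+ 2 -> `|t| <= `|x|.
  move=> h; rewrite -(ler_pXn2r (n := 2))// ?nnegrE//.
  by rewrite real_normK// num_real.
by split; apply: key; rewrite qnorm_sqE; have := sqr_ge0 (qRe x);
  have := sqr_ge0 (qi x); have := sqr_ge0 (qj x); have := sqr_ge0 (qk x); lra.
Qed.

Lemma contractive_continuous (V W : normedModType R) (L : {linear V -> W}) (k : R) :
  (forall x, `|L x| <= k * `|x|) -> continuous L.
Proof.
move=> Lk x; apply/cvgrPdist_le => e e0.
have k1 : 0 < `|k| + 1 by rewrite ltr_wpDl.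
apply/nbhs_ballP; exists (e / (`|k| + 1)); first exact: divr_gt0.
move=> y; rewrite -ball_normE /ball_ /= => xy; rewrite -linearB.
apply: le_trans (Lk _) _.
have := ltW xy; rewrite ler_pdivlMr// => h; apply: le_trans h.
rewrite mulrC ler_wpM2l//; have := ler_norm k; lra.
Qed.

Lemma qRe_cont : continuous (@qRe R : H -> R^o).
Proof. by apply: (@contractive_continuous _ _ _ 1) => x; rewrite mul1r; case: (qcoord_le x). Qed.
Lemma qi_cont : continuous (@qi R : H -> R^o).
Proof. by apply: (@contractive_continuous _ _ _ 1) => x; rewrite mul1r; case: (qcoord_le x). Qed.
Lemma qj_cont : continuous (@qj R : H -> R^o).
Proof. by apply: (@contractive_continuous _ _ _ 1) => x; rewrite mul1r; case: (qcoord_le x). Qed.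
Lemma qk_cont : continuous (@qk R : H -> R^o).
Proof. by apply: (@contractive_continuous _ _ _ 1) => x; rewrite mul1r; case: (qcoord_le x). Qed.

Lemma qmul_cvg (T : Type) (F : set_system T) (FF : Filter F) (g : T -> H) (q l : H) :
  g @ F --> l -> (fun t => q * g t) @ F --> q * l.
Proof.
move=> gl; apply/cvgrPdist_le => e e0.
have k1 : 0 < `|q| + 1 by rewrite ltr_wpDl.
move/cvgrPdist_le : gl => /(_ (e / (`|q| + 1)) (divr_gt0 e0 k1)).
apply: filterS => t; rewrite ler_pdivlMr// => h.
rewrite -mulrBr qnormM; apply: le_trans h.
by rewrite mulrC ler_wpM2l//; lra.
Qed.

End LinearMaps.

Section EpsilonDifferential.
Variable R : realType.
Local Notation H := (quat R).

Lemma differentiable_eps (V W : normedModType R) (f : V -> W) x : differentiable f x ->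
  forall e, 0 < e -> exists2 d, 0 < d &
    forall w, `|w| < d -> `|f (x + w) - f x - 'd f x w| <= e * `|w|.
Proof.
move=> /diff_locallyP[_ /eqaddoP H0] e e0.
have /= := H0 e e0; rewrite near_simpl => /nbhs_ballP[d /= d0 Hd].
exists d => // w wd; have /= := Hd w.
rewrite -ball_normE /ball_ /= sub0r normrN => /(_ wd).
by rewrite /shift /= !fctE opprD addrA (addrC w x).
Qed.

Lemma eps_differentiable (V W : normedModType R) (f : V -> W) x (L : {linear V -> W}) :
  continuous L -> (forall e, 0 < e -> exists2 d, 0 < d &
    forall w, `|w| < d -> `|f (x + w) - f x - L w| <= e * `|w|) ->
  differentiable f x.
Proof.
move=> cL He.
have E : f \o shift x = cst (f x) + L +o_ (0 : V) id.
  apply/eqaddoP => e e0; have [d d0 Hd] := He e e0.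
  rewrite near_simpl; apply/nbhs_ballP; exists d => // w.
  rewrite -ball_normE /ball_ /= sub0r normrN => wd.
  by have := Hd w wd; rewrite /shift /= !fctE opprD addrA (addrC w x).
have dL := diff_unique cL E.
by apply/diff_locallyP; rewrite dL; split.
Qed.

Lemma near_differentiable (V W : normedModType R) (f g : V -> W) x (d : R) : 0 < d ->
  (forall w, `|w| < d -> f (x + w) = g (x + w)) -> differentiable g x ->
  differentiable f x.
Proof.
move=> d0 fg dg; apply: (@eps_differentiable _ _ _ _ ('d g x)).
  exact: diff_continuous.
move=> e e0; have [d' d'0 H'] := differentiable_eps dg e0.
exists (Num.min d d'); first by rewrite lt_min d0.
move=> w; rewrite lt_min => /andP[wd wd'].
by have := fg 0; rewrite normr0 addr0 => ->//; rewrite fg//; exact: H'.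
Qed.

Lemma quat_sum (x : H) : x = qRe x *: 1 + qi x *: Quat 0 1 0 0 +
  (qj x *: Quat 0 0 1 0 + qk x *: Quat 0 0 0 1).
Proof. by apply: quat_eq => /=; ring. Qed.

Lemma quat_differentiable (V : normedModType R) (F : V -> H) x :
  differentiable (fun y => qRe (F y) : R) x -> differentiable (fun y => qi (F y) : R) x ->
  differentiable (fun y => qj (F y) : R) x -> differentiable (fun y => qk (F y) : R) x ->
  differentiable F x.
Proof.
move=> d0 d1 d2 d3; rewrite (_ : F = fun y => qRe (F y) *: 1 + qi (F y) *: Quat 0 1 0 0 +
  (qj (F y) *: Quat 0 0 1 0 + qk (F y) *: Quat 0 0 0 1)); last first.
  by apply/funext => y; exact: quat_sum.
by apply: differentiableD; apply: differentiableD; apply: differentiableZl.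
Qed.

Lemma qcoord_differentiable (V : normedModType R) (F : V -> H) x : differentiable F x ->
  [/\ differentiable (fun y => qRe (F y) : R) x, differentiable (fun y => qi (F y) : R) x,
    differentiable (fun y => qj (F y) : R) x & differentiable (fun y => qk (F y) : R) x].
Proof.
move=> dF; split.
- by apply: (@differentiable_comp _ _ _ _ F (@qRe R)) => //;
  apply: linear_differentiable; exact: qRe_cont.
- by apply: (@differentiable_comp _ _ _ _ F (@qi R)) => //;
  apply: linear_differentiable; exact: qi_cont.
- by apply: (@differentiable_comp _ _ _ _ F (@qj R)) => //;
  apply: linear_differentiable; exact: qj_cont.
- by apply: (@differentiable_comp _ _ _ _ F (@qk R)) => //;
  apply: linear_differentiable; exact: qk_cont.
Qed.

Lemma differentiable_add (V W : normedModType R) (f g : V -> W) x :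
  differentiable f x -> differentiable g x -> differentiable (fun y => f y + g y) x.
Proof. exact: differentiableD. Qed.

Lemma differentiable_sub (V W : normedModType R) (f g : V -> W) x :
  differentiable f x -> differentiable g x -> differentiable (fun y => f y - g y) x.
Proof. exact: differentiableB. Qed.

Lemma differentiable_mul (V : normedModType R) (f g : V -> R) x :
  differentiable f x -> differentiable g x -> differentiable (fun y => f y * g y) x.
Proof. exact: differentiableM. Qed.

Lemma qmul_differentiable (V : normedModType R) (F G : V -> H) x : differentiable F x ->
  differentiable G x -> differentiable (fun y => F y * G y) x.
Proof.
move=> /qcoord_differentiable[a0 a1 a2 a3] /qcoord_differentiable[b0 b1 b2 b3].
apply: quat_differentiable => /=.
all: by do ?[apply: differentiable_sub|apply: differentiable_add|apply: differentiable_mul].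
Qed.

End EpsilonDifferential.

(** * Holomorphy for left multiplication by C_i *)

Section Hol.
Variable R : realType.
Local Notation H := (quat R).
Local Notation C := (R[i]).
Variable i : H.
Hypothesis hi : qsphere R i.

(* Complex differentiability at [z], scalars of C_i acting on the left. *)
Definition hol (G : C -> H) (z : C) : Prop := exists d : H, forall e : R, 0 < e ->
  exists2 r : R, 0 < r & forall w, normc w < r ->
    `|G (z + w) - G z - emb i w * d| <= e * normc w.

Lemma hol_cont (G : C -> H) z : hol G z -> forall e : R, 0 < e ->
  exists2 r : R, 0 < r & forall w, normc w < r -> `|G (z + w) - G z| <= e.
Proof.
move=> [d Hd] e e0; have [r r0 Hr] := Hd 1 ltr01.
have d1 : 0 < `|d| + 1 by rewrite ltr_wpDl.
exists (Num.min r (e / (`|d| + 1))); first by rewrite lt_min r0 divr_gt0.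
move=> w; rewrite lt_min ltr_pdivlMr// => /andP[w1 w2].
have := Hr w w1; rewrite mul1r => h.
have := ler_normD (G (z + w) - G z - emb i w * d) (emb i w * d).
rewrite subrK qnormM emb_norm//; lra.
Qed.

(** T is described by exact difference quotients s that are K-Lipschitz close to the derivative t;
    this is the form in which the quotient of a Moebius map comes. *)
Lemma hol_comp (G : C -> H) (T : C -> C) z (t : C) (K : R) (r0 : R) : 0 < r0 -> 0 <= K ->
  hol G (T z) ->
  (forall w, normc w < r0 -> exists s, T (z + w) - T z = w * s /\ normc (s - t) <= K * normc w) ->
  hol (G \o T) z.
Proof.
move=> r0_gt0 K0 [d Hd] HT; exists (emb i t * d) => e e0.
(* M bounds |s| when |w| < r0. M and the later N each keep one of the two errors, that of G and that
   of s - t, below e/2 times |w|. *)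
pose M := normc t + K * r0 + 1.
have M0 : 0 < M.
  by have := normc_ge0 t; have := mulr_ge0 K0 (ltW r0_gt0); rewrite /M; lra.
have [r1 r1_gt0 Hr1] := Hd (e / (2 * M)) (divr_gt0 e0 (mulr_gt0 (ltr0Sn _ 1) M0)).
pose N := 2 * (K * `|d| + 1).
have N0 : 0 < N by have := mulr_ge0 K0 (normr_ge0 d); rewrite /N; lra.
exists (Num.min r0 (Num.min (r1 / M) (e / N))).
  by rewrite !lt_min r0_gt0 !divr_gt0.
move=> w; rewrite !lt_min !ltr_pdivlMr// => /and3P[w0 w1 w2].
have [s [sE st]] := HT w w0.
have n0 := normc_ge0 w.
have sM : normc s <= M.
  have := le_normcD (s - t) t; rewrite subrK /M.
  have : K * normc w <= K * r0 by rewrite ler_wpM2l// ltW.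
  lra.
have := Hr1 (w * s); rewrite normcM => /(_ _)/wrap[].
  by apply: le_lt_trans w1; rewrite ler_wpM2l.
have zE : T z + w * s = T (z + w) by rewrite -sE addrC subrK.
rewrite zE => h.
have -> : (G \o T) (z + w) - (G \o T) z - emb i w * (emb i t * d) =
  (G (T (z + w)) - G (T z) - emb i (w * s) * d) + emb i (w * (s - t)) * d.
  rewrite !embM// embB /= mulrBr mulrBl mulrA; rewrite -!addrA; congr (_ + (_ + _)).
  by rewrite addrA addNr add0r.
apply: le_trans (ler_normD _ _) _; rewrite qnormM emb_norm// normcM.
have h1 : e / (2 * M) * (normc w * normc s) <= e / 2 * normc w.
  have -> : e / (2 * M) * (normc w * normc s) = e / 2 * normc w * (normc s / M).
    by field; rewrite gt_eqF.
  apply: ler_piMr; last by rewrite ler_pdivrMr// mul1r.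
  by apply: mulr_ge0 => //; apply: divr_ge0; rewrite // ltW.
have h2 : normc w * normc (s - t) * `|d| <= e / 2 * normc w.
  rewrite -mulrA [leRHS]mulrC ler_wpM2l//.
  have : normc (s - t) * `|d| <= K * normc w * `|d| by rewrite ler_wpM2r.
  by have := normr_ge0 d; rewrite /N in w2; nra.
lra.
Qed.

End Hol.

Section SliceHyperholomorphic.
Variable R : realType.
Local Notation H := (quat R).
Local Notation C := (R[i]).
Implicit Types (i j x q : H) (f : H -> H) (a z w : C).

Lemma normc_lt1 (u v : R) : (normc (Complex u v) < 1) = (u ^+ 2 + v ^+ 2 < 1).
Proof.
rewrite -[u ^+ 2 + v ^+ 2](normc_sq (Complex u v)) -[X in _ = (_ < X)](expr1n _ 2).
by rewrite ltr_pXn2r// nnegrE ?normc_ge0.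
Qed.

Lemma idir_sphere x : qsphere R (idir x).
Proof.
rewrite /idir; case: eqVneq => [_|x0]; split => //=.
- rewrite -[LHS]/(Num.sqrt _) /qsqnorm /= expr1n expr0n !addr0 add0r sqrtr1//.
- by rewrite mulr0.
- by rewrite normrZ ger0_norm ?invr_ge0// mulVf// normr_eq0.
Qed.

Lemma quat_slice x : x = slice (idir x) (qRe x) `|qIm x|.
Proof.
rewrite /slice /idir; case: eqVneq => [x0|x0].
  rewrite x0 normr0 scale0r addr0; case: x x0 => a b c d [-> -> ->].
  by apply: quat_eq => /=; ring.
rewrite scalerA divff ?normr_eq0// scale1r.
by case: x {x0} => a b c d; apply: quat_eq => /=; ring.
Qed.

Lemma slice_normsq i u v : qsphere R i -> `|slice i u v| = normc (Complex u v).
Proof. by move=> hi; rewrite -[slice i u v]/(emb i (Complex u v)) emb_norm. Qed.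

Lemma qdisc_idir x : qdisc x -> qRe x ^+ 2 + `|qIm x| ^+ 2 < 1.
Proof.
by move=> x1; rewrite -normc_lt1 -(slice_normsq _ _ (idir_sphere x)) -quat_slice.
Qed.

(** The given representation uses only v = |Im x| >= 0 and one i_x; replacing (i, v) by (-i, -v) is
    absorbed by the parities. At v = 0 oddness makes [be] vanish, so the default i_x does no
    harm. *)
Lemma slice_rep f (al be : R -> R -> H) :
  (forall x, qdisc x -> f x = al (qRe x) `|qIm x| + idir x * be (qRe x) `|qIm x|) ->
  (forall u v : R, u ^+ 2 + v ^+ 2 < 1 -> al u (- v) = al u v /\ be u (- v) = - be u v) ->
  forall i (u v : R), qsphere R i -> u ^+ 2 + v ^+ 2 < 1 ->
  f (slice i u v) = al u v + i * be u v.
Proof.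
move=> fE par i u v hi uv.
have i0 : i != 0 by rewrite -normr_eq0 (proj2 hi) oner_eq0.
rewrite fE; last by rewrite /qdisc /= slice_normsq// normc_lt1.
rewrite -[slice i u v]/(emb i (Complex u v)) emb_qRe// emb_normIm// /idir emb_qIm//=.
have [v0|v0] := eqVneq v 0.
  rewrite v0 normr0; have [_ b0] : al u (- 0) = al u 0 /\ be u (- 0) = - be u 0.
    by apply: par; rewrite -{1}v0.
  have -> : be u 0 = 0.
    move: b0; rewrite oppr0 => /eqP; rewrite -addr_eq0 -mulr2n -scaler_nat scaler_eq0.
    by rewrite pnatr_eq0/= => /eqP.
  by rewrite !mulr0.
rewrite scaler_eq0 (negbTE v0) (negbTE i0)/= normrZ (proj2 hi) mulr1.
have [p1 p2] := par u v uv.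
move: v0; rewrite neq_lt => /orP[v0|v0].
  rewrite ltr0_norm// p1 p2 scalerA invrN mulNr mulVf ?lt_eqF// scaleN1r.
  by rewrite mulrNN.
by rewrite gtr0_norm// scalerA mulVf ?gt_eqF// scale1r.
Qed.

Lemma is_derive_cvg (V : normedModType R) (g : R -> V) (u : R) d :
  derivable g u 1 -> 'D_1 g u = d -> h^-1 *: (g (h + u) - g u) @[h --> (0 : R)^'] --> d.
Proof.
move=> dg <-.
have -> : (fun h => h^-1 *: (g (h + u) - g u)) =
    (fun h => h^-1 *: ((g \o shift u) (h *: (1 : R)) - g u)).
  by apply/funext => h /=; rewrite (_ : h *: (1 : R) = h)//; exact: mulr1.
exact: dg.
Qed.

(** Total differentiability of f provides a real-linear differential L; the partial derivatives of
    [al] and [be] only compute L 1 and L i. The Cauchy-Riemann equations say L i = i L 1, so L w = w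
    (L 1) for w in C_i. *)
Lemma slice_hyperholomorphic_hol f i z : slice_hyperholomorphic f -> qsphere R i ->
  normc z < 1 -> hol i (f \o emb i) z.
Proof.
move=> [df [al [be [fE cond]]]] hi z1.
have rep := slice_rep fE (fun u v uv => let: And5 h _ _ _ _ := cond u v uv in h) .
have dz : differentiable f (emb i z) by apply: df; rewrite /qdisc /= emb_norm.
set L := 'd f (emb i z).
suff Li : L i = i * L 1.
  exists (L 1) => e e0; have [r r0 Hr] := differentiable_eps dz e0.
  exists r => // w wr; have := Hr (emb i w); rewrite emb_norm// => /(_ wr).
  rewrite /= embD.
  have -> : 'd f (emb i z) (emb i w) = emb i w * L 1.
    by rewrite /emb /slice linearD !linearZ /= Li mulrDl -!scalerAl mul1r.
  by [].
case: z z1 dz @L => u v; rewrite normc_lt1 => uv dz L.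
have [_ [da1 da2] [db1 db2] cr1 cr2] := cond u v uv.
have [d0 d0_gt0 Hd0] : exists2 d : R, 0 < d & forall w, normc w < d ->
    normc (Complex u v + w) < 1.
  exists (1 - normc (Complex u v)); first by rewrite subr_gt0 normc_lt1.
  by move=> w wd; have := le_normcD (Complex u v) w; lra.
have near_d (h : R) : `|h| < d0 -> normc (Complex (h + u) v) < 1 /\ normc (Complex u (h + v)) < 1.
  move=> hd; split.
    have := Hd0 (Complex h 0); rewrite /= expr0n/= addr0 sqrtr_sqr => /(_ hd).
    by rewrite addr0 (addrC u).
  have := Hd0 (Complex 0 h); rewrite /= expr0n/= add0r sqrtr_sqr => /(_ hd).
  by rewrite addr0 (addrC v).
have near0 : \forall h \near (0 : R)^', `|h| < d0.
  apply: nbhs_dnbhs; apply/nbhs_ballP; exists d0 => // h.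
  by rewrite -ball_normE /ball_ /= sub0r normrN.
have K1 : L 1 = 'D_1 (al^~ v) u + i * 'D_1 (be^~ v) u.
  rewrite /L -deriveE//; apply/cvg_lim => //.
  have c1 : (h^-1 *: (al (h + u) v - al u v) + i * (h^-1 *: (be (h + u) v - be u v)))
      @[h --> (0 : R)^'] --> 'D_1 (al^~ v) u + i * 'D_1 (be^~ v) u.
    apply: cvgD; first exact: (is_derive_cvg da1 erefl).
    apply: qmul_cvg; exact: (is_derive_cvg db1 erefl).
  apply: cvg_trans c1.
  apply: near_eq_cvg; near=> h.
  have [h1 _] : normc (Complex (h + u) v) < 1 /\ normc (Complex u (h + v)) < 1.
    by apply: near_d; near: h.
  rewrite /= (_ : h *: 1 + emb i (Complex u v) = slice i (h + u) v); last first.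
    by rewrite /emb /slice /= scalerDl addrA.
  rewrite rep// -?normc_lt1// -[emb i _]/(slice i u v) rep// -scalerAr -scalerDr.
  by rewrite mulrBr opprD addrACA.
have K2 : L i = 'D_1 (al u) v + i * 'D_1 (be u) v.
  rewrite /L -deriveE//; apply/cvg_lim => //.
  have c1 : (h^-1 *: (al u (h + v) - al u v) + i * (h^-1 *: (be u (h + v) - be u v)))
      @[h --> (0 : R)^'] --> 'D_1 (al u) v + i * 'D_1 (be u) v.
    apply: cvgD; first exact: (is_derive_cvg da2 erefl).
    apply: qmul_cvg; exact: (is_derive_cvg db2 erefl).
  apply: cvg_trans c1.
  apply: near_eq_cvg; near=> h.
  have [_ h1] : normc (Complex (h + u) v) < 1 /\ normc (Complex u (h + v)) < 1.
    by apply: near_d; near: h.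
  rewrite /= (_ : h *: i + emb i (Complex u v) = slice i u (h + v)); last first.
    by rewrite /emb /slice /= scalerDl addrCA.
  rewrite rep// -?normc_lt1// -[emb i _]/(slice i u v) rep// -scalerAr -scalerDr.
  by rewrite mulrBr opprD addrACA.
rewrite K1 K2; move: cr1 cr2; rewrite !derive1E => -> ->.
by rewrite mulrDr mulrA (qsphere_sq hi) mulN1r opprK addrC.
Unshelve. all: by end_near. Qed.

(** The values at z and conj z on C_i determine [al] and [be] as even and odd parts, and these do
    not depend on the slice. *)
Lemma slice_change f i j z : slice_hyperholomorphic f -> qsphere R i -> qsphere R j ->
  normc z < 1 -> f (emb j z) = 2^-1 *: ((1 - j * i) * f (emb i z)) +
    2^-1 *: ((1 + j * i) * f (emb i (conjc z))).
Proof.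
move=> [_ [al [be [fE cond]]]] hi hj; case: z => u v; rewrite normc_lt1 => uv.
have par u' v' : u' ^+ 2 + v' ^+ 2 < 1 ->
    al u' (- v') = al u' v' /\ be u' (- v') = - be u' v' by move=> /cond[].
have rep := slice_rep fE par; have [p1 p2] := par u v uv.
rewrite /emb /= !rep// ?sqrrN// p1 p2; set A := al u v; set B := be u v.
have -> : (1 - j * i) * (A + i * B) = (A + j * B) + (i * B - j * i * A).
  rewrite mulrBl mul1r mulrDr [j * i * (i * B)]mulrA -[j * i * i]mulrA (qsphere_sq hi).
  rewrite mulrN1 mulNr opprB -!addrA; congr (_ + _); exact: addrCA.
have -> : (1 + j * i) * (A + i * - B) = (A + j * B) - (i * B - j * i * A).
  rewrite mulrDl mul1r mulrDr [j * i * (i * - B)]mulrA -[j * i * i]mulrA (qsphere_sq hi).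
  rewrite mulrN1 !mulrN mulNr opprK opprB -!addrA; congr (_ + _).
  by rewrite addrC -addrA addrCA.
rewrite -scalerDr addrACA subrr addr0 -mulr2n -[X in _ *: X]scaler_nat scalerA mulVf ?scale1r//.
Qed.

Lemma half_le1 (i j : H) : qsphere R i -> qsphere R j ->
  `|2^-1 *: (1 - j * i)| <= 1 /\ `|2^-1 *: (1 + j * i)| <= 1.
Proof.
move=> hi hj; have ji : `|j * i| = 1 by rewrite qnormM (proj2 hi) (proj2 hj) mulr1.
have h2 : `|2^-1| = 2^-1 :> R by rewrite ger0_norm// invr_ge0.
rewrite !normrZ h2; split; rewrite ler_pdivrMl// mulr1.
  by apply: le_trans (ler_normB _ _) _; rewrite ji qnorm1.
by apply: le_trans (ler_normD _ _) _; rewrite ji qnorm1.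
Qed.

End SliceHyperholomorphic.

Section MoebiusHol.
Variable R : realType.
Local Notation H := (quat R).
Local Notation C := (R[i]).

(** The factor r < 1 will make G o (r T_a) holomorphic up to the closed unit disc, as the mean value
    formula on the unit circle requires. *)
Lemma hol_Tc (i : H) (G : C -> H) (a z : C) (r : R) : qsphere R i ->
  normc a < 1 -> normc z <= 1 ->
  hol i G (r%:C%C * Tc a z) -> hol i (fun z => G (r%:C%C * Tc a z)) z.
Proof.
move=> hi a1 z1 hG; have d0 := Tc_den a1 z1.
(* For |w| < c/2 the denominator at z + w still has modulus at least c/2, whence the value of K. *)
set c := normc (1 + conjc a * z).
have c0 : 0 < c by rewrite normc_gt0.
pose t : C := r%:C%C * ((1 - conjc a * a) / ((1 + conjc a * z) * (1 + conjc a * z))).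
pose K := normc t * normc a / (c / 2).
have K0 : 0 <= K by rewrite /K !mulr_ge0 ?normc_ge0// invr_ge0 divr_ge0// ltW.
apply: (@hol_comp _ _ hi G (fun z => r%:C%C * Tc a z) z t K (c / 2) _ K0 hG).
  by rewrite divr_gt0.
move=> w wc.
have n1 : c / 2 <= normc (1 + conjc a * (z + w)).
  rewrite mulrDr addrA; apply: le_trans (normcB_le _ _).
  rewrite normcM normc_conj -/c; have := normc_ge0 w; have := normc_ge0 a; nra.
have d1 : 1 + conjc a * (z + w) != 0 by rewrite -normc_gt0; apply: lt_le_trans n1; rewrite divr_gt0.
exists (r%:C%C * ((1 - conjc a * a) / ((1 + conjc a * z) * (1 + conjc a * (z + w))))).
split; first by rewrite -mulrBr Tc_sub// mulrCA.
have -> : r%:C%C * ((1 - conjc a * a) / ((1 + conjc a * z) * (1 + conjc a * (z + w)))) - t =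
    t * (- (conjc a * w)) / (1 + conjc a * (z + w)).
  by rewrite /t; field; rewrite d0 d1.
rewrite -mulrA (normcM t) (normcM (- _)) normcV normcN (normcM (conjc a)) normc_conj /K.
rewrite -!mulrA ler_wpM2l ?normc_ge0// ler_wpM2l ?normc_ge0// mulrC ler_wpM2r ?normc_ge0//.
by rewrite lef_pV2// posrE; [apply: lt_le_trans n1|]; rewrite divr_gt0.
Qed.

End MoebiusHol.

(** * Composition with a Moebius map *)

Section MoreDifferentiability.
Variable R : realType.
Local Notation H := (quat R).
Implicit Types (V : normedModType R).

Lemma differentiable_real_comp V (g : R -> R) (f : V -> R) x :
  differentiable f x -> derivable g (f x) 1 -> differentiable (fun y => g (f y)) x.
Proof.
move=> df dg; apply: (@differentiable_comp _ _ _ _ f g) => //.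
exact/derivable1_diffP.
Qed.

Lemma differentiable_inv V (f : V -> R) x : differentiable f x -> f x != 0 ->
  differentiable (fun y => (f y)^-1) x.
Proof.
move=> df f0; apply: (differentiable_real_comp (g := fun x => x^-1)) => //.
by apply: derivableV => //; exact: derivable_id.
Qed.

Lemma differentiable_sqrt V (f : V -> R) x : differentiable f x -> 0 < f x ->
  differentiable (fun y => Num.sqrt (f y)) x.
Proof.
move=> df f0; apply: (differentiable_real_comp (g := Num.sqrt)) => //.
by case: (is_derive1_sqrt f0).
Qed.

Lemma differentiable_cst_fun V (W : normedModType R) (c : W) (x : V) :
  differentiable (fun=> c) x.
Proof. exact: differentiable_cst. Qed.

Lemma is_derive_of_eps (W : normedModType R) (f : R -> W) (x : R) (d : W) :
  (forall e : R, 0 < e -> exists2 r, 0 < r &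
    forall h, `|h| < r -> `|f (h + x) - f x - h *: d| <= e * `|h|) ->
  is_derive x (1 : R) f d.
Proof.
move=> H; have c : h^-1 *: (f (h *: 1 + x) - f x) @[h --> (0 : R)^'] --> d.
  apply/cvgrPdist_le => /= e e0; have [r r0 Hr] := H e e0.
  near=> h.
  have h0 : h != 0 by near: h; exact: nbhs_dnbhs_neq.
  have hr : `|h| < r.
    near: h; apply: nbhs_dnbhs; apply/nbhs_ballP; exists r => // h.
    by rewrite -ball_normE /ball_ /= sub0r normrN.
  have := Hr h hr => hh; have h1 : h *: (1 : R) = h by rewrite /GRing.scale /= mulr1.
  rewrite h1.
  have -> : d - h^-1 *: (f (h + x) - f x) = - (h^-1 *: (f (h + x) - f x - h *: d)).
    by rewrite [in RHS]scalerBr scalerA mulVf// scale1r opprB.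
  rewrite normrN normrZ normfV mulrC ler_pdivrMr ?normr_gt0//.
split; first by apply/cvg_ex; exists d.
exact/cvg_lim.
Unshelve. all: by end_near. Qed.

End MoreDifferentiability.

Section MoebiusDifferentiability.
Variable R : realType.

Lemma differentiable_opp (V : normedModType R) (f : V -> R) x :
  differentiable f x -> differentiable (fun y => - f y) x.
Proof. exact: differentiableN. Qed.

Lemma Tc_differentiable (V : normedModType R) (u w : V -> R) (x : V) (a : R[i]) :
  differentiable u x -> differentiable w x -> 1 + conjc a * Complex (u x) (w x) != 0 ->
  differentiable (fun y => complex.Re (Tc a (Complex (u y) (w y)))) x /\
  differentiable (fun y => complex.Im (Tc a (Complex (u y) (w y)))) x.
Proof.
case: a => a b du dw dn.
pose P y := 1 + (a * u y - - b * w y).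
pose Q y := 0 + (a * w y + - b * u y).
have c k : differentiable (fun=> k : R) x := differentiable_cst_fun k x.
have dP : differentiable P x.
  by do ?[apply: differentiable_sub|apply: differentiable_add|apply: differentiable_mul].
have dQ : differentiable Q x.
  by do ?[apply: differentiable_sub|apply: differentiable_add|apply: differentiable_mul].
pose N y := P y ^+ 2 + Q y ^+ 2.
have dN : differentiable N x.
  exact: differentiable_add (differentiable_mul dP dP) (differentiable_mul dQ dQ).
have N0 : N x != 0.
  have -> : N x = normc (1 + conjc (Complex a b) * Complex (u x) (w x)) ^+ 2 by rewrite normc_sq.
  by apply: expf_neq0; rewrite gt_eqF// normc_gt0.
have dI := differentiable_inv dN N0.
have d1 := differentiable_mul dP dI; have d2 := differentiable_opp (differentiable_mul dQ dI).
split; rewrite /Tc /=.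
  exact: differentiable_sub (differentiable_mul (differentiable_add du (c a)) d1)
     (differentiable_mul (differentiable_add dw (c b)) d2).
exact: differentiable_add (differentiable_mul (differentiable_add du (c a)) d2)
   (differentiable_mul (differentiable_add dw (c b)) d1).
Qed.

End MoebiusDifferentiability.

Section RightMultiplication.
Variable R : realType.
Local Notation H := (quat R).

(** At a real point the differential of the extension is x -> x d in all four directions, d being
    the derivative on the slice. *)
Definition qmulr (d x : H) : H := x * d.

Let qmulr_linear d : linear (qmulr d : H -> H).
Proof. by move=> k x y; rewrite /qmulr mulrDl -scalerAl. Qed.

HB.instance Definition _ d := GRing.isLinear.Build R H H _ (qmulr d) (qmulr_linear d).

End RightMultiplication.

Section CompositionSliceHyperholomorphic.
Variable R : realType.
Local Notation H := (quat R).
Local Notation C := (R[i]).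
Variable i : H.
Hypothesis hi : qsphere R i.

Lemma hol_line (G : C -> H) (z w : C) (d : H) : 
  (forall e : R, 0 < e -> exists2 r : R, 0 < r & forall w, normc w < r ->
    `|G (z + w) - G z - emb i w * d| <= e * normc w) ->
  forall e : R, 0 < e -> exists2 r : R, 0 < r & forall h : R, `|h| < r ->
    `|G (z + h%:C%C * w) - G z - h *: (emb i w * d)| <= e * `|h|.
Proof.
move=> Hd e e0; have n0 := normc_ge0 w.
have N0 : 0 < normc w + 1 by rewrite ltr_wpDl.
have [r r0 Hr] := Hd (e / (normc w + 1)) (divr_gt0 e0 N0).
exists (r / (normc w + 1)) => [|h]; first exact: divr_gt0.
rewrite ltr_pdivlMr// => hr; have := Hr (h%:C%C * w).
rewrite normcM normc_real => /(_ _)/wrap[]; first by have := normr_ge0 h; nra.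
rewrite embZ -scalerAl => /le_trans; apply.
have -> : e / (normc w + 1) * (`|h| * normc w) = e * `|h| * (normc w / (normc w + 1)) by ring.
apply: ler_piMr; first by apply: mulr_ge0 => //; exact: ltW.
by rewrite ler_pdivrMr// mul1r lerDl.
Qed.

Let halves (P x : H) : 2^-1 *: ((1 - P) * x) + 2^-1 *: ((1 + P) * x) = x.
Proof.
rewrite -scalerDr -mulrDl addrACA addNr addr0 mulrDl mul1r.
by rewrite -mulr2n -(scaler_nat 2 x) scalerA mulVf ?scale1r// pnatr_eq0.
Qed.

(** With P = J i, x = w_0 and y = v i the result is w_0 + v J: the weights of the extension turn the
    slice increments w_0 + v i and w_0 - v i into the quaternion increment w. *)
Let halves2 (P x y : H) :
  2^-1 *: (1 - P) * (x + y) + 2^-1 *: (1 + P) * (x - y) = x - P * y.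
Proof.
have hx := halves P x; have hy := halves P y.
rewrite !mulrDr mulrN -!scalerAl addrACA hx; congr (_ + _).
have e : 2^-1 *: ((1 - P) * y) = y - 2^-1 *: ((1 + P) * y).
  exact: (canRL (addrK _) hy).
rewrite e -addrA -opprD -mulr2n -(scaler_nat 2) scalerA mulfV ?pnatr_eq0// scale1r.
by rewrite mulrDl mul1r opprD addrA subrr add0r.
Qed.

Let ring_split (p q A B Z s t w d : H) : p + q = 1 -> p * s + q * t = w ->
  p * A + q * B - Z - w * d = p * (A - Z - s * d) + q * (B - Z - t * d).
Proof.
move=> one <-; rewrite !mulrBr !mulrDl !mulrA -[Z in LHS]mul1r -one mulrDl.
by rewrite !opprD [X in X + _ = _]addrACA [LHS]addrACA.
Qed.

Variables (f : H -> H) (a : C).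
Hypothesis hf : slice_hyperholomorphic f.
Hypothesis a1 : normc a < 1.

Let G z := f (emb i (Tc a z)).
Let g := icomp i f (moebius i (emb i a)).
(** Expanding [ext] separates the part free of i_x, namely [al], from the coefficient of i_x, namely
    [be]. *)
Let al (u v : R) : H := 2^-1 *: (G (Complex u v) + G (Complex u (- v))).
Let be (u v : R) : H := 2^-1 *: (i * (G (Complex u (- v)) - G (Complex u v))).

Let G_hol z : normc z < 1 -> hol i G z.
Proof.
move=> z1; have := @hol_Tc _ i (f \o emb i) a z 1 hi a1 (ltW z1).
have e (w : C) : (1%:C)%C * Tc a w = Tc a w by rewrite mul1r.
rewrite e => /(_ (slice_hyperholomorphic_hol hf hi (Tc_lt1 a1 z1))) [d Hd].
by exists d => x x0; have [r r0 Hr] := Hd x x0; exists r => // w wr; have := Hr w wr; rewrite !e.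
Qed.

Let gE x : g x = 2^-1 *: ((1 - idir x * i) * G (Complex (qRe x) `|qIm x|)) +
  2^-1 *: ((1 + idir x * i) * G (Complex (qRe x) (- `|qIm x|))).
Proof.
have e u v : f (moebius i (emb i a) (slice i u v)) = G (Complex u v).
  have := @icomp_emb _ i f a (Complex u v) hi.
  by rewrite /icomp ext_emb.
by rewrite /g /icomp /ext /= !e.
Qed.

Let g_albe x : g x = al (qRe x) `|qIm x| + idir x * be (qRe x) `|qIm x|.
Proof.
rewrite gE /al /be -scalerAr -!scalerDr; congr (_ *: _).
by rewrite mulrBl mulrDl !mul1r mulrA mulrBr addrACA; congr (_ + _); rewrite addrC.
Qed.

Let conj_lt1 (u v : R) : normc (Complex u v) < 1 -> normc (Complex u (- v)) < 1.
Proof. by rewrite !normc_lt1 sqrrN. Qed.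

Let shift_re (u v h : R) : Complex (h + u) v = Complex u v + h%:C%C * 1.
Proof. by apply/eqP; rewrite eq_complex /=; apply/andP; split; apply/eqP; ring. Qed.

Let shift_im (u v h : R) : Complex u (h + v) = Complex u v + h%:C%C * Complex 0 1.
Proof. by apply/eqP; rewrite eq_complex /=; apply/andP; split; apply/eqP; ring. Qed.

Let shift_imN (u v h : R) : Complex u (- (h + v)) = Complex u (- v) + h%:C%C * Complex 0 (- 1).
Proof. by apply/eqP; rewrite eq_complex /=; apply/andP; split; apply/eqP; ring. Qed.

(** The derivatives d1 at u + iv and d2 at u - iv determine all partials: differentiating in v
    multiplies them by i and -i on the left, and i i = -1 gives the two equations. *)
Lemma icomp_moebius_cond (u v : R) : u ^+ 2 + v ^+ 2 < 1 ->
  [/\ al u (- v) = al u v /\ be u (- v) = - be u v,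
      derivable (al^~ v) u 1 /\ derivable (al u) v 1,
      derivable (be^~ v) u 1 /\ derivable (be u) v 1,
      derive1 (al^~ v) u = derive1 (be u) v &
      derive1 (be^~ v) u = - derive1 (al u) v].
Proof.
rewrite -normc_lt1 => z1; have z2 := conj_lt1 z1.
have [d1 H1] := G_hol z1; have [d2 H2] := G_hol z2.
have ii := qsphere_sq hi.
have e01 : emb i (Complex 0 1) = i by rewrite /emb /slice /= scale0r scale1r add0r.
have e0N : emb i (Complex 0 (- 1)) = - i by rewrite /emb /slice /= scale0r scaleN1r add0r.
have x1 : is_derive u (1 : R) (fun u => G (Complex u v)) d1.
  apply: is_derive_of_eps => e e0; have [r r0 Hr] := hol_line 1 H1 e0.
  by exists r => // h hr; have := Hr h hr; rewrite shift_re emb1 mul1r.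
have x2 : is_derive u (1 : R) (fun u => G (Complex u (- v))) d2.
  apply: is_derive_of_eps => e e0; have [r r0 Hr] := hol_line 1 H2 e0.
  by exists r => // h hr; have := Hr h hr; rewrite shift_re emb1 mul1r.
have y1 : is_derive v (1 : R) (fun v => G (Complex u v)) (i * d1).
  apply: is_derive_of_eps => e e0; have [r r0 Hr] := hol_line (Complex 0 1) H1 e0.
  by exists r => // h hr; have := Hr h hr; rewrite shift_im e01.
have y2 : is_derive v (1 : R) (fun v => G (Complex u (- v))) (- i * d2).
  apply: is_derive_of_eps => e e0; have [r r0 Hr] := hol_line (Complex 0 (- 1)) H2 e0.
  by exists r => // h hr; have := Hr h hr; rewrite shift_imN e0N.
(* Left multiplication by i is not a real scaling, so its derivative is taken from the limit of the
   quotient. *)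
have mulD (F : R -> H) (x : R) (d : H) : is_derive x (1 : R) F d ->
    is_derive x (1 : R) (fun x => i * F x) (i * d).
  move=> dF; have c := is_derive_cvg (@ex_derive _ _ _ _ _ _ _ dF) (@derive_val _ _ _ _ _ _ _ dF).
  have c2 := @qmul_cvg _ _ _ _ _ i _ c.
  have c3 : h^-1 *: (i * F (h *: 1 + x) - i * F x) @[h --> (0 : R)^'] --> i * d.
    have -> : (fun h : R => h^-1 *: (i * F (h *: 1 + x) - i * F x)) =
        (fun h => i * (h^-1 *: (F (h + x) - F x))).
      apply/funext => h; rewrite -scalerAr mulrBr; congr (_ *: (_ * F (_ + _) - _)).
      by rewrite /GRing.scale /= mulr1.
    exact: c2.
  by split; [apply/cvg_ex; exists (i * d)|exact/cvg_lim].
have ax : is_derive u (1 : R) (al^~ v) (2^-1 *: (d1 + d2)).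
  exact: is_deriveZ (is_deriveD x1 x2).
have ay : is_derive v (1 : R) (al u) (2^-1 *: (i * d1 + - i * d2)).
  exact: is_deriveZ (is_deriveD y1 y2).
have bx : is_derive u (1 : R) (be^~ v) (2^-1 *: (i * (d2 - d1))).
  exact: is_deriveZ (mulD _ _ _ (is_deriveB x2 x1)).
have by_ : is_derive v (1 : R) (be u) (2^-1 *: (i * (- i * d2 - i * d1))).
  exact: is_deriveZ (mulD _ _ _ (is_deriveB y2 y1)).
split.
- split; first by rewrite /al opprK addrC.
  by rewrite /be opprK -scalerN -mulrN opprB.
- by split; apply: ex_derive.
- by split; apply: ex_derive.
- rewrite !derive1E (@derive_val _ _ _ _ _ _ _ ax) (@derive_val _ _ _ _ _ _ _ by_).
  by congr (_ *: _); rewrite mulrBr !mulrA mulrN ii opprK mul1r mulN1r opprK addrC.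
- rewrite !derive1E (@derive_val _ _ _ _ _ _ _ bx) (@derive_val _ _ _ _ _ _ _ ay).
  by rewrite -scalerN; congr (_ *: _); rewrite mulrBr mulNr opprB.
Qed.

(** No differentiation of i_x is possible here. Instead the holomorphic expansions at u0 along w_0 +
    v i and w_0 - v i are averaged with coefficients of norm at most 1, so the error stays
    o(|w|). *)
Let g_differentiable_real x : qdisc x -> qIm x = 0 -> differentiable g x.
Proof.
move=> xD xI; set u0 := qRe x.
have n0 : `|qIm x| = 0 by rewrite xI normr0.
have z1 : normc (Complex u0 0) < 1.
  by have := qdisc_idir xD; rewrite n0 normc_lt1.
have [d Hd] := G_hol z1.
have gx : g x = G (Complex u0 0).
  by rewrite gE n0 oppr0 halves.
apply: (@eps_differentiable _ _ _ g x (qmulr d)).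
  by apply: (@contractive_continuous _ _ _ _ `|d|) => w; rewrite /qmulr /= qnormM mulrC.
move=> e e0; have [r r0 Hr] := Hd (e / 2) (divr_gt0 e0 (ltr0Sn _ 1)).
exists r => // w wr.
have wI : qIm (x + w) = qIm w.
  apply: quat_eq => //=.
  - by rewrite (f_equal (@qi R) xI : qi x = 0) add0r.
  - by rewrite (f_equal (@qj R) xI : qj x = 0) add0r.
  - by rewrite (f_equal (@qk R) xI : qk x = 0) add0r.
have JE : idir (x + w) = idir w by rewrite /idir wI.
set J := idir w; have hJ : qsphere R J := idir_sphere w.
set v := `|qIm w|; set w0 := qRe w.
have zw : normc (Complex w0 v) = `|w| by rewrite [in RHS](quat_slice w) slice_normsq.
have zw' : normc (Complex w0 (- v)) = `|w| by rewrite -zw /= sqrrN.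
have ws : w = w0%:A + v *: J := quat_slice w.
have ii := qsphere_sq hi.
rewrite gx gE JE wI -/J -/v -/w0 (_ : qRe (x + w) = u0 + w0)//.
have s1 : Complex (u0 + w0) v = Complex u0 0 + Complex w0 v.
  by apply/eqP; rewrite eq_complex /= add0r !eqxx.
have s2 : Complex (u0 + w0) (- v) = Complex u0 0 + Complex w0 (- v).
  by apply/eqP; rewrite eq_complex /= add0r !eqxx.
have h1 := Hr (Complex w0 v); rewrite zw in h1.
have h2 := Hr (Complex w0 (- v)); rewrite zw' in h2.
have [a_le b_le] := half_le1 hi hJ.
rewrite s1 s2; set A := G (_ + _) in h1 *; set B := G (_ + _) in h2 *; set Z := G _ in h1 h2 *.
have -> : 2^-1 *: ((1 - J * i) * A) + 2^-1 *: ((1 + J * i) * B) - Z - qmulr d w =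
   2^-1 *: (1 - J * i) * (A - Z - emb i (Complex w0 v) * d) +
   2^-1 *: (1 + J * i) * (B - Z - emb i (Complex w0 (- v)) * d).
  rewrite !scalerAl /qmulr; apply: ring_split.
    by have := halves (J * i) 1; rewrite !mulr1.
  have -> : emb i (Complex w0 v) = w0%:A + v *: i by [].
  have -> : emb i (Complex w0 (- v)) = w0%:A - v *: i by rewrite /emb /slice /= scaleNr.
  by rewrite halves2 -scalerAr -mulrA ii mulrN1 scalerN opprK -ws.
apply: le_trans (ler_normD _ _) _; rewrite !qnormM.
have h1' := h1 wr; have h2' := h2 wr.
have : `|2^-1 *: (1 - J * i)| * `|A - Z - emb i (Complex w0 v) * d| <= 1 * (e / 2 * `|w|).
  exact: ler_pM.
have : `|2^-1 *: (1 + J * i)| * `|B - Z - emb i (Complex w0 (- v)) * d| <= 1 * (e / 2 * `|w|).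
  exact: ler_pM.
lra.
Qed.

(** Off the real axis i_x is the smooth map Im y / |Im y|, and the extension is built from it by
    products and compositions with f. *)
Let g_differentiable_nonreal x : qdisc x -> qIm x != 0 -> differentiable g x.
Proof.
move=> xD xI; have xn : 0 < `|qIm x| by rewrite normr_gt0.
pose v (y : H) : R := Num.sqrt (qi y ^+ 2 + qj y ^+ 2 + qk y ^+ 2).
have vE y : v y = `|qIm y|.
  by rewrite /v -[RHS]ger0_norm// -sqrtr_sqr qnorm_sqE /= expr0n add0r.
have [dr di dj dk] : [/\ differentiable (fun y : H => qRe y : R) x,
    differentiable (fun y : H => qi y : R) x, differentiable (fun y : H => qj y : R) x &
    differentiable (fun y : H => qk y : R) x].
  split; apply: linear_differentiable;
    [exact: qRe_cont|exact: qi_cont|exact: qj_cont|exact: qk_cont].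
have dv : differentiable (v : H -> R) x.
  apply: (@differentiable_sqrt _ _ (fun y => qi y ^+ 2 + qj y ^+ 2 + qk y ^+ 2)).
    by do ?[apply: differentiable_add|apply: differentiable_mul].
  by have := vE x; rewrite -vE in xn => _; move: xn; rewrite sqrtr_gt0.
have v0 : v x != 0 by rewrite vE gt_eqF.
pose Jf (y : H) : H := (v y)^-1 *: qIm y.
have dJ : differentiable Jf x.
  apply: quat_differentiable => /=; apply: differentiable_mul => //;
    try exact: differentiable_inv; exact: differentiable_cst_fun.
have a_x : normc (Complex (qRe x) (v x)) < 1.
  by rewrite normc_lt1 vE; exact: qdisc_idir.
have K (s : R) : s ^+ 2 = 1 -> differentiable (fun y : H => G (Complex (qRe y) (s * v y))) x.
  move=> s2; have z1 : normc (Complex (qRe x) (s * v x)) < 1.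
    by rewrite normc_lt1 exprMn s2 mul1r -normc_lt1.
  apply: (@differentiable_comp _ _ _ _ (fun y : H => emb i (Tc a (Complex (qRe y) (s * v y))))
    f); last first.
    by apply: (proj1 hf); rewrite /qdisc /= emb_norm//; exact: Tc_lt1.
  have dsv : differentiable (fun y : H => s * v y) x.
    by apply: differentiable_mul => //; exact: differentiable_cst_fun.
  have dn := Tc_den a1 (ltW z1).
  have [dp dq] := Tc_differentiable dr dsv dn.
  set p := (fun y : H => complex.Re _) in dp; set q := (fun y : H => complex.Im _) in dq.
  have -> : (fun y : H => emb i (Tc a (Complex (qRe y) (s * v y))))
    = (fun y => p y *: 1 + q y *: i) by [].
  by apply: differentiable_add; exact: differentiableZl.
pose gn (y : H) : H := 2^-1 *: ((1 - Jf y * i) * G (Complex (qRe y) (1 * v y))) +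
  2^-1 *: ((1 + Jf y * i) * G (Complex (qRe y) (- 1 * v y))).
(* Within distance |Im x| of x no point is real, so [idir] keeps away from its default value. *)
apply: (@near_differentiable _ _ _ g gn x `|qIm x| xn).
  move=> w wx; rewrite gE /gn mul1r mulN1r !vE.
  have -> : Jf (x + w) = idir (x + w).
    rewrite /Jf /idir vE; case: eqVneq => // yI; exfalso.
    move: wx; apply/negP; rewrite -leNgt.
    have -> : qIm x = - qIm w.
      apply/eqP; rewrite -addr_eq0; apply/eqP; rewrite -[RHS]yI.
      by apply: quat_eq => //=; rewrite addr0.
    rewrite normrN -vE /v -[leRHS]ger0_norm// -sqrtr_sqr qnorm_sqE ler_sqrt ?addr_ge0 ?sqr_ge0//.
    by rewrite -!addrA lerDr sqr_ge0.
  by [].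
have c1 : differentiable (fun=> 1 : H) x by exact: differentiable_cst_fun.
have ci : differentiable (fun=> i : H) x by exact: differentiable_cst_fun.
have s1 : (1 : R) ^+ 2 = 1 by rewrite expr1n.
have s2 : (- 1 : R) ^+ 2 = 1 by rewrite sqrrN expr1n.
have dJi := qmul_differentiable dJ ci.
apply: differentiable_add.
  apply: (@differentiableZ _ _ _ (fun y => (1 - Jf y * i) * G (Complex (qRe y) (1 * v y)))).
  exact: qmul_differentiable (differentiable_sub c1 dJi) (K 1 s1).
apply: (@differentiableZ _ _ _ (fun y => (1 + Jf y * i) * G (Complex (qRe y) (- 1 * v y)))).
exact: qmul_differentiable (differentiable_add c1 dJi) (K _ s2).
Qed.

Lemma slice_hyperholomorphic_icomp : slice_hyperholomorphic g.
Proof.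
split=> [x xD|]; first by have [|] := eqVneq (qIm x) 0 => xI;
  [exact: g_differentiable_real|exact: g_differentiable_nonreal].
exists al, be; split; first by move=> x _; exact: g_albe.
exact: icomp_moebius_cond.
Qed.

End CompositionSliceHyperholomorphic.

(** * Mean values and the Poisson formula *)

Section MeanValue.
Variable R : realType.
Local Notation H := (quat R).
Local Notation C := (R[i]).

Lemma is_derive_eps (f : R -> R) (x d : R) : is_derive x (1 : R) f d -> forall e, 0 < e ->
  exists2 r, 0 < r & forall y, `|y| < r -> `|f (x + y) - f x - d * y| <= e * `|y|.
Proof.
move=> [/derivable1_diffP df <-] e e0; have [r r0 Hr] := differentiable_eps df e0.
exists r => // y yr.
have -> : 'D_1 f x * y = 'd f x y by rewrite diff1E// derive1E mulrC.
exact: Hr.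
Qed.

(** The first-order expansion of exp (x + i y) at 0, assembled from those of the real functions exp,
    cos and sin. *)
Lemma cexp_eps (e : R) : 0 < e -> exists2 r, 0 < r & forall x y : R, `|x| < r -> `|y| < r ->
  normc ((expR x)%:C%C * cis y - 1 - Complex x y) <= e * (`|x| + `|y|).
Proof.
move=> e0; pose k := Num.min 1 (e / 8).
have k0 : 0 < k by rewrite lt_min ltr01 divr_gt0.
have [k1 k2] : k <= 1 /\ 8 * k <= e.
  by split; [rewrite ge_min lexx|rewrite -ler_pdivlMl// mulrC; rewrite ge_min lexx orbT].
clearbody k.
have [r1 r1_0 H1] := is_derive_eps (is_derive_expR (0 : R)) k0.
have [r2 r2_0 H2] := is_derive_eps (is_derive_cos (0 : R)) k0.
have [r3 r3_0 H3] := is_derive_eps (is_derive_sin (0 : R)) k0.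
exists (Num.min (Num.min r1 k) (Num.min r2 r3)); first by rewrite !lt_min r1_0 k0 r2_0.
move=> x y; rewrite !lt_min => /andP[/andP[x1 xk] _] /andP[/andP[_ yk] /andP[y2 y3]].
have := H1 x x1; have := H2 y y2; have := H3 y y3.
rewrite !add0r expR0 cos0 sin0 oppr0 mul0r !subr0 !mul1r.
move=> h3 h2 h1; rewrite ?addr0 in h1 h2 h3 *; apply: le_trans (normc_le _) _ => /=.
rewrite !mul0r subr0 addr0 oppr0 addr0.
set p := expR x in h1 *; set q := cos y in h2 *; set u := sin y in h3 *.
have E1 : p * q - 1 - x = (p - 1 - x) + (q - 1) * p by ring.
have E2 : p * u - y = (p - 1) * y + (u - y) * p by ring.
have pa : `|p - 1| <= 2 * `|x|.
  have := ler_normD (p - 1 - x) x; rewrite subrK.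
  have : k * `|x| <= `|x| by rewrite ler_piMl.
  lra.
have pb : `|p| <= 3.
  have := ler_normD (p - 1) 1; rewrite subrK normr1; lra.
have B1 : `|p * q - 1 - x| <= k * `|x| + 3 * (k * `|y|).
  rewrite E1 (le_trans (ler_normD _ _))// normrM; apply: lerD => //.
  by rewrite mulrC; apply: ler_pM.
have B2 : `|p * u - y| <= 2 * (k * `|x|) + 3 * (k * `|y|).
  rewrite E2 (le_trans (ler_normD _ _))// !normrM; apply: lerD.
    have : `|p - 1| * `|y| <= 2 * `|x| * k by apply: ler_pM => //; exact: ltW.
    lra.
  by rewrite mulrC; apply: ler_pM.
have x0 := normr_ge0 x; have y0 := normr_ge0 y.
have : 8 * (k * (`|x| + `|y|)) <= e * (`|x| + `|y|).
  by rewrite mulrA ler_wpM2r// addr_ge0.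
have := mulr_ge0 (ltW k0) x0; have := mulr_ge0 (ltW k0) y0; lra.
Qed.

Variable i : H.
Hypothesis hi : qsphere R i.

Lemma qRe_le (c x : H) : `|qRe (c * x)| <= `|c| * `|x|.
Proof. by rewrite -qnormM; case: (qcoord_le (c * x)). Qed.

Lemma qReB (c x y : H) : qRe (c * (x - y)) = qRe (c * x) - qRe (c * y).
Proof. by rewrite mulrBr. Qed.

Lemma hol_curve_continuous (G : C -> H) (z : R -> C) (c : H) t : hol i G (z t) ->
  {for t, continuous (fun t => complex.Re (z t))} ->
  {for t, continuous (fun t => complex.Im (z t))} ->
  {for t, continuous (fun t => qRe (c * G (z t)))}.
Proof.
move=> hG c1 c2; apply/cvgrPdist_le => e e0.
have k1 : 0 < `|c| + 1 by rewrite ltr_wpDl.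
have [r r0 Hr] := hol_cont hi hG (divr_gt0 e0 k1).
have r2 : 0 < r / 2 by rewrite divr_gt0.
move/cvgrPdist_lt : c1 => /(_ _ r2) h1; move/cvgrPdist_lt : c2 => /(_ _ r2) h2.
near=> s.
have zs : normc (z s - z t) < r.
  apply: le_lt_trans (normc_le _) _.
  have -> : complex.Re (z s - z t) = - (complex.Re (z t) - complex.Re (z s)).
    by case: (z s) => ? ?; case: (z t) => ? ? /=; ring.
  have -> : complex.Im (z s - z t) = - (complex.Im (z t) - complex.Im (z s)).
    by case: (z s) => ? ?; case: (z t) => ? ? /=; ring.
  rewrite !normrN.
  have a1 : `|complex.Re (z t) - complex.Re (z s)| < r / 2 by near: s.
  have a2 : `|complex.Im (z t) - complex.Im (z s)| < r / 2 by near: s.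
  lra.
have zE : z t + (z s - z t) = z s by rewrite addrC subrK.
have := Hr _ zs; rewrite zE ler_pdivlMr// => h.
rewrite -qReB; apply: le_trans (qRe_le _ _) _; rewrite distrC mulrC; apply: le_trans h.
by rewrite ler_wpM2l//; lra.
Unshelve. all: by end_near. Qed.

Variables (G : C -> H) (rho : R).
Hypothesis rho0 : 0 < rho.
Hypothesis hG : forall z, normc z <= rho -> hol i G z.

(* Truncating [s] at 0 keeps the point in the disc for all [s]. *)
Let logpt s t : C := (rho * expR (Num.min s 0))%:C%C * cis t.

Let logpt_le s t : normc (logpt s t) <= rho.
Proof.
rewrite /logpt normcM normc_cis mulr1 normc_real ger0_norm; last first.
  by rewrite mulr_ge0// ?expR_ge0// ltW.
by rewrite ger_pMr// -expR0 ler_expR ge_min lexx orbT.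
Qed.

(** In logarithmic polar coordinates ds + i dt = dz / z, and P ds + Q dt is the real part of -c i
    (ds + i dt) G, closed because G is holomorphic. *)
Let Q (c : H) s t := qRe (c * G (logpt s t)).
Let P (c : H) s t := - qRe (c * i * G (logpt s t)).

Let logptE s t : logpt s t =
  Complex (rho * expR (Num.min s 0) * cos t) (rho * expR (Num.min s 0) * sin t).
Proof. by apply/eqP; rewrite eq_complex /= !mul0r subr0 addr0 !eqxx. Qed.

Let Qcont c s : continuous (Q c s).
Proof.
have c1 : continuous (fun t => complex.Re (logpt s t)).
  under eq_fun do rewrite logptE /=.
  by move=> t; apply: cvgM; [exact: cvg_cst|exact: continuous_cos].
have c2 : continuous (fun t => complex.Im (logpt s t)).
  under eq_fun do rewrite logptE /=.
  by move=> t; apply: cvgM; [exact: cvg_cst|exact: continuous_sin].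
move=> t; apply: hol_curve_continuous; [exact/hG/logpt_le|exact: c1|exact: c2].
Qed.

Let Pcont c t : continuous ((P c)^~ t).
Proof.
have cE : continuous (fun s : R => rho * expR (Num.min s 0)).
  move=> u; apply: cvgM; first exact: cvg_cst.
  apply: (cvg_comp _ expR); last exact: continuous_expR.
  apply: (@continuous_min _ _ id (cst 0) u); first exact: cvg_id.
  exact: cvg_cst.
have c1 : continuous (fun s => complex.Re (logpt s t)).
  under eq_fun do rewrite logptE /=.
  by move=> s; apply: cvgM; [exact: cE|exact: cvg_cst].
have c2 : continuous (fun s => complex.Im (logpt s t)).
  under eq_fun do rewrite logptE /=.
  by move=> s; apply: cvgM; [exact: cE|exact: cvg_cst].
move=> s; apply: cvgN.
apply: (@hol_curve_continuous G (fun s => logpt s t) (c * i) s).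
- exact/hG/logpt_le.
- exact: c1.
- exact: c2.
Qed.

(** The chain rule: in these coordinates the differential of G is (x + i y) D with D = z0 d. Since i
    i = -1, the coefficient Re (c D) appears both in dP/dt and in dQ/ds. *)
Let PQ c (a : R) : a < 0 -> forall s t,
  (a <= s <= a + - a /\ 0 <= t <= 0 + 2 * pi) ->
  closed_at (fun s t => a <= s <= a + - a /\ 0 <= t <= 0 + 2 * pi) (P c) (Q c) s t.
Proof.
move=> a0 s t [sa _]; rewrite subrr in sa *.
have s0 : s <= 0 by case/andP: sa.
have ptE u v : a <= u <= 0 -> logpt u v = (rho * expR u)%:C%C * cis v.
  by move=> /andP[_ u0]; rewrite /logpt min_l.
set z0 := logpt s t.
have z0_le := logpt_le s t; rewrite -/z0 in z0_le.
have [d Hd] := hG z0_le.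
pose D := emb i z0 * d.
exists (- qRe (c * i * D)), (qRe (c * D)), (qRe (c * i * D)) => e e0.
pose k := Num.min 1 (e / ((`|c| + 1) * (3 * rho + rho * `|d| + 1))).
have c1 : 0 < `|c| + 1 by rewrite ltr_wpDl.
have M0 : 0 < 3 * rho + rho * `|d| + 1.
  by have := mulr_ge0 (ltW rho0) (normr_ge0 d); have := rho0; lra.
have k0 : 0 < k by rewrite lt_min ltr01 divr_gt0// mulr_gt0.
have [k1 k2] : k <= 1 /\ k * ((`|c| + 1) * (3 * rho + rho * `|d| + 1)) <= e.
  by split; [rewrite ge_min lexx|rewrite -ler_pdivlMr ?mulr_gt0//; rewrite ge_min lexx orbT].
clearbody k.
have [r1 r1_0 H1] := Hd k k0.
have [r2 r2_0 H2] := cexp_eps k0.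
(* The increment z0 (E - 1) has modulus at most 3 rho (|x| + |y|), hence below r1. *)
exists (Num.min r2 (r1 / (6 * rho))); first by rewrite lt_min r2_0 divr_gt0// mulr_gt0.
move=> x y [sx _]; rewrite !lt_min !ltr_pdivlMr ?mulr_gt0// => /andP[x2 x1] /andP[y2 y1].
have := H2 x y x2 y2; set E := _%:C%C * cis y => hE.
set m := `|x| + `|y| in hE *.
have m0 : 0 <= m by rewrite addr_ge0.
have zE : logpt (s + x) (t + y) = z0 + z0 * (E - 1).
  rewrite /z0 !ptE// expRD cisD /E mulrBr mulr1 addrC subrK.
  by apply/eqP; rewrite eq_complex /=; apply/andP; split; apply/eqP; ring.
have E1 : normc (E - 1) <= 3 * m.
  have := le_normcD (E - 1 - Complex x y) (Complex x y); rewrite subrK.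
  have : normc (Complex x y) <= m := normc_le _.
  have : k * m <= m by rewrite ler_piMl.
  lra.
have w1 : normc (z0 * (E - 1)) <= rho * (3 * m).
  by rewrite normcM; apply: ler_pM => //; exact: normc_ge0.
have w2 : normc (z0 * (E - 1)) < r1.
  apply: le_lt_trans w1 _; rewrite /m; lra.
have main : `|G (logpt (s + x) (t + y)) - G z0 - emb i (Complex x y) * D| <=
    k * (3 * rho + rho * `|d| + 1) * m.
  rewrite zE.
  have -> : G (z0 + z0 * (E - 1)) - G z0 - emb i (Complex x y) * D =
    (G (z0 + z0 * (E - 1)) - G z0 - emb i (z0 * (E - 1)) * d) +
    emb i (z0 * (E - 1 - Complex x y)) * d.
    rewrite /D mulrA -embM// [Complex x y * z0]mulrC (mulrBr z0 (E - 1)).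
    by rewrite embB mulrBl [in RHS]addrA subrK.
  apply: le_trans (ler_normD _ _) _; have := H1 _ w2 => h1.
  rewrite qnormM emb_norm// normcM.
  have h2 : k * normc (z0 * (E - 1)) <= k * (rho * (3 * m)) by rewrite ler_wpM2l// ltW.
  have h3 : normc z0 * normc (E - 1 - Complex x y) * `|d| <= rho * (k * m) * `|d|.
    by rewrite ler_wpM2r//; apply: ler_pM => //; exact: normc_ge0.
  have := mulr_ge0 (ltW k0) m0; lra.
have bnd (b : H) : `|b| <= `|c| ->
    `|qRe (b * G (logpt (s + x) (t + y))) - qRe (b * G z0) - qRe (b * (emb i (Complex x y) * D))|
      <= e * m.
  move=> bc; rewrite -!qReB; apply: le_trans (qRe_le _ _) _.
  apply: (@le_trans _ _ ((`|c| + 1) * (k * (3 * rho + rho * `|d| + 1) * m))).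
    by apply: ler_pM => //; lra.
  by rewrite mulrA [_ * (k * _)]mulrCA ler_wpM2r.
have lin (b : H) : qRe (b * (emb i (Complex x y) * D)) = qRe (b * D) * x + qRe (b * i * D) * y.
  by rewrite /emb /slice /=; ring.
have bi := bnd (c * i); rewrite qnormM (proj2 hi) mulr1 lexx lin in bi.
have bc := bnd c (lexx _); rewrite lin in bc.
split; last by apply: le_trans bc; rewrite le_eqVlt; apply/orP; left; apply/eqP; congr `|_|.
have ii : qRe (c * i * i * D) = - qRe (c * D).
  by rewrite -[c * i * i]mulrA qsphere_sq// mulrN1 mulNr.
have := bi isT; rewrite ii /P -normrN => h; apply: le_trans h.
by rewrite le_eqVlt; apply/orP; left; apply/eqP; congr `|_|; ring.
Qed.

(** Apply [goursat] to [ln k, 0] x [0, 2 pi]: the sides t = 0 and t = 2 pi cancel by periodicity, so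
    the angular integral is the same on the circles of radii rho and rho k. On the small circle G is
    close to G 0 by continuity. *)
Lemma mean_value (c : H) :
  J 0 (2 * pi) (fun t => qRe (c * G (rho%:C%C * cis t))) = 2 * pi * qRe (c * G 0).
Proof.
have pp : 0 < 2 * pi :> R by rewrite mulr_gt0// pi_gt0.
have pp0 := ltW pp.
have JQ a : a < 0 -> J 0 (2 * pi) (Q c 0) = J 0 (2 * pi) (Q c a).
  move=> a0; have na : 0 <= - a by lra.
  have := @goursat R (P c) (Q c) a 0 (- a) (2 * pi) na (ltW pp)
    (fun t => @Pcont c t) (fun s => @Qcont c s) (PQ c a0).
  rewrite /circulation add0r addrN.
  have -> : J a 0 (fun x => P c x 0 - P c x (2 * pi)) = 0.
    rewrite -[RHS](mul0r (0 - a)) -J_cst ?ltW//; apply: J_eq => x _.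
    by rewrite /P /logpt -[2 * pi]add0r cis_2pi subrr.
  rewrite add0r JB; [|exact: lint_cont (@Qcont c 0)|exact: lint_cont (@Qcont c a)].
  by move/eqP; rewrite subr_eq0 => /eqP.
have -> : J 0 (2 * pi) (fun t => qRe (c * G (rho%:C%C * cis t))) = J 0 (2 * pi) (Q c 0).
  by apply: J_eq => t _; rewrite /Q /logpt minxx expR0 mulr1.
apply/eqP; rewrite -subr_eq0 -normr_eq0 eq_le normr_ge0 andbT leNgt; apply/negP.
set X := `|_| => X0.
have c0 : 0 < `|c| + 1 by rewrite ltr_wpDl.
have c1 : 0 < 2 * (2 * pi * (`|c| + 1)) by rewrite mulr_gt0// mulr_gt0.
have h0 : hol i G 0 by apply: hG; rewrite normc0 ltW.
have [r r0 Hr] := hol_cont hi h0 (divr_gt0 X0 c1).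
(* k < 1 makes ln k negative, and rho k < r puts the inner circle where G is close enough to G 0 to
   give X <= X / 2. *)
pose k := Num.min 2^-1 (r / (2 * rho)).
have rr : 0 < 2 * rho by rewrite mulr_gt0.
have k0 : 0 < k by rewrite lt_min (divr_gt0 r0 rr) andbT invr_gt0.
have k1 : k < 1 by rewrite (@le_lt_trans _ _ 2^-1)// ?ge_min ?lexx//; lra.
have kr : rho * k < r.
  have : k * (2 * rho) <= r by rewrite -ler_pdivlMr ?mulr_gt0//; rewrite ge_min lexx orbT.
  by have := mulr_gt0 k0 rho0; lra.
have a0 : ln k < 0 by rewrite ln_lt0// k0.
have ptn t : normc (logpt (ln k) t) < r.
  rewrite /logpt min_l ?ltW// lnK ?posrE// normcM normc_cis mulr1 normc_real.
  by rewrite ger0_norm// mulr_ge0// ltW.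
suff : X <= X / 2 by lra.
rewrite {1}/X (JQ _ a0).
have -> : 2 * pi * qRe (c * G 0) = J 0 (2 * pi) (fun=> qRe (c * G 0)).
  by rewrite J_cst// subr0 mulrC.
rewrite -JB; [|exact: lint_cont (@Qcont c _)|exact: lint_cst].
apply: le_trans (J_norm _ _ _) _;
  first by apply: lintB; [exact: lint_cont (@Qcont c _)|exact: lint_cst].
apply: (@le_trans _ _ (J 0 (2 * pi) (fun=> X / (2 * (2 * pi))))).
  apply: J_le; [apply: lint_norm; apply: lintB; [exact: lint_cont (@Qcont c _)|exact: lint_cst]|
    exact: lint_cst|].
  move=> t _; rewrite /Q -qReB; apply: le_trans (qRe_le _ _) _.
  have := Hr _ (ptn t); rewrite add0r ler_pdivlMr// => h.
  rewrite ler_pdivlMr; last by rewrite mulr_gt0.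
  apply: le_trans h.
  set y := `|_ - _|; have y0 : 0 <= y by exact: normr_ge0.
  have := mulr_ge0 y0 (ltW pp); lra.
have half_avg (x p : R) : p != 0 -> x / (2 * (2 * p)) * (2 * p) = x / 2.
  by move=> p_neq0; field.
by rewrite J_cst// subr0 half_avg// gt_eqF// pi_gt0.
Qed.

End MeanValue.

(** * The lift of a Moebius map to the circle *)

Section CircleMap.
Variable R : realType.
Local Notation C := (R[i]).
Implicit Types (a b : C) (t s : R).

Let wr a t := 1 + (complex.Re a * cos t + complex.Im a * sin t).
Let wi a t := complex.Re a * sin t - complex.Im a * cos t.

(* [phi a] lifts T_a on the circle: T_a (e^it) = e^(i phi(t)), since the quotient
   defining T_a (e^it) is e^it conj(w) / w with w = 1 + conj(a) e^it = wr + i wi.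
   Its derivative [dphi a] is the Poisson kernel at [- a]. *)
Definition phi a t := t - 2 * atan (wi a t / wr a t).
Definition dphi a t := (1 - normc a ^+ 2) / (wr a t ^+ 2 + wi a t ^+ 2).

Let wE a t : 1 + conjc a * cis t = Complex (wr a t) (wi a t).
Proof.
case: a => a1 a2; apply/eqP; rewrite eq_complex /wr /wi /=; apply/andP.
by split; apply/eqP; ring.
Qed.

Let wr_gt0 a t : normc a < 1 -> 0 < wr a t.
Proof.
move=> a1; have := normc_Re (conjc a * cis t); rewrite normcM normc_conj normc_cis mulr1.
have -> : complex.Re (conjc a * cis t) = complex.Re a * cos t + complex.Im a * sin t.
  by case: a {a1} => a1 a2 /=; ring.
by rewrite ler_norml /wr => /andP[]; lra.
Qed.

Lemma conjc_cis t : conjc (cis t) = cis (- t).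
Proof. by rewrite /cis cosN sinN. Qed.

Lemma cis_conjc t : cis t * conjc (cis t) = 1.
Proof. by rewrite conjc_cis -cisD subrr cis0. Qed.

(** As Re w > 0, [atan] of wi / wr is the argument of w with no branch to choose, and conj w has the
    opposite angle. *)
Lemma cis_phi a t : normc a < 1 -> cis (phi a t) = Tc a (cis t).
Proof.
move=> a1; have w0 := wr_gt0 t a1.
have d0 : 1 + conjc a * cis t != 0 by rewrite Tc_den// normc_cis.
apply: (canRL (mulfK d0)); set th := atan (wi a t / wr a t).
have c0 : 0 < cos th by apply: cos_gt0_pihalf; rewrite atan_gtNpi2 atan_ltpi2.
have sE : sin th = cos th * (wi a t / wr a t).
  have := atanK (wi a t / wr a t); rewrite -/th /tan => <-.
  by rewrite mulrC divfK// gt_eqF.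
have w_polar : 1 + conjc a * cis t = (wr a t / cos th)%:C%C * cis th.
  have cn0 := lt0r_neq0 c0; have wn0 := lt0r_neq0 w0.
  rewrite wE; apply/eqP; rewrite eq_complex /= !mul0r subr0 addr0 sE divfK// eqxx /=.
  by apply/eqP; field; rewrite cn0 wn0.
have numE : cis t + a = cis t * conjc (1 + conjc a * cis t).
  rewrite rmorphD rmorph1 rmorphM /= conjcK mulrDr mulr1 mulrCA cis_conjc mulr1//.
have wc : conjc (1 + conjc a * cis t) = (wr a t / cos th)%:C%C * cis (- th).
  rewrite w_polar; apply/eqP; rewrite eq_complex /= cosN sinN.
  by apply/andP; split; apply/eqP; ring.
rewrite numE wc w_polar /phi -/th (_ : t - 2 * th = t + (- th - th)); last by ring.
have thN : cis (- th) * cis th = 1 by rewrite -cisD addNr cis0.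
rewrite !cisD; set K := (wr a t / cos th)%:C%C; set u := cis t; set v := cis (- th).
rewrite -/v in thN; transitivity (u * K * v * (v * cis th)); first by ring.
by rewrite thN mulr1 mulrA.
Qed.

Lemma dphi_gt0 a t : normc a < 1 -> 0 < dphi a t.
Proof.
move=> a1; rewrite divr_gt0//; first by have := normc_ge0 a; nra.
by rewrite ltr_pwDl ?sqr_ge0// exprn_gt0// wr_gt0.
Qed.

Lemma dphiE a t : dphi a t = (1 - normc a ^+ 2) / normc (1 + conjc a * cis t) ^+ 2.
Proof. by rewrite wE (normc_sq (Complex _ _)). Qed.

Let dwr a t : is_derive t (1 : R) (wr a) (- wi a t).
Proof. by rewrite /wr /wi; apply: is_derive_eq; rewrite /GRing.scale /=; ring. Qed.

Let dwi a t : is_derive t (1 : R) (wi a) (wr a t - 1).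
Proof. by rewrite /wr /wi; apply: is_derive_eq; rewrite /GRing.scale /=; ring. Qed.

Lemma is_derive_phi a t : normc a < 1 -> is_derive t (1 : R) (phi a) (dphi a t).
Proof.
move=> a1; have w0 : wr a t != 0 by rewrite gt_eqF// wr_gt0.
have dV := is_deriveV w0 (dwr a t).
have dQ := is_deriveM (dwi a t) dV.
have dA := is_derive1_comp (is_derive1_atan _) dQ.
have dP := is_deriveB (is_derive_id t (1 : R)) (is_deriveZ 2 dA).
apply: (@is_derive_eq _ _ _ _ _ _ _ _ dP).
have hN : normc a ^+ 2 = (wr a t - 1) ^+ 2 + wi a t ^+ 2.
  have -> : normc a ^+ 2 = normc a ^+ 2 * (cos t ^+ 2 + sin t ^+ 2) by rewrite cos2Dsin2 mulr1.
  by rewrite normc_sq /wr /wi; ring.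
have q0 : wr a t ^+ 2 + wi a t ^+ 2 != 0.
  by rewrite gt_eqF// ltr_pwDl ?sqr_ge0// exprn_gt0// wr_gt0.
rewrite /dphi hN /GRing.scale /= !fctE.
set x := wr a t in w0 q0 *; set y := wi a t in q0 *.
field; rewrite w0 /= addrC.
by rewrite addrC q0.
Qed.

Lemma phi_2pi a t : phi a (t + 2 * pi) = phi a t + 2 * pi.
Proof.
have e : cis (t + 2 * pi) = cis t by exact: cis_2pi.
case: e; rewrite /phi /wi /wr => -> ->; ring.
Qed.

Lemma dphi_2pi a t : dphi a (t + 2 * pi) = dphi a t.
Proof.
by have e : cis (t + 2 * pi) = cis t by [exact: cis_2pi]; case: e; rewrite /dphi /wi /wr => -> ->.
Qed.

Lemma dphi_continuous a : normc a < 1 -> continuous (dphi a).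
Proof.
move=> a1.
have cr : continuous (wr a).
  by move=> t; apply: differentiable_continuous; apply/derivable1_diffP; case: (dwr a t).
have ci : continuous (wi a).
  by move=> t; apply: differentiable_continuous; apply/derivable1_diffP; case: (dwi a t).
move=> t; apply: cvgM; first exact: cvg_cst.
apply: cvgV; first by rewrite gt_eqF// ltr_pwDl ?sqr_ge0// exprn_gt0// wr_gt0.
apply: cvgD; (apply: (cvg_comp _ (fun x : R => x ^+ 2)); last exact: exprn_continuous).
  exact: cr.
exact: ci.
Qed.

Lemma lint_dphi a (h : R -> R) : normc a < 1 -> lint h -> lint (fun t => h t * dphi a t).
Proof.
by move=> a1 lh; under eq_fun do rewrite mulrC; exact: lintMc (dphi_continuous a1) lh.
Qed.

Lemma cis_eq1 t : 0 <= t < 2 * pi -> cis t = 1 -> t = 0.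
Proof.
move=> /andP[t0 t2] [ct _]; apply/eqP; rewrite eq_le t0 andbT leNgt; apply/negP => tp.
have : 0 < sin (t / 2) by apply: sin_gt0_pi; lra.
have : cos (t / 2 + t / 2) = 1 by rewrite -splitr.
by rewrite cosD => h s0; have := cos2Dsin2 (t / 2); nra.
Qed.

Lemma cis_inj s t : cis s = cis t -> exists m : int, s = t + m%:~R * (2 * pi).
Proof.
move=> e; have e1 : cis (s - t) = 1.
  by rewrite cisD e -conjc_cis cis_conjc.
have [m [d [dE d2]]] := period_rep (s - t); exists m.
have cd : cis d = 1.
  rewrite -e1 dE.
  have pc : periodic (@cos R) (2 * pi) by move=> u; rewrite mulr_natl cosD2pi.
  have ps : periodic (@sin R) (2 * pi) by move=> u; rewrite mulr_natl sinD2pi.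
  by rewrite /cis (periodic_int m d pc) (periodic_int m d ps).
have d0 := cis_eq1 d2 cd; rewrite d0 add0r in dE.
by rewrite -dE addrC subrK.
Qed.

Lemma cis_periodic (F : R -> R) s t : periodic F (2 * pi) -> cis s = cis t -> F s = F t.
Proof. by move=> pF /cis_inj[m ->]; exact: periodic_int. Qed.

Lemma phiK a t : normc a < 1 -> cis (phi a (phi (- a) t)) = cis t.
Proof.
by move=> a1; rewrite cis_phi// cis_phi ?normcN// TcK ?normc_cis.
Qed.

Lemma phi_shift_int a t (m : int) : phi a (t + m%:~R * (2 * pi)) = phi a t + m%:~R * (2 * pi).
Proof.
have pF : periodic (fun t : R => phi a t - t : R) (2 * pi).
  by move=> u; rewrite phi_2pi; ring.
have := periodic_int m t pF => /= e.
have -> : phi a (t + m%:~R * (2 * pi)) = phi a (t + m%:~R * (2 * pi)) - (t + m%:~R * (2 * pi))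
  + (t + m%:~R * (2 * pi)) by ring.
by rewrite e; ring.
Qed.

(** phi a (phi (-a) y) and y have the same [cis], hence differ by whole periods, which phi commutes
    with. *)
Lemma phi_surj a y : normc a < 1 -> exists x, phi a x = y.
Proof.
move=> a1; have [m e] := cis_inj (phiK y a1).
exists (phi (- a) y + (- m)%:~R * (2 * pi)); rewrite phi_shift_int e.
by rewrite rmorphN /=; ring.
Qed.

Section ChangeOfVariables.
Variable a : C.
Hypothesis a1 : normc a < 1.
Let na1 : normc (- a) < 1. Proof. by rewrite normcN. Qed.

Lemma lint_phi (F : R -> R) : lint F -> lint (fun t => F (phi a t)).
Proof.
exact: (lint_comp (fun x => is_derive_phi x a1) (dphi_continuous a1)
  (fun x => dphi_gt0 x a1) (fun y => phi_surj y a1)).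
Qed.

Lemma periodic_phi (F : R -> R) : periodic F (2 * pi) ->
  periodic (fun t : R => F (phi a t) : R) (2 * pi).
Proof. by move=> pF t /=; rewrite phi_2pi pF. Qed.

(** Substitute t = phi (-a) s. The two lifts are inverse only modulo 2 pi and phi (-a) moves the
    interval of integration; periodicity of F settles both. *)
Lemma J_phi (F : R -> R) : lint F -> periodic F (2 * pi) ->
  J 0 (2 * pi) (fun t => F (phi a t)) = J 0 (2 * pi) (fun t => F t * dphi (- a) t).
Proof.
move=> lF pF; have lFp := lint_phi lF.
have := J_cv (fun x => is_derive_phi x na1) (dphi_continuous na1)
  (fun x => dphi_gt0 x na1) (fun y => phi_surj y na1) 0 (2 * pi) (proj1 lFp).
have -> : phi (- a) (2 * pi) = phi (- a) 0 + 2 * pi by rewrite -phi_2pi add0r.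
rewrite J_period//; last exact: periodic_phi.
move=> ->; apply: J_eq => t _; congr (_ * _).
exact: cis_periodic (phiK t a1).
Qed.

End ChangeOfVariables.

Lemma J_rotate (F : R -> R) s : lint F -> periodic F (2 * pi) ->
  J 0 (2 * pi) (fun t => F (t + s)) = J 0 (2 * pi) F.
Proof.
by move=> lF pF; rewrite -J_shift ?add0r 1?addrC ?J_period//; case: lF.
Qed.

Lemma phi_comp a b : normc a < 1 -> normc b < 1 -> exists s, forall t,
  cis (phi a (phi b t)) = cis (phi (Tc a b) (t + s)).
Proof.
move=> a1 b1; have [s sE] := polar (rot a b); exists s => t.
rewrite normc_rot// mul1r in sE.
rewrite !cis_phi//; last exact: Tc_lt1.
by rewrite Tc_comp ?normc_cis// sE cisD mulrC.
Qed.

End CircleMap.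

(** * The Poisson kernel in polar form *)

Section PoissonKernel.
Variable R : realType.
Local Notation C := (R[i]).
Implicit Types (r x s t : R) (a : C).

(** The usual denominator 1 - 2 r cos x + r^2, rewritten as a sum of terms that are nonnegative for
    r >= 0, from which upper and lower bounds can be read off. *)
Definition pker r x : R := (1 - r ^+ 2) / ((1 - r) ^+ 2 + 2 * r * (1 - cos x)).

Lemma dphi_pker r s t : 0 <= r -> dphi (- (r%:C%C * cis s)) t = pker r (t - s).
Proof.
move=> r0; rewrite dphiE normcN normcM normc_cis mulr1 normc_real ger0_norm// /pker.
congr (_ / _); rewrite normc_sq /= cosB.
have := cos2Dsin2 s; have := cos2Dsin2 t => ht hs.
transitivity (1 + r ^+ 2 * (cos s ^+ 2 + sin s ^+ 2) * (cos t ^+ 2 + sin t ^+ 2)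
  - 2 * r * (cos t * cos s + sin t * sin s)); first by ring.
by rewrite ht hs; ring.
Qed.

Lemma pkerN r x : pker r (- x) = pker r x.
Proof. by rewrite /pker cosN. Qed.

Lemma pker_continuous r : 0 <= r < 1 -> continuous (pker r).
Proof.
move=> /andP[r0 r1].
have a1 : normc (- (r%:C%C * cis 0)) < 1 :> R.
  by rewrite normcN normcM normc_cis mulr1 normc_real ger0_norm.
have -> : pker r = dphi (- (r%:C%C * cis 0)).
  by apply/funext => t; rewrite dphi_pker// subr0.
exact: dphi_continuous.
Qed.

Lemma pker_gt0 r x : 0 <= r < 1 -> 0 < pker r x.
Proof.
move=> /andP[r0 r1]; have := dphi_pker 0 x r0; rewrite subr0 => <-.
by apply: dphi_gt0; rewrite normcN normcM normc_cis mulr1 normc_real ger0_norm.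
Qed.

Lemma pker_2pi r x : pker r (x + 2 * pi) = pker r x.
Proof. by rewrite /pker (mulr_natl pi) cosD2pi. Qed.

Lemma J_dphi a : normc a < 1 -> J 0 (2 * pi) (dphi a) = 2 * pi.
Proof.
move=> a1; have na1 : normc (- a) < 1 by rewrite normcN.
have p1 : periodic (fun _ : R => 1 : R) (2 * pi) by [].
have := J_phi na1 (lint_cst 1) p1.
have pp : 0 <= 2 * pi :> R by rewrite mulr_ge0// pi_ge0.
rewrite J_cst// mul1r subr0 => h; rewrite [RHS]h.
by apply: J_eq => t _; rewrite mul1r opprK.
Qed.

Lemma J_pker r s : 0 <= r < 1 -> J 0 (2 * pi) (fun t => pker r (t - s)) = 2 * pi.
Proof.
move=> /andP[r0 r1].
have -> : (fun t => pker r (t - s)) = dphi (- (r%:C%C * cis s)).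
  by apply/funext => t; rewrite dphi_pker.
by apply: J_dphi; rewrite normcN normcM normc_cis mulr1 normc_real ger0_norm.
Qed.

Lemma lint_pker r s (h : R -> R) : 0 <= r < 1 -> lint h ->
  lint (fun t => h t * pker r (t - s)).
Proof.
move=> /andP[r0 r1] lh.
have -> : (fun t => h t * pker r (t - s)) = (fun t => h t * dphi (- (r%:C%C * cis s)) t).
  by apply/funext => t; rewrite dphi_pker.
by apply: lint_dphi => //; rewrite normcN normcM normc_cis mulr1 normc_real ger0_norm.
Qed.

End PoissonKernel.

Section PoissonFormula.
Variable R : realType.
Local Notation H := (quat R).
Local Notation C := (R[i]).
Implicit Types (a z : C) (r t : R) (u : C -> R).

(* The real components of a slice hyperholomorphic function, restricted to a
   slice: these are harmonic, and only these consequences matter. *)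
Definition poisson_disc u : Prop :=
  [/\ forall r, 0 <= r < 1 -> continuous (fun t => u (r%:C%C * cis t)),
      forall z, normc z < 1 -> u (r%:C%C * z) @[r --> (1 : R)^'-] --> u z &
      forall r a, 0 <= r < 1 -> normc a < 1 ->
        2 * pi * u (r%:C%C * a) =
        J 0 (2 * pi) (fun t => u (r%:C%C * cis t) * dphi (- a) t)].

Lemma normc_rM r z : 0 <= r -> normc (r%:C%C * z) = r * normc z.
Proof. by move=> r0; rewrite normcM normc_real ger0_norm. Qed.

(** The Poisson formula is the mean value formula for z -> f (r T_a z) on the unit circle, whose
    centre value is f (r a), followed by the change of variables [J_phi]. *)
Lemma slice_hyperholomorphic_poisson i f c : qsphere R i -> slice_hyperholomorphic f ->
  poisson_disc (fun z => qRe (c * f (emb i z))).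
Proof.
move=> hi hf.
have hol1 z : normc z < 1 -> hol i (f \o emb i) z.
  by move=> z1; exact: slice_hyperholomorphic_hol.
have cont r : 0 <= r < 1 -> continuous (fun t => qRe (c * f (emb i (r%:C%C * cis t)))).
  move=> /andP[r0 r1] t.
  apply: (@hol_curve_continuous _ i hi (f \o emb i) (fun t => r%:C%C * cis t)).
  - by apply: hol1; rewrite normc_rM// normc_cis mulr1.
  - have -> : (fun t => complex.Re (r%:C%C * cis t)) = (fun t => r * cos t).
      by apply/funext => x /=; rewrite mul0r subr0.
    by apply: cvgM; [exact: cvg_cst|exact: continuous_cos].
  - have -> : (fun t => complex.Im (r%:C%C * cis t)) = (fun t => r * sin t).
      by apply/funext => x /=; rewrite mul0r addr0.
    by apply: cvgM; [exact: cvg_cst|exact: continuous_sin].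
split => //.
- move=> z z1; apply/cvgrPdist_le => /= e e0.
  have c0 : 0 < `|c| + 1 by rewrite ltr_wpDl.
  have [d d0 Hd] := hol_cont hi (hol1 _ z1) (divr_gt0 e0 c0).
  near=> r.
  have -> : r%:C%C * z = z + (r - 1)%:C%C * z.
    by rewrite rmorphB rmorph1 mulrBl mul1r addrC subrK.
  rewrite distrC -qReB; apply: le_trans (qRe_le _ _) _.
  have w1 : normc ((r - 1)%:C%C * z) < d.
    rewrite normcM normc_real; apply: (@le_lt_trans _ _ (`|r - 1| * 1)).
      by rewrite ler_wpM2l// ltW.
    rewrite mulr1 distrC ger0_norm; first by near: r; exact: nbhs_left_ltBl.
    by rewrite subr_ge0; near: r; exact: nbhs_left_le.
  have := Hd _ w1; rewrite ler_pdivlMr// => h; apply: le_trans h.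
  by rewrite mulrC ler_wpM2l// lerDl.
- move=> r a /andP[r0 r1] a1.
  have := @mean_value _ i hi (fun z => f (emb i (r%:C%C * Tc a z))) 1 ltr01 _ c.
  rewrite Tc0 => <-; last first.
    move=> z z1; apply: (hol_Tc hi (G := f \o emb i)) => //; apply: hol1.
    by rewrite normc_rM//; have := Tc_le1 a1 z1; have := normc_ge0 (Tc a z); nra.
  rewrite -(J_phi a1 (lint_cont (cont r _))) ?r0//; last first.
    by move=> t; rewrite cis_2pi.
  by apply: J_eq => t _; rewrite mul1r cis_phi.
Unshelve. all: by end_near. Qed.

End PoissonFormula.

(** * Boundary functions *)

Section IteratedIntegrals.
Variable R : realType.
Local Notation mu := (@lebesgue_measure R).
Local Notation I := (`[0%R, (2 * pi)%R]%classic : set (measurableTypeR R)).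
Implicit Types (x y : R) (h : R -> R).

Lemma lint_bounded h (B : R) : measurable_fun [set: measurableTypeR R] h ->
  (forall t, `|h t| <= B) -> lint h.
Proof. by move=> mh hB; exact: lint_le mh hB (lint_cst B). Qed.

Lemma continuous_periodic_bounded h : continuous h -> periodic h (2 * pi) ->
  exists2 B : R, 0 <= B & forall t, `|h t| <= B.
Proof.
move=> ch ph; have pp : 0 <= 2 * pi :> R by rewrite mulr_ge0// pi_ge0.
have cn : continuous (fun t => `|h t|).
  by move=> t; apply: (@continuous_comp _ _ _ h (fun x => `|x|));
    [exact: ch|exact: norm_continuous].
have [c _ cmax] := EVT_max pp (continuous_subspaceT cn).
exists `|h c| => // t; have [m [s [-> /andP[s0 s1]]]] := period_rep t.
by rewrite periodic_int//; apply: cmax; rewrite in_itv/= s0 ltW.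
Qed.

Let integral_indic_mul (h : R -> R) :
  (\int[mu]_y (\1_I y * h y)%:E = \int[mu]_(y in I) (h y)%:E)%E.
Proof.
rewrite [RHS]integral_mkcond; apply: eq_integral => y _.
by rewrite patchE indicE; case: ifPn => _; rewrite ?mul1r ?mul0r.
Qed.

Section Tonelli.
Variable k : R -> R -> R.
Hypothesis mk : measurable_fun [set: measurableTypeR R * measurableTypeR R] (fun p => k p.1 p.2).
Hypothesis k0 : forall x y, 0 <= k x y.

Let mindic : measurable_fun [set: measurableTypeR R] (\1_I : R -> R).
Proof. exact: measurable_indic. Qed.

Lemma measurable_section_integral :
  measurable_fun [set: measurableTypeR R] (fun x => \int[mu]_(y in I) (k x y)%:E)%E.
Proof.
have mf : measurable_fun [set: measurableTypeR R * measurableTypeR R]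
    (fun p => (\1_I p.2 * k p.1 p.2)%:E).
  apply/measurable_EFinP; apply: measurable_funM => //.
  exact: (measurableT_comp mindic measurable_snd).
have f0 p : (0 <= (\1_I p.2 * k p.1 p.2)%:E)%E by rewrite lee_fin mulr_ge0.
have := measurable_fun_fubini_tonelli_F (m2 := mu) _ mf f0.
by apply: eq_measurable_fun => x _; rewrite /fubini_F /= integral_indic_mul.
Qed.

Lemma tonelli_swap : (\int[mu]_(x in I) \int[mu]_(y in I) (k x y)%:E =
  \int[mu]_(y in I) \int[mu]_(x in I) (k x y)%:E)%E.
Proof.
have mf : measurable_fun [set: measurableTypeR R * measurableTypeR R]
    (fun p => (\1_I p.1 * \1_I p.2 * k p.1 p.2)%:E).
  apply/measurable_EFinP; apply: measurable_funM => //; apply: measurable_funM.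
    exact: (measurableT_comp mindic measurable_fst).
  exact: (measurableT_comp mindic measurable_snd).
have f0 p : (0 <= (\1_I p.1 * \1_I p.2 * k p.1 p.2)%:E)%E by rewrite lee_fin !mulr_ge0.
have := fubini_tonelli (m1 := mu) (m2 := mu) _ mf f0.
have side (g : R -> R -> R) : (\int[mu]_x \int[mu]_y (\1_I x * \1_I y * g x y)%:E =
    \int[mu]_(x in I) \int[mu]_(y in I) (g x y)%:E)%E.
  rewrite [RHS]integral_mkcond; apply: eq_integral => x _.
  rewrite patchE [X in (\int[_]_y (X * _ * _)%:E)%E]indicE; case: ifPn => _.
    by rewrite -integral_indic_mul; apply: eq_integral => y _; rewrite mul1r.
  by rewrite integral0_eq// => y _; rewrite !mul0r.
rewrite /= side => ->; rewrite -(side (fun y x => k x y)).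
by apply: eq_integral => y _; apply: eq_integral => x _; rewrite [_ * \1_I y]mulrC.
Qed.

End Tonelli.

(* Adding the constant [B] reduces this to Tonelli. *)
Lemma J_swap (k : R -> R -> R) B :
  measurable_fun [set: measurableTypeR R * measurableTypeR R] (fun p => k p.1 p.2) ->
  (forall x y, `|k x y| <= B) ->
  lint (fun x => J 0 (2 * pi) (k x)) /\
  J 0 (2 * pi) (fun x => J 0 (2 * pi) (k x)) =
  J 0 (2 * pi) (fun y => J 0 (2 * pi) (k^~ y)).
Proof.
have pp : 0 <= 2 * pi :> R by rewrite mulr_ge0// pi_ge0.
have main (g : R -> R -> R) : measurable_fun [set: measurableTypeR R * measurableTypeR R]
  (fun p => g p.1 p.2) ->
   (forall x y, `|g x y| <= B) ->
   [/\ forall x, lint (g x), lint (fun x => J 0 (2 * pi) (g x)) &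
       (\int[mu]_(x in I) \int[mu]_(y in I) (g x y + B)%:E)%E =
        (J 0 (2 * pi) (fun x => J 0 (2 * pi) (g x)) + B * (2 * pi) * (2 * pi))%:E].
  move=> mg gB.
  have lg x : lint (g x).
    apply: lint_bounded (gB x).
    exact: (measurable_fun_pair2 x mg).
  have mg' : measurable_fun [set: measurableTypeR R * measurableTypeR R] (fun p => g p.1 p.2 + B).
    by apply: measurable_funD => //; exact: measurable_cst.
  have g0 x y : 0 <= g x y + B.
    by have := gB x y; rewrite ler_norml => /andP[? _]; rewrite -lerBlDr sub0r.
  have E x : (\int[mu]_(y in I) (g x y + B)%:E = (J 0 (2 * pi) (g x) + B * (2 * pi))%:E)%E.
    rewrite -JE; last by apply: lintD (lint_cst B).
    by rewrite JD//; [rewrite J_cst// subr0|exact: lint_cst].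
  have mJ : measurable_fun [set: measurableTypeR R] (fun x => J 0 (2 * pi) (g x)).
    have := measurable_section_integral mg' g0; under eq_fun do rewrite E.
    move/measurable_EFinP => h.
    have := measurable_funB h (measurable_cst (B * (2 * pi))).
    by apply: eq_measurable_fun => x _ /=; rewrite addrK.
  have lJ : lint (fun x => J 0 (2 * pi) (g x)).
    apply: (@lint_bounded _ (B * (2 * pi))) => // x.
    apply: le_trans (J_norm _ _ (lg x)) _.
    have -> : B * (2 * pi) = J 0 (2 * pi) (fun=> B) by rewrite J_cst// subr0.
    by apply: J_le => //; [exact: lint_norm|exact: lint_cst].
  split => //; under eq_integral do rewrite E.
  rewrite -JE; last by apply: lintD (lint_cst _).
  by rewrite JD//; [rewrite J_cst// subr0|exact: lint_cst].
move=> mk kB; have [_ lJ E1] := main k mk kB; split; first exact: lJ.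
have mk' : measurable_fun [set: measurableTypeR R * measurableTypeR R] (fun p => k p.2 p.1).
  exact: (measurableT_comp mk (measurable_fun_pair measurable_snd measurable_fst)).
have [_ _ E2] := main (fun y x => k x y) mk' (fun y x => kB x y).
have g0 x y : 0 <= k x y + B.
  by have := kB x y; rewrite ler_norml => /andP[? _]; rewrite -lerBlDr sub0r.
have mg' : measurable_fun [set: measurableTypeR R * measurableTypeR R] (fun p => k p.1 p.2 + B).
  by apply: measurable_funD => //; exact: measurable_cst.
by have := tonelli_swap mg' g0; rewrite E1 E2 => -[/addIr].
Qed.

End IteratedIntegrals.

(** * Square means over concentric circles *)

Section PoissonL2.
Variable R : realType.
Local Notation C := (R[i]).
Implicit Types (r s t : R).

Lemma J_kernel_swap (A B k : R -> R) : continuous A -> periodic A (2 * pi) ->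
  continuous B -> periodic B (2 * pi) -> continuous k -> periodic k (2 * pi) ->
  lint (fun s => J 0 (2 * pi) (fun t => A s * (B t * k (t - s)))) /\
  J 0 (2 * pi) (fun s => J 0 (2 * pi) (fun t => A s * (B t * k (t - s)))) =
  J 0 (2 * pi) (fun t => J 0 (2 * pi) (fun s => A s * (B t * k (t - s)))).
Proof.
move=> cA pA cB pB ck pk.
have [bA bA0 hA] := continuous_periodic_bounded cA pA.
have [bB bB0 hB] := continuous_periodic_bounded cB pB.
have [bk bk0 hk] := continuous_periodic_bounded ck pk.
apply: (@J_swap _ (fun s t => A s * (B t * k (t - s))) (bA * (bB * bk))).
  have mA : measurable_fun [set: measurableTypeR R] A by exact: continuous_measurable_fun.
  have mB : measurable_fun [set: measurableTypeR R] B by exact: continuous_measurable_fun.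
  have mk : measurable_fun [set: measurableTypeR R] k by exact: continuous_measurable_fun.
  apply: measurable_funM; first exact: (measurableT_comp mA measurable_fst).
  apply: measurable_funM; first exact: (measurableT_comp mB measurable_snd).
  apply: (measurableT_comp mk).
  by apply: measurable_funB; [exact: measurable_snd|exact: measurable_fst].
by move=> s t; rewrite !normrM; apply: ler_pM => //; apply: ler_pM.
Qed.

Variable u : C -> R.
Hypothesis hu : poisson_disc u.

Let U r t := u (r%:C%C * cis t).

Let U_periodic r : periodic (U r : R -> R) (2 * pi).
Proof. by move=> t; rewrite /U cis_2pi. Qed.

Let U_cont r : 0 <= r < 1 -> continuous (U r).
Proof. by case: hu => h _ _; exact: h. Qed.

Let U_lint r : 0 <= r < 1 -> lint (U r).
Proof. by move=> r1; exact: lint_cont (U_cont r1). Qed.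

Let pker_per r : periodic (@pker R r) (2 * pi).
Proof. by move=> x; exact: pker_2pi. Qed.

Let U_poisson r p s : 0 <= r < 1 -> 0 <= p < 1 ->
  2 * pi * U (r * p) s = J 0 (2 * pi) (fun t => U r t * pker p (t - s)).
Proof.
move=> r1 p1; have [p0 p_lt1] := andP p1; case: hu => _ _ h.
have n1 : normc (p%:C%C * cis s) < 1 by rewrite normc_rM// normc_cis mulr1.
rewrite /U rmorphM /= -[X in u X]mulrA h//.
by apply: J_eq => t _; rewrite dphi_pker.
Qed.

Let sq_cont (h : R -> R) : continuous h -> continuous (fun t => h t ^+ 2).
Proof.
move=> ch t; apply: (@continuous_comp _ _ _ h (fun x : R => x ^+ 2)); first exact: ch.
exact: exprn_continuous.
Qed.

Let rp1 r p : 0 <= r < 1 -> 0 <= p < 1 -> 0 <= r * p < 1.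
Proof.
move=> /andP[r0 r1] /andP[p0 p1]; rewrite mulr_ge0//=.
by apply: le_lt_trans p1; rewrite ler_piMl// ltW.
Qed.

Definition circle_sq r := J 0 (2 * pi) (fun t => u (r%:C%C * cis t) ^+ 2).

Let shift_lint (k : R -> R) s : continuous k -> lint (fun t => k (t - s)).
Proof. by move=> ck; exact: (lint_shift (- s) (lint_cont ck)). Qed.

(** Writing K for convolution with [pker p], U (r p) = K (U r), and K is symmetric because the
    kernel is even: the inner product of K U with itself is that of U with K K U. *)
Let circle_sq_cross r p : 0 <= r < 1 -> 0 <= p < 1 ->
  circle_sq (r * p) = J 0 (2 * pi) (fun t => U r t * U (r * p * p) t).
Proof.
move=> r1 p1; have rp := rp1 r1 p1; have rpp := rp1 rp p1.
have pp : 0 < 2 * pi :> R by rewrite mulr_gt0// pi_gt0.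
have ck := pker_continuous p1.
have [_ E] := J_kernel_swap (U_cont rp) (@U_periodic _) (U_cont r1) (@U_periodic _)
  ck (@pker_per p).
apply: (mulfI (lt0r_neq0 pp)).
rewrite -JZ; last by exact: lint_cont (sq_cont (U_cont rp)).
rewrite -JZ; last by exact: lintMc (U_cont r1) (U_lint rpp).
transitivity (J 0 (2 * pi) (fun s => J 0 (2 * pi)
  (fun t => U (r * p) s * (U r t * pker p (t - s))))).
  apply: J_eq => s _; rewrite JZ.
    by rewrite -(U_poisson s r1 p1) /U; ring.
  by apply: lintMc (U_cont r1) _; exact: shift_lint.
rewrite E; apply: J_eq => t _.
rewrite mulrCA (U_poisson t rp p1) -JZ; last by apply: lintMc (U_cont rp) _; exact: shift_lint.
by apply: J_eq => s _; rewrite mulrCA -pkerN opprB.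
Qed.

(** Jensen's inequality for the kernel: expanding the integral of (U - m)^2 against it, where m is
    the kernel mean, gives m^2 <= the mean of U^2. Integrating over s and swapping the integrals
    leaves the total mass of the kernel. *)
Let circle_sq_rp r p : 0 <= r < 1 -> 0 <= p < 1 -> circle_sq (r * p) <= circle_sq r.
Proof.
move=> r1 p1; have rp := rp1 r1 p1.
have pp : 0 < 2 * pi :> R by rewrite mulr_gt0// pi_gt0.
have ck := pker_continuous p1.
have c1 : continuous (fun _ : R => 1 : R) by move=> ?; exact: cvg_cst.
have sper : periodic (fun t : R => U r t ^+ 2 : R) (2 * pi) by move=> t; rewrite U_periodic.
have [lE E] := J_kernel_swap c1 (fun=> erefl) (sq_cont (U_cont r1)) sper ck (@pker_per p).
rewrite -(ler_pM2l pp) /circle_sq.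
rewrite -JZ; last by exact: lint_cont (sq_cont (U_cont rp)).
rewrite -JZ; last by exact: lint_cont (sq_cont (U_cont r1)).
have -> : J 0 (2 * pi) (fun t => 2 * pi * u (r%:C%C * cis t) ^+ 2) =
    J 0 (2 * pi) (fun t => J 0 (2 * pi) (fun s => 1 * (U r t ^+ 2 * pker p (t - s)))).
  apply: J_eq => t _.
  transitivity (J 0 (2 * pi) (fun s => U r t ^+ 2 * pker p (s - t))); last first.
    by apply: J_eq => s _; rewrite mul1r -pkerN opprB.
  rewrite JZ; last exact: shift_lint.
  rewrite mulrC; congr (_ * _).
  by rewrite J_pker.
rewrite -E; apply: (J_le _ lE); first by apply: lintZ; exact: lint_cont (sq_cont (U_cont rp)).
move=> s _; rewrite -/(U (r * p) s); clear E lE; set m := U (r * p) s.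
have lk := shift_lint s ck.
have l1 := lintMc (U_cont r1) lk.
have l2 := lintMc (sq_cont (U_cont r1)) lk.
have l3 := lintB l2 (lintZ (2 * m) l1).
have l4 := lintZ (m ^+ 2) lk.
have : 0 <= J 0 (2 * pi) (fun t => (U r t - m) ^+ 2 * pker p (t - s)).
  by apply: J_ge0 => t; apply: mulr_ge0; [exact: sqr_ge0|exact: ltW (pker_gt0 _ p1)].
have -> : (fun t => (U r t - m) ^+ 2 * pker p (t - s)) =
   (fun t => (U r t ^+ 2 * pker p (t - s) - (2 * m) * (U r t * pker p (t - s))) +
       m ^+ 2 * pker p (t - s)).
  by apply/funext => t; ring.
have -> := JD 0 (2 * pi) l3 l4.
have -> := JB 0 (2 * pi) l2 (lintZ (2 * m) l1).
have -> := JZ 0 (2 * pi) (2 * m) l1.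
have -> := JZ 0 (2 * pi) (m ^+ 2) lk.
rewrite -(U_poisson s r1 p1) -/m (J_pker s p1).
have -> : J 0 (2 * pi) (fun t => 1 * (U r t ^+ 2 * pker p (t - s))) =
    J 0 (2 * pi) (fun t => U r t ^+ 2 * pker p (t - s)).
  by apply: J_eq => t _; rewrite mul1r.
move: (J 0 _ _) => X; move: pp; move: (2 * pi) => P _; lra.
Qed.

Lemma circle_sq_le r' r : 0 <= r' -> r' <= r -> r < 1 -> circle_sq r' <= circle_sq r.
Proof.
rewrite le_eqVlt => /predU1P[<-|r'0]; rewrite le_eqVlt => /predU1P[->//|rr] r1.
  by rewrite -(mulr0 r); apply: circle_sq_rp; rewrite ?ltr01 ?lexx//= r1 ltW.
have r0 := lt_trans r'0 rr.
rewrite -(divfK (lt0r_neq0 r0) r') mulrC; apply: circle_sq_rp; first by rewrite r1 ltW.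
by rewrite divr_ge0 ?ltW//= ltr_pdivrMr// mul1r.
Qed.

(* The operators U_r |-> U_(rp) are self-adjoint and commute, so the cross term
   is the mass on the intermediate circle. *)
Lemma circle_sq_sub r' r : 0 < r' -> r' <= r -> r < 1 ->
  J 0 (2 * pi) (fun t => (u (r%:C%C * cis t) - u (r'%:C%C * cis t)) ^+ 2) <=
  circle_sq r - circle_sq r'.
Proof.
move=> r'0 rr r1; have r0 := lt_le_trans r'0 rr.
have r'1 := le_lt_trans rr r1.
have rI : 0 <= r < 1 by rewrite r1 ltW.
have rI' : 0 <= r' < 1 by rewrite r'1 ltW.
have [req|rne] := eqVneq r' r.
  rewrite req subrr (_ : (fun _ => _) = (fun=> 0)).
    by rewrite J_cst ?mul0r// mulr_ge0// pi_ge0.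
  by apply/funext => t; rewrite subrr expr0n.
have rlt : r' < r by rewrite lt_neqAle rne.
(* With r p p = r', the cross term of the circles r and r' is the mass on the circle of radius r
   p. *)
pose p := Num.sqrt (r' / r).
have p2 : p * p = r' / r by rewrite -expr2 sqr_sqrtr// divr_ge0 ?ltW.
have p0 : 0 <= p := sqrtr_ge0 _.
have p1 : p < 1 by rewrite -sqrtr1 ltr_sqrt// ltr_pdivrMr// mul1r.
have pI : 0 <= p < 1 by rewrite p0.
have rpp : r * p * p = r' by rewrite -mulrA p2 mulrC divfK// gt_eqF.
have h := circle_sq_cross rI pI; rewrite rpp in h.
have h2 : circle_sq r' <= circle_sq (r * p).
  by rewrite -rpp; apply: circle_sq_rp => //; exact: rp1.
have lr := lint_cont (sq_cont (U_cont rI)).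
have lr' := lint_cont (sq_cont (U_cont rI')).
have lc := lintMc (U_cont rI) (U_lint rI').
rewrite (_ : (fun _ => _) = (fun t => U r t ^+ 2 - 2 * (U r t * U r' t) + U r' t ^+ 2)); last first.
  by apply/funext => t; rewrite /U; ring.
rewrite JD//; last exact: lintB lr (lintZ _ lc).
rewrite JB//; last exact: lintZ.
rewrite JZ// -h -/(circle_sq r) -/(circle_sq r').
lra.
Qed.

End PoissonL2.

Lemma cvg_EFin_seq (R : realType) (f : nat -> R) (l : R) :
  f n @[n --> \oo] --> l -> (f n)%:E @[n --> \oo] --> l%:E.
Proof. by move=> fl; apply: cvg_EFin => //; exact: nearW. Qed.

(** * Limits of rapidly converging sequences in L^1 *)

Section RapidL1.
Variable R : realType.
Local Notation mu := (@lebesgue_measure R).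
Local Notation I := (`[0%R, (2 * pi)%R]%classic : set (measurableTypeR R)).
Variables (h : nat -> R -> R) (c : R).
Hypothesis lh : forall n, lint (h n).
Hypothesis ph : forall n, periodic (h n : R -> R) (2 * pi).
Hypothesis hJ : forall n, J 0 (2 * pi) (fun t => `|h n.+1 t - h n t|) <= c * 2^-1 ^+ n.

Let S (t : R) : \bar R := (\sum_(n <oo) (`|h n.+1 t - h n t|)%:E)%E.

Let ld n : lint (fun t => `|h n.+1 t - h n t|).
Proof. exact: lint_norm (lintB (lh n.+1) (lh n)). Qed.

Let mh n : measurable_fun I (EFin \o h n).
Proof. by case: (lh n) => m _; apply/measurable_EFinP; exact: measurable_funS m. Qed.

Let md n : measurable_fun I (fun t => (`|h n.+1 t - h n t|)%:E).
Proof. by case: (ld n) => m _; apply/measurable_EFinP; exact: measurable_funS m. Qed.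

Let mI : measurable I. Proof. exact: measurable_itv. Qed.

Let S_ge0 t : (0 <= S t)%E.
Proof. by apply: nneseries_ge0 => n _ _; rewrite lee_fin. Qed.

Let S_int : mu.-integrable I S.
Proof.
apply/integrableP; split.
  have := @ge0_emeasurable_sum _ _ R I (fun n t => (`|h n.+1 t - h n t|)%:E) xpredT
    (fun k x _ _ => normr_ge0 _) (fun k _ => md k).
  by apply: eq_measurable_fun => x _; rewrite /S; congr (limn _);
    apply/funext => n; apply: eq_bigl => k; rewrite inE.
under eq_integral do rewrite gee0_abs//.
rewrite integral_nneseries//; apply: (@le_lt_trans _ _ (2 * c)%:E); last exact: ltry.
apply: lime_le; first by apply: is_cvg_nneseries => n _ _; exact: integral_ge0.
apply: nearW => N.
have -> : (\sum_(0 <= n < N) \int[mu]_(x in I) (`|h n.+1 x - h n x|)%:E =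
   (\sum_(0 <= n < N) J 0 (2 * pi) (fun t => `|h n.+1 t - h n t|)%R)%:E)%E.
  by rewrite -sumEFin; apply: eq_bigr => n _; rewrite JE.
rewrite lee_fin.
have c0 : 0 <= c.
  have := hJ 0; rewrite expr0 mulr1; apply: le_trans.
  by apply: J_ge0.
(* Keeping the remainder of the geometric series in the bound makes the induction close. *)
suff : \sum_(0 <= n < N) J 0 (2 * pi) (fun t => `|h n.+1 t - h n t|) <= 2 * c - 2 * c * 2^-1 ^+ N.
  by move/le_trans; apply; rewrite lerBlDr lerDl !mulr_ge0// exprn_ge0.
elim: N => [|N IH]; first by rewrite big_nil expr0 mulr1 subrr.
rewrite big_nat_recr//= exprS.
have := hJ N; move: (J _ _ _) IH => x; set y := \sum_(_ <= _ < _) _; lra.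
Qed.

Let h_le t n : (`|(h n t)%:E| <= `|(h 0%N t)%:E| + S t)%E.
Proof.
have -> : h n t = h 0%N t + \sum_(0 <= k < n) (h k.+1 t - h k t).
  by rewrite telescope_sumr// addrC subrK.
rewrite EFinD; apply: le_trans (lee_abs_add _ _) _; apply: leeD => //.
apply: (@le_trans _ _ (\sum_(0 <= k < n) (`|h k.+1 t - h k t|)%:E)%E).
  by rewrite sumEFin lee_fin; exact: ler_norm_sum.
by apply: nneseries_lim_ge => k _ _; rewrite lee_fin.
Qed.

Let h_cvg t : S t \is a fin_num -> cvgn (h^~ t).
Proof.
move=> Sf; have -> : h^~ t = (fun n => h 0%N t + series (telescope (h^~ t)) n).
  by apply/funext => n; exact: (eq_sum_telescope (h^~ t)).
apply: is_cvgD; first exact: is_cvg_cst.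
apply: normed_cvg; apply: nondecreasing_is_cvgn.
  by apply: nondecreasing_series => n _ _; exact: normr_ge0.
exists (fine (S t)) => _ [n _ <-]; rewrite -lee_fin fineK//.
by rewrite /series/= -sumEFin; apply: nneseries_lim_ge => k _ _; rewrite lee_fin.
Qed.

(** The sequence converges only almost everywhere; the upper limit gives a function that is
    measurable and exactly periodic on the whole line. *)
Let F (t : R) : R := fine (limn_esup (fun n => (h n t)%:E)).

Let F_cvg t : S t \is a fin_num -> h n t @[n --> \oo] --> F t.
Proof.
move=> /h_cvg /cvg_ex[l hl]; have hlE : (h n t)%:E @[n --> \oo] --> l%:E by exact: cvg_EFin_seq.
by rewrite /F (cvg_limn_einf_sup hlE).2.
Qed.

(** The increments have summable L^1 norms, so their sum S is integrable, hence finite almost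
    everywhere, and |h 0| + S dominates the sequence. *)
Lemma rapid_L1_limit : exists F : R -> R, [/\ lint F, periodic F (2 * pi),
  J 0 (2 * pi) (fun t => `|h n t - F t|) @[n --> \oo] --> 0 &
  {ae mu, forall t, I t -> h n t @[n --> \oo] --> F t}].
Proof.
have aeF : {ae mu, forall t, I t -> h n t @[n --> \oo] --> F t}.
  by apply: filterS (integrable_ae mI S_int) => t St It; exact: F_cvg (St It).
have mF : measurable_fun [set: measurableTypeR R] F.
  apply: measurableT_comp => //; apply: measurable_fun_limn_esup => n.
  by apply/measurable_EFinP; case: (lh n).
have pF : periodic (F : R -> R) (2 * pi).
  by move=> t; rewrite /F; under eq_fun do rewrite ph.
have mFI : measurable_fun I (EFin \o F) by apply/measurable_EFinP; exact: measurable_funS mF.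
have aeF' : {ae mu, forall t, I t -> (EFin \o h n) t @[n --> \oo] --> (EFin \o F) t}.
  by apply: filterS aeF => t H /H; exact: cvg_EFin_seq.
have ig : mu.-integrable I (fun t => `|(h 0%N t)%:E| + S t)%E.
  exact: (integrableD mI (integrable_abse (lint_int 0 (2 * pi) (lh 0%N))) S_int).
have [iF cF _] := dominated_convergence mI mh mFI aeF' ig (aeW mu (fun t n _ => h_le t n)).
have lF := lint_periodic mF pF iF.
exists F; split => //.
move: cF => /fine_cvg; rewrite /=; apply: cvg_trans;
  rewrite (_ : _ \o _ = (fun n => J 0 (2 * pi) (fun t => `|h n t - F t|))) //.
Qed.

End RapidL1.

Section BoundaryFunction.
Variable R : realType.
Local Notation mu := (@lebesgue_measure R).
Local Notation I := (`[0%R, (2 * pi)%R]%classic : set (measurableTypeR R)).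
Local Notation C := (R[i]).
Implicit Types (r s t : R) (u : C -> R) (F : R -> R).

(** F is square integrable on the circle and u is its Poisson integral. Since F is a given function
    and not a limit, later identities about it hold without exceptional sets. *)
Definition boundary_of u F : Prop :=
  [/\ lint F, lint (fun t => F t ^+ 2), periodic (F : R -> R) (2 * pi) &
   forall a, normc a < 1 -> 2 * pi * u a = J 0 (2 * pi) (fun t => F t * dphi (- a) t)].

Let mI : measurable I. Proof. exact: measurable_itv. Qed.

Lemma integral_le_J F B : lint F -> J 0 (2 * pi) F <= B ->
  (\int[mu]_(t in I) (F t)%:E <= B%:E)%E.
Proof. by move=> lF h; rewrite -JE// lee_fin. Qed.

Lemma bounded_dphi a : normc a < 1 -> exists2 K : R, 0 <= K & forall t, `|dphi a t| <= K.
Proof.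
move=> a1; apply: (continuous_periodic_bounded (dphi_continuous a1)).
by move=> t; exact: dphi_2pi.
Qed.

(** Turns an L^2 bound into an L^1 bound: with q of the size of the L^2 norm it replaces the
    Cauchy-Schwarz inequality. *)
Lemma amgm (x q : R) : 0 < q -> `|x| <= (q + q^-1 * x ^+ 2) / 2.
Proof.
move=> q0; have qV : 0 < q^-1 by rewrite invr_gt0.
have : 0 <= q^-1 * (q - `|x|) ^+ 2 by rewrite mulr_ge0 ?sqr_ge0// ltW.
have -> : q^-1 * (q - `|x|) ^+ 2 = q - 2 * `|x| + q^-1 * `|x| ^+ 2.
  by field; exact: lt0r_neq0.
by move=> H; rewrite -(real_normK (num_real x)); lra.
Qed.

(** By [circle_sq_sub], the square of the L^2 distance between two circles is at most the gap of
    their masses. These masses increase to a supremum, so suitable radii give a sequence converging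
    fast enough for [rapid_L1_limit]. *)
Lemma poisson_boundary u B : poisson_disc u ->
  (forall r, 0 <= r < 1 -> circle_sq u r <= B) -> exists F, boundary_of u F.
Proof.
move=> hu uB.
pose A := [set circle_sq u r | r in [set r | 0 < r < 1]].
have half : 0 < (2^-1 : R) < 1 by apply/andP; split; lra.
have hsA : has_sup A.
  split; first by exists (circle_sq u 2^-1), 2^-1.
  by exists B => _ [r /andP[r0 r1] <-]; apply: uB; rewrite r1 ltW.
pose L := sup A.
have p2 n : 0 < (2^-1 : R) ^+ n by rewrite exprn_gt0// invr_gt0.
(* Mass within 4^-n of the supremum makes consecutive L^2 distances at most 2^-n; the other bound
   forces r n to 1. *)
have ex n : exists r, [/\ 1 - 2^-1 ^+ n.+1 <= r, 0 < r < 1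
  & L - (2^-1 ^+ n) ^+ 2 <= circle_sq u r <= L].
  have q0 : 0 < (2^-1 ^+ n : R) ^+ 2 by rewrite exprn_gt0.
  have [_ [s /andP[s0 s1] <-] hs] := sup_adherent q0 hsA.
  have m0 : 0 < Num.max s (1 - 2^-1 ^+ n.+1) < 1.
    by rewrite lt_max s0 gt_max s1/= ltrBlDr ltrDl.
  exists (Num.max s (1 - 2^-1 ^+ n.+1)); split => //; first by rewrite le_max lexx orbT.
  apply/andP; split; last by apply: sup_upper_bound => //; exists (Num.max s (1 - 2^-1 ^+ n.+1)).
  apply: (le_trans (ltW hs)); apply: circle_sq_le => //; first exact: ltW.
    by rewrite le_max lexx.
  by case/andP: m0.
have [r rE] := choice ex.
have rI n : 0 <= r n < 1 by have [_ /andP[r0 ->] _] := rE n; rewrite ltW.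
pose h n t := u ((r n)%:C%C * cis t).
have ch n : continuous (h n) by case: hu => H _ _; exact: H.
have lh n : lint (h n) := lint_cont (ch n).
have ph n : periodic (h n : R -> R) (2 * pi) by move=> t; rewrite /h cis_2pi.
have sub m n : J 0 (2 * pi) (fun t => (h n t - h m t) ^+ 2)
  <= `|circle_sq u (r n) - circle_sq u (r m)|.
  have [_ /andP[m0 m1] _] := rE m; have [_ /andP[n0 n1] _] := rE n.
  case: (leP (r m) (r n)) => [mn|/ltW nm].
    by apply: le_trans (circle_sq_sub hu m0 mn n1) (ler_norm _).
  rewrite distrC; apply: le_trans (ler_norm _); apply: le_trans (circle_sq_sub hu n0 nm m1).
  by rewrite le_eqVlt; apply/orP; left; apply/eqP; apply: J_eq => t _; rewrite -sqrrN opprB.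
have hJ n : J 0 (2 * pi) (fun t => `|h n.+1 t - h n t|) <= (pi + 2^-1) * 2^-1 ^+ n.
  have ls : lint (fun t => (h n.+1 t - h n t) ^+ 2).
    apply: lint_cont => t; apply: (@continuous_comp _ _ _
      (fun t => h n.+1 t - h n t) (fun x : R => x ^+ 2)).
      by apply: cvgB; exact: ch.
    exact: exprn_continuous.
  (* [amgm] with weight q = 2^-n integrates to at most pi q + q^-1 q^2 / 2, which is (pi + 1/2)
     2^-n. *)
  set q : R := 2^-1 ^+ n; have q0 : 0 < q := p2 n.
  have le1 : J 0 (2 * pi) (fun t => `|h n.+1 t - h n t|) <=
      J 0 (2 * pi) (fun t => q / 2 + (q^-1 / 2) * (h n.+1 t - h n t) ^+ 2).
    apply: J_le; [exact: lint_norm (lintB (lh _) (lh _))|exact: lintD (lint_cst _) (lintZ _ ls)|].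
    by move=> t _; apply: le_trans (amgm _ q0) _; lra.
  apply: (le_trans le1); rewrite JD; [|exact: lint_cst|exact: lintZ].
  have pp : 0 <= 2 * pi :> R by rewrite mulr_ge0// pi_ge0.
  have -> : J 0 (2 * pi) (fun=> q / 2) = q / 2 * (2 * pi) by rewrite J_cst// subr0.
  rewrite JZ//.
  have jq : J 0 (2 * pi) (fun t => (h n.+1 t - h n t) ^+ 2) <= q ^+ 2.
    apply: le_trans (sub _ _) _.
    have [_ _ /andP[a1 a2]] := rE n; have [_ _ /andP[b1 b2]] := rE n.+1.
    have b3 : (2^-1 ^+ n.+1 : R) ^+ 2 <= q ^+ 2.
      rewrite [2^-1 ^+ n.+1]exprS -/q exprMn; have := sqr_ge0 q; move: (q ^+ 2) => z z0.
      by rewrite expr2; lra.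
    rewrite ler_norml -/q in a1 *; apply/andP; split; lra.
  have h3 : q^-1 / 2 * J 0 (2 * pi) (fun t => (h n.+1 t - h n t) ^+ 2) <= q / 2.
    apply: (@le_trans _ _ (q^-1 / 2 * q ^+ 2)).
      by rewrite ler_wpM2l// divr_ge0// invr_ge0 ltW.
    by rewrite mulrAC expr2 mulrA mulVf ?mul1r// gt_eqF.
  by move: h3; move: (J _ _ _) => X; lra.
have [F [lF pF cF aF]] := rapid_L1_limit lh ph hJ.
have r1 : r n @[n --> \oo] --> (1 : R).
  apply: (@squeeze_cvgr _ _ _ _ (fun n => 1 - 2^-1 ^+ n.+1) (fun=> 1)).
  - by apply: nearW => n; have [-> /andP[_ /ltW]] := rE n.
  - rewrite -[X in _ --> X]subr0; apply: cvgB; first exact: cvg_cst.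
    rewrite (_ : (fun n => _) = (fun n => [sequence (2^-1 : R) ^+ n]_n (n + 1)%N)); last first.
      by apply/funext => n /=; rewrite addn1.
    by rewrite cvg_shiftn; apply: cvg_expr; rewrite ger0_norm ?invr_ge0//; lra.
  - exact: cvg_cst.
have hu' : forall z, normc z < 1 -> u ((r n)%:C%C * z) @[n --> \oo] --> u z.
  move=> z z1; case: hu => _ cu _; have /cvg_at_leftP := cu z z1; apply; split => // n.
  by have [_ /andP[]] := rE n.
exists F; split => //.
- have mF2 : measurable_fun [set: measurableTypeR R] (fun t => F t ^+ 2).
    by apply: measurable_funX; case: lF.
  have pF2 : periodic (fun t : R => F t ^+ 2 : R) (2 * pi) by move=> t; rewrite pF.
  apply: (lint_periodic mF2 pF2); apply/integrableP; split.
    by apply/measurable_EFinP; exact: measurable_funS mF2.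
  have mh2 n : measurable_fun I (fun t => (h n t ^+ 2)%:E).
    apply/measurable_EFinP; apply: measurable_funX.
    by case: (lh n) => mh _; exact: measurable_funS mh.
  apply: (@le_lt_trans _ _ B%:E); last exact: ltry.
  (* Fatou's lemma: F^2 is almost everywhere the limit of h n ^2, whose integrals are bounded by
     B. *)
  have -> : (\int[mu]_(t in I) `|(EFin \o (fun t => (F t ^+ 2)%R)) t| =
      \int[mu]_(t in I) limn_einf (fun n => (h n t ^+ 2)%:E))%E.
    apply: ae_eq_integral_gen => //; apply: filterS aF => t H /H ht /=.
    rewrite ger0_norm ?sqr_ge0//; apply/esym.
    have h2 : h n t ^+ 2 @[n --> \oo] --> F t ^+ 2.
      exact: (cvg_comp _ (fun x : R => x ^+ 2) ht (@exprn_continuous R 2 (F t))).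
    by rewrite (cvg_limn_einf_sup (cvg_EFin_seq h2)).1.
  apply: le_trans (fatou mu mI mh2 _) _; first by move=> n t _; rewrite lee_fin sqr_ge0.
  rewrite limn_einf_lim; apply: lime_le; first exact: is_cvg_einfs.
  apply: nearW => n; apply: (@le_trans _ _ (\int[mu]_(t in I) (h n t ^+ 2)%:E)%E).
    by apply: ereal_inf_lbound; exists n => /=.
  apply: integral_le_J; last exact: uB.
  exact: lintMc (ch n) (lh n).
- move=> a a1; have na1 : normc (- a) < 1 by rewrite normcN.
  have [K K0 hK] := bounded_dphi na1.
  have ck := dphi_continuous na1.
  have lk G : lint G -> lint (fun t => G t * dphi (- a) t) by exact: lint_dphi.
  have c1 : 2 * pi * u ((r n)%:C%C * a) @[n --> \oo] --> 2 * pi * u a.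
    by apply: cvgM; [exact: cvg_cst|exact: hu'].
  apply: (cvg_unique _ c1) => //.
  apply/cvgrPdist_le => e e0.
  have K1 : 0 < K + 1 by rewrite ltr_wpDl.
  have /cvgrPdist_le/(_ _ (divr_gt0 e0 K1)) := cF; apply: filterS => n.
  rewrite sub0r normrN ger0_norm; last by apply: J_ge0.
  rewrite ler_pdivlMr// => hn; apply: le_trans hn.
  have hn : 2 * pi * u ((r n)%:C%C * a) = J 0 (2 * pi) (fun t => h n t * dphi (- a) t).
    by case: hu => _ _; apply.
  rewrite hn -JB; [|exact: lk|exact: lk].
  apply: le_trans (J_norm _ _ (lintB (lk _ lF) (lk _ (lh n)))) _.
  rewrite [leRHS]mulrC -JZ; last exact: lint_norm (lintB (lh n) lF).
  apply: J_le; [exact: lint_norm (lintB (lk _ lF) (lk _ (lh n)))|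
    exact: lintZ (lint_norm (lintB (lh n) lF))|].
  move=> t _; rewrite -mulrBl normrM mulrC distrC ler_wpM2r//.
  by apply: le_trans (hK t) _; rewrite lerDl.
Qed.

(** The converse bound, through which f o_i T_a is seen to be in H^2 once its boundary function is
    known. Jensen as on inner circles; F being merely square integrable, the order of integration is
    exchanged by Tonelli. *)
Lemma circle_sq_boundary u F r : poisson_disc u -> boundary_of u F -> 0 <= r < 1 ->
  circle_sq u r <= J 0 (2 * pi) (fun t => F t ^+ 2).
Proof.
move=> hu [lF lF2 pF aF] rI; have [r0 r1] := andP rI.
have pp : 0 < 2 * pi :> R by rewrite mulr_gt0// pi_gt0.
have ck := pker_continuous rI.
have n1 s : normc (r%:C%C * cis s) < 1 by rewrite normc_rM// normc_cis mulr1.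
have lFk s (G : R -> R) : lint G -> lint (fun t => G t * pker r (t - s)) by exact: lint_pker.
have cu : continuous (fun t => u (r%:C%C * cis t)) by case: hu => h _ _; exact: h.
have lu2 : lint (fun t => u (r%:C%C * cis t) ^+ 2) := lintMc cu (lint_cont cu).
have jensen s : 2 * pi * u (r%:C%C * cis s) ^+ 2
  <= J 0 (2 * pi) (fun t => F t ^+ 2 * pker r (t - s)).
  set m := u _.
  have mE : 2 * pi * m = J 0 (2 * pi) (fun t => F t * pker r (t - s)).
    by rewrite aF//; apply: J_eq => t _; rewrite dphi_pker.
  have : 0 <= J 0 (2 * pi) (fun t => (F t - m) ^+ 2 * pker r (t - s)).
    by apply: J_ge0 => t; apply: mulr_ge0; [exact: sqr_ge0|exact: ltW (pker_gt0 _ rI)].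
  have -> : (fun t => (F t - m) ^+ 2 * pker r (t - s)) =
     (fun t => (F t ^+ 2 * pker r (t - s) - (2 * m) * (F t * pker r (t - s))) +
         m ^+ 2 * pker r (t - s)).
    by apply/funext => t; ring.
  have l1 := lFk s _ lF; have l2 := lFk s _ lF2; have l3 := lint_shift (- s) (lint_cont ck).
  have -> := JD 0 (2 * pi) (lintB l2 (lintZ (2 * m) l1)) (lintZ (m ^+ 2) l3).
  have -> := JB 0 (2 * pi) l2 (lintZ (2 * m) l1).
  have -> := JZ 0 (2 * pi) (2 * m) l1.
  have -> := JZ 0 (2 * pi) (m ^+ 2) l3.
  rewrite -mE J_pker//; move: (J 0 _ _) => X; move: (2 * pi) => P; lra.
rewrite -(ler_pM2l pp) -(JZ _ _ _ lu2) -lee_fin (JE _ _ (lintZ _ lu2)).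
have mF2 : measurable_fun [set: measurableTypeR R] (fun t => F t ^+ 2) by case: lF2.
have mk : measurable_fun [set: measurableTypeR R * measurableTypeR R]
    (fun p => F p.2 ^+ 2 * pker r (p.2 - p.1)).
  apply: measurable_funM; first exact: (measurableT_comp mF2 measurable_snd).
  apply: (measurableT_comp (continuous_measurable_fun ck)).
  by apply: measurable_funB; [exact: measurable_snd|exact: measurable_fst].
have k0 x y : 0 <= F y ^+ 2 * pker r (y - x).
  by apply: mulr_ge0; [exact: sqr_ge0|exact: ltW (pker_gt0 _ rI)].
apply: (@le_trans _ _ (\int[mu]_(x in I) \int[mu]_(y in I) (F y ^+ 2 * pker r (y - x))%:E)%E).
  apply: ge0_le_integral => //.
  - by move=> t _; rewrite lee_fin mulr_ge0 ?sqr_ge0// ltW.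
  - by apply/measurable_EFinP; case: (lintZ (2 * pi) lu2) => m _; exact: measurable_funS m.
  - by apply: measurable_funS (measurable_section_integral
    (k := fun x y => F y ^+ 2 * pker r (y - x)) mk k0).
  - by move=> t _; rewrite -JE ?lee_fin//; exact: lFk.
rewrite (tonelli_swap (k := fun x y => F y ^+ 2 * pker r (y - x)) mk k0).
rewrite -(JZ _ _ _ lF2) (JE _ _ (lintZ _ lF2)).
rewrite le_eqVlt; apply/orP; left; apply/eqP; apply: eq_integral => t _.
have lks := lint_shift (- t) (lint_cont ck).
transitivity ((J 0 (2 * pi) (fun s => F t ^+ 2 * pker r (s - t)))%:E).
  rewrite (JE _ _ (lintZ _ lks)); apply: eq_integral => s _.
  by rewrite -pkerN opprB.
by rewrite (JZ _ _ _ lks) J_pker// mulrC.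
Qed.

End BoundaryFunction.

(** * Radial limits *)

Section DyadicBounds.
Variable R : realType.
Implicit Types (r s t x v w : R) (h : R -> R) (n m k : nat).

(** Halving the angle divides 1 - cos by at most 4: 1 - cos 2y = 2 (1 - cos y)(1 + cos y) <= 4 (1 -
    cos y). *)
Lemma one_sub_cos_dyadic m : 2 * 4^-1 ^+ m <= 1 - cos (pi * 2^-1 ^+ m) :> R.
Proof.
elim: m => [|m IH]; first by rewrite !expr0 !mulr1 cospi opprK.
set y := pi * 2^-1 ^+ m.+1.
have e : pi * 2^-1 ^+ m = y *+ 2 :> R by rewrite /y exprS -mulr_natl; lra.
rewrite e cos_mulr2n -mulr_natl in IH; rewrite exprS.
have c1 : cos y <= 1 := cos_le1 y.
have : (1 - cos y) * (1 + cos y) <= (1 - cos y) * 2 by apply: ler_wpM2l; lra.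
have -> : (1 - cos y) * (1 + cos y) = 1 - cos y ^+ 2 by ring.
move: IH; move: (4^-1 ^+ m) (cos y ^+ 2) => q c2; lra.
Qed.

Lemma one_sub_cos_ge m x : pi * 2^-1 ^+ m <= `|x| -> `|x| <= pi ->
  2 * 4^-1 ^+ m <= 1 - cos x.
Proof.
move=> h1 h2; have e : cos x = cos `|x| by case: (ger0P x) => _; rewrite ?cosN.
have p0 : 0 <= pi :> R := pi_ge0 R.
have w0 : 0 <= pi * 2^-1 ^+ m :> R by rewrite mulr_ge0// exprn_ge0// invr_ge0.
apply: le_trans (one_sub_cos_dyadic m) _; rewrite lerD2l lerN2 e leNgt.
by rewrite ltr_cos ?in_itv/= ?normr_ge0 ?h2 ?w0 ?(le_trans h1 h2)// -leNgt.
Qed.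

Lemma pker_le r n x : 0 <= r -> 2^-1 ^+ n.+1 <= 1 - r -> pker r x <= 4 * 2 ^+ n.
Proof.
move=> r0 hr; have q0 : 0 < (2^-1 : R) ^+ n.+1 by rewrite exprn_gt0.
have r1 : 0 < 1 - r by apply: lt_le_trans hr.
have d0 : 0 < (1 - r) ^+ 2 by rewrite exprn_gt0.
have c0 : 0 <= 2 * r * (1 - cos x) by rewrite !mulr_ge0// subr_ge0 cos_le1.
have p2 : 2 * 2 ^+ n * 2^-1 ^+ n.+1 = 1 :> R.
  by rewrite -exprS -exprMn divff// expr1n.
rewrite /pker ler_pdivrMr; last by rewrite ltr_wpDr.
have : 1 <= 2 * 2 ^+ n * (1 - r).
  by rewrite -[leLHS]p2 ler_wpM2l// mulr_ge0// exprn_ge0.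
have P0 : 0 < (2 : R) ^+ n by rewrite exprn_gt0.
move: (2 ^+ n) P0 => P P0 h.
have : 1 - r ^+ 2 <= 2 * (1 - r) by nra.
have : 2 * (1 - r) * 1 <= 2 * (1 - r) * (2 * P * (1 - r)) by rewrite ler_wpM2l// mulr_ge0// ltW.
have := mulr_ge0 (ltW P0) c0.
lra.
Qed.

Lemma pker_le_dyadic r m x : 2^-1 <= r -> r < 1 -> pi * 2^-1 ^+ m <= `|x| -> `|x| <= pi ->
  pker r x <= 4 ^+ m * (1 - r).
Proof.
move=> r2 r1 h1 h2; have := one_sub_cos_ge h1 h2.
have q4 : 4 ^+ m * 4^-1 ^+ m = 1 :> R by rewrite -exprMn divff// expr1n.
have P0 : 0 < (4 : R) ^+ m by rewrite exprn_gt0.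
move: (4 ^+ m) (4^-1 ^+ m) P0 q4 => P q P0 q4 h.
have q0 : 0 < q by have : 0 < P * q by [rewrite q4]; rewrite pmulr_rgt0.
have d0 : 0 < (1 - r) ^+ 2 by rewrite exprn_gt0// subr_gt0.
have k1 : 2 * q <= 2 * r * (1 - cos x) by nra.
rewrite /pker ler_pdivrMr; last by nra.
have : P * (1 - r) * (2 * q) <= P * (1 - r) * ((1 - r) ^+ 2 + 2 * r * (1 - cos x)).
  by rewrite ler_wpM2l ?mulr_ge0 ?ltW ?subr_gt0//; lra.
have -> : P * (1 - r) * (2 * q) = 2 * (1 - r)
  by transitivity (2 * (1 - r) * (P * q)); [ring|rewrite q4 mulr1].
apply: le_trans; nra.
Qed.

Definition Jball s w h := J (s - w) (s + w) h.

Lemma Jball_annulus (h k : R -> R) s v w K : 0 <= v -> v <= w -> lint h -> (forall t, 0 <= h t) ->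
  lint (fun t => h t * k (t - s)) ->
  (forall x, v <= `|x| -> `|x| <= w -> k x <= K) -> 0 <= K ->
  Jball s w (fun t => h t * k (t - s)) <=
  Jball s v (fun t => h t * k (t - s)) + K * Jball s w h.
Proof.
move=> v0 vw lh h0 lhk kK K0; rewrite /Jball.
have [a1 a2 a3] : [/\ s - w <= s - v, s - v <= s + v & s + v <= s + w] by split; lra.
have a23 := le_trans a2 a3; have a12 := le_trans a1 a2.
rewrite (J_split a1 a23 lhk) (J_split a2 a3 lhk).
rewrite (J_split a1 a23 lh) (J_split a2 a3 lh).
have lK := lintZ K lh.
have b1 : J (s - w) (s - v) (fun t => h t * k (t - s)) <= K * J (s - w) (s - v) h.
  rewrite -(JZ _ _ _ lh); apply: (J_le lhk lK) => t /andP[t1 t2].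
  rewrite mulrC ler_wpM2r//; apply: kK; rewrite ler0_norm; lra.
have b2 : J (s + v) (s + w) (fun t => h t * k (t - s)) <= K * J (s + v) (s + w) h.
  rewrite -(JZ _ _ _ lh); apply: (J_le lhk lK) => t /andP[t1 t2].
  rewrite mulrC ler_wpM2r//; apply: kK; rewrite ger0_norm; lra.
have b3 : 0 <= K * J (s - v) (s + v) h by rewrite mulr_ge0// J_ge0.
rewrite !mulrDr; lra.
Qed.

Definition wd k : R := pi * 2^-1 ^+ k.

(* The bound 4 sum_(k <= n) 4^k 2^-n 1_(|x| <= pi 2^-k) for the kernel, indexed
   from the inside by l = n - k. *)
Lemma Jball_pker_le r s h n m : 0 <= r < 1 -> 2^-1 ^+ n.+1 <= 1 - r <= 2^-1 ^+ n ->
  (m <= n)%N -> lint h -> (forall t, 0 <= h t) ->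
  Jball s (wd (n - m)) (fun t => h t * pker r (t - s)) <=
  4 * \sum_(l < m.+1) 2 ^+ n * 4^-1 ^+ l * Jball s (wd (n - l)) h.
Proof.
move=> rI /andP[nr rn] mn lh h0; have lhk := lint_pker s rI lh.
have [r0 r1] := andP rI.
have p0 : 0 <= pi :> R := pi_ge0 R.
elim: m mn => [|m IH] mn.
  rewrite big_ord_recl big_ord0 expr0 mulr1 addr0 subn0 /Jball mulrA.
  have lK := lintZ (4 * 2 ^+ n) lh.
  rewrite -(JZ _ _ _ lh); apply: (J_le lhk lK) => t _.
  by rewrite mulrC ler_wpM2r// pker_le.
rewrite big_ord_recr /=.
have nm : (n - m = (n - m.+1).+1)%N by rewrite subnS prednK// subn_gt0.
have w1 : 0 <= wd (n - m) by rewrite mulr_ge0// exprn_ge0.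
have w2 : wd (n - m) <= wd (n - m.+1).
  rewrite /wd nm exprS ler_wpM2l//; have : 0 <= (2^-1 : R) ^+ (n - m.+1) by rewrite exprn_ge0.
  by move: (_ ^+ _) => z; lra.
have w3 : wd (n - m.+1) <= pi by rewrite /wd ler_piMr// exprn_ile1//; lra.
have n1 : (0 < n)%N by apply: leq_ltn_trans mn.
have r2 : 2^-1 <= r.
  have : (2^-1 : R) ^+ n <= 2^-1.
    by case: (n) n1 => // n' _; rewrite exprS ler_piMr// exprn_ile1//; lra.
  by lra.
have K0 : 0 <= 4 ^+ (n - m) * 2^-1 ^+ n :> R by rewrite mulr_ge0// exprn_ge0.
have kb x : wd (n - m) <= `|x| -> `|x| <= wd (n - m.+1) -> pker r x <= 4 ^+ (n - m) * 2^-1 ^+ n.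
  move=> x1 x2; apply: le_trans (pker_le_dyadic r2 r1 x1 (le_trans x2 w3)) _.
  by rewrite ler_wpM2l// exprn_ge0.
apply: le_trans (Jball_annulus w1 w2 lh h0 lhk kb K0) _.
rewrite mulrDr; apply: lerD; first by apply: IH; exact: ltnW.
rewrite mulrA ler_wpM2r//; first exact: J_ge0.
rewrite le_eqVlt; apply/orP; left; apply/eqP.
have e1 : 4 ^+ (n - m) = 4 ^+ n * 4^-1 ^+ m :> R.
  by rewrite -[in RHS](subnK (ltnW mn)) exprD -mulrA -exprMn divff// expr1n mulr1.
have e2 : (4 : R) ^+ n = 2 ^+ n * 2 ^+ n by rewrite -exprMn -natrM.
have e3 : 2 ^+ n * 2^-1 ^+ n = 1 :> R by rewrite -exprMn divff// expr1n.
rewrite e1 e2 exprS; set q : R := 4^-1 ^+ m.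
transitivity (2 ^+ n * (2 ^+ n * 2^-1 ^+ n) * q); first by ring.
by rewrite e3; lra.
Qed.

Lemma geometric_sum_le x m : 0 <= x < 1 -> \sum_(l < m) x ^+ l <= (1 - x)^-1.
Proof.
move=> /andP[x0 x1]; have y0 : 0 < 1 - x by rewrite subr_gt0.
rewrite -[leRHS]mul1r ler_pdivlMr//.
have -> : (\sum_(l < m) x ^+ l) * (1 - x) = 1 - x ^+ m.
  elim: m => [|m IH]; first by rewrite big_ord0 mul0r expr0 subrr.
  by rewrite big_ord_recr /= mulrDl IH exprS; ring.
by rewrite lerBlDr lerDl exprn_ge0.
Qed.

(** If averages of h over dyadic balls grow outwards at most like q^l, the kernel bound turns them
    into a geometric series of ratio q/2. It serves with q = 1 at Lebesgue points and with q = 3/2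
    for bounded mean oscillation. *)
Lemma Jball_pker_geometric r s h n m (A q : R) : 0 <= r < 1 ->
  2^-1 ^+ n.+1 <= 1 - r <= 2^-1 ^+ n -> (m <= n)%N -> lint h -> (forall t, 0 <= h t) ->
  0 <= A -> 0 <= q < 2 ->
  (forall l, (l <= m)%N -> Jball s (wd (n - l)) h <= A * 2^-1 ^+ (n - l) * q ^+ l) ->
  Jball s (wd (n - m)) (fun t => h t * pker r (t - s)) <= 4 * A * (1 - q / 2)^-1.
Proof.
move=> rI rn mn lh h0 A0 /andP[q0 q2] hD.
apply: (le_trans (Jball_pker_le s rI rn mn lh h0)).
rewrite -mulrA ler_wpM2l//.
have qI : 0 <= q / 2 < 1 by rewrite divr_ge0//=; lra.
apply: (@le_trans _ _ (A * \sum_(l < m.+1) (q / 2) ^+ l)); last first.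
  by rewrite ler_wpM2l// geometric_sum_le.
rewrite mulr_sumr; apply: ler_sum => -[l /= lm] _; rewrite ltnS in lm.
have ln := leq_trans lm mn.
have c0 : 0 <= 2 ^+ n * 4^-1 ^+ l :> R by rewrite mulr_ge0 ?exprn_ge0.
apply: le_trans (ler_wpM2l c0 (hD l lm)) _.
rewrite le_eqVlt; apply/orP; left; apply/eqP.
have -> : (2 : R) ^+ n = 2 ^+ (n - l) * 2 ^+ l by rewrite -exprD subnK.
have e1 : 2 ^+ (n - l) * 2^-1 ^+ (n - l) = 1 :> R by rewrite -exprMn divff// expr1n.
have -> : (4^-1 : R) ^+ l = 2^-1 ^+ l * 2^-1 ^+ l by rewrite -exprMn -invfM -natrM.
have e2 : 2 ^+ l * 2^-1 ^+ l = 1 :> R by rewrite -exprMn divff// expr1n.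
rewrite exprMn.
transitivity (A * (2 ^+ (n - l) * 2^-1 ^+ (n - l)) * (2 ^+ l * 2^-1 ^+ l)
  * (q ^+ l * 2^-1 ^+ l)); first by ring.
by rewrite e1 e2 !mulr1.
Qed.

Lemma dyadic_scale x : 0 < x -> x <= 1 -> exists n, 2^-1 ^+ n.+1 <= x <= 2^-1 ^+ n.
Proof.
move=> x0 x1; have : exists n, 2^-1 ^+ n.+1 <= x.
  have h : 2^-1 ^+ n @[n --> \oo] --> (0 : R).
    by apply: cvg_expr; rewrite ger0_norm; lra.
  have /cvgrPdist_le/(_ _ x0) [N _ /(_ N.+1 (leqnSn _))] := h.
  by rewrite sub0r normrN ger0_norm ?exprn_ge0// => hN; exists N.
move=> ex; case: (ex_minnP ex) => n hn hmin; exists n; rewrite hn /=.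
case: n hn hmin => [|n] hn hmin; first by rewrite expr0.
by rewrite leNgt; apply/negP => /ltW /hmin; rewrite ltnn.
Qed.

End DyadicBounds.

Section RadialLimit.
Variable R : realType.
Local Notation mu := (@lebesgue_measure R).
Implicit Types (r s t : R) (F : R -> R).

Lemma lebesgue_pt_Jball F s : lint F -> lebesgue_pt F s ->
  forall e : R, 0 < e -> exists K, forall k, (K <= k)%N ->
    Jball s (wd R k) (fun t => `|F t - F s|) <= e * 2^-1 ^+ k.
Proof.
move=> lF hs e e0.
have pp : 0 < 2 * pi :> R by rewrite mulr_gt0// pi_gt0.
have w0 k : 0 < wd R k by rewrite mulr_gt0 ?pi_gt0// exprn_gt0.
(* The ball of radius [wd R k] has length 2 pi 2^-k. *)
have e1 : 0 < e / (2 * pi) by rewrite divr_gt0.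
have lh : lint (fun t => `|F t - F s|) := lint_norm (lintB lF (lint_cst (F s))).
have davgE r : 0 < r -> davg F s r = ((2 * r)^-1 * Jball s r (fun t => `|F t - F s|))%:E.
  move=> r0; rewrite /davg /iavg lebesgue_measure_ball ?ltW//.
  rewrite EFinM; congr (_ * _)%E.
    by rewrite inver mulrn_eq0/= gt_eqF// mulr_natl.
  rewrite /Jball JE// ball_itv.
  have [mh _] := lh.
  have mE (A : set (measurableTypeR R)) : measurable_fun A (fun y => (`|F y - F s|)%:E).
    by apply/measurable_EFinP; exact: measurable_funS mh.
  transitivity (\int[mu]_(y in `](s - r)%R, (s + r)%R[) (`|F y - F s|)%:E)%E.
    by apply: eq_integral => y _.
  by rewrite (integral_itv_bndo_bndc (mE _)) (integral_itv_obnd_cbnd (mE _)).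
have /fine_cvgP[_ /cvgrPdist_le /(_ _ e1)] := hs.
move=> [d /= d0 hd].
have hw : wd R k @[k --> \oo] --> (0 : R).
  rewrite /wd -[X in _ --> X](mulr0 pi); apply: cvgM; first exact: cvg_cst.
  by apply: cvg_expr; rewrite ger0_norm; lra.
have /cvgrPdist_lt/(_ _ d0) [K _ hK] := hw.
exists K => k kK; have := hd (wd R k).
have := hK k kK; rewrite sub0r normrN => hk.
rewrite /ball_ /= sub0r normrN => /(_ hk (w0 k)).
rewrite sub0r normrN davgE//= ger0_norm; last first.
  have w20 : 0 <= 2 * wd R k by apply: mulr_ge0 => //; exact: ltW.
  by apply: mulr_ge0; [rewrite invr_ge0|exact: J_ge0].
rewrite mulrC ler_pdivrMr; last by apply: mulr_gt0 => //; exact: w0.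
move/le_trans; apply; rewrite /wd le_eqVlt; apply/orP; left; apply/eqP.
have pn : pi != 0 :> R by rewrite gt_eqF// pi_gt0.
by move: pn; move: (pi : R) (2^-1 ^+ k : R) => p x pn; field.
Qed.

(** Split the kernel at distance pi 2^-K from s: inside, the averages of |F - F s| are small at
    every scale; outside, the kernel is at most 4^K (1 - r), which tends to 0. *)
Lemma poisson_radial_limit (u : R[i] -> R) F s : boundary_of u F -> lebesgue_pt F s ->
  u (r%:C%C * cis s) @[r --> (1 : R)^'-] --> F s.
Proof.
move=> [lF _ pF aF] hs.
have pp : 0 < 2 * pi :> R by rewrite mulr_gt0// pi_gt0.
have pi0 : 0 <= pi :> R := pi_ge0 R.
pose h t := `|F t - F s|.
have lh : lint h := lint_norm (lintB lF (lint_cst (F s))).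
have h0 t : 0 <= h t by exact: normr_ge0.
have bound r : 0 <= r < 1 ->
    2 * pi * `|F s - u (r%:C%C * cis s)| <= Jball s pi (fun t => h t * pker r (t - s)).
  move=> rI; have [r0 r1] := andP rI.
  have ua : 2 * pi * u (r%:C%C * cis s) = J 0 (2 * pi) (fun t => F t * pker r (t - s)).
    rewrite aF ?normc_rM ?normc_cis ?mulr1//.
    by apply: J_eq => t _; rewrite dphi_pker.
  have n1 : normc (r%:C%C * cis s) < 1 by rewrite normc_rM// normc_cis mulr1.
  have ck : 2 * pi * F s = J 0 (2 * pi) (fun t => F s * pker r (t - s)).
    have lk := lint_pker s rI (lint_cst 1).
    rewrite JZ; last by move: lk; under eq_fun do rewrite mul1r.
    have na1 : normc (- (r%:C%C * cis s)) < 1 by rewrite normcN.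
    rewrite mulrC; congr (_ * _); rewrite -[LHS](J_dphi na1); apply: J_eq => t _.
    by rewrite dphi_pker.
  have lk1 := lint_pker s rI lF; have lk2 := lint_pker s rI (lint_cst (F s)).
  have lkB := lintB lk2 lk1.
  rewrite -[X in X * _](ger0_norm (ltW pp)) -normrM mulrBr ua ck -JB//.
  apply: le_trans (J_norm _ _ lkB) _.
  rewrite le_eqVlt; apply/orP; left; apply/eqP.
  have pN : periodic (fun t : R => `|F s * pker r (t - s) - F t * pker r (t - s)|) (2 * pi).
    by move=> t; rewrite pF addrAC pker_2pi.
  rewrite /Jball -(J_period (s - pi) (lint_norm lkB) pN).
  have -> : s - pi + 2 * pi = s + pi :> R by lra.
  apply: J_eq => t _; rewrite -mulrBl normrM distrC; congr (_ * _).
  by rewrite ger0_norm// ltW// pker_gt0.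
apply/cvgrPdist_le => /= e e0.
(* The inner part is then at most 4 (e/8) 2 = e and the outer at most e, together below 2 pi e. *)
have e1 : 0 < e / 8 by rewrite divr_gt0.
have [K hK] := lebesgue_pt_Jball lF hs e1.
pose D := Jball s pi h; have D0 : 0 <= D by apply: J_ge0.
have c0 : 0 < 4 ^+ K * D + 1 by rewrite ltr_wpDl// mulr_ge0// exprn_ge0.
near=> r.
have r2 : 2^-1 <= r by near: r; apply: nbhs_left_ge; lra.
have r1 : r < 1 by near: r; exact: nbhs_left_lt.
have rI : 0 <= r < 1 by rewrite r1 andbT; lra.
have rD : 1 - r <= e / (4 ^+ K * D + 1).
  by apply: ltW; near: r; exact: nbhs_left_ltBl (divr_gt0 e0 c0).
have rK : 1 - r < 2^-1 ^+ K.+1 by near: r; apply: nbhs_left_ltBl; rewrite exprn_gt0.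
have r10 : 0 < 1 - r by rewrite subr_gt0.
have [|n rn] := @dyadic_scale _ (1 - r) r10; first by lra.
have Kn : (K <= n)%N.
  rewrite leqNgt; apply/negP => nK; have /andP[h1 _] := rn.
  have := le_lt_trans h1 rK; rewrite ltNge => /negP; apply.
  have x0 : 0 <= (2^-1 : R) by lra.
  have x1 : (2^-1 : R) <= 1 by lra.
  exact: (ler_wiXn2l x0 x1 (leqW nK)).
rewrite -(ler_pM2l pp); apply: le_trans (bound r rI) _.
have lk := lint_pker s rI lh.
have w0 : 0 <= wd R K by rewrite mulr_ge0// exprn_ge0.
have w1 : wd R K <= pi by rewrite ler_piMr// exprn_ile1//; lra.
have kb x : wd R K <= `|x| -> `|x| <= pi -> pker r x <= 4 ^+ K * (1 - r).
  by move=> x1 x2; exact: pker_le_dyadic.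
have kb0 : 0 <= 4 ^+ K * (1 - r) by rewrite mulr_ge0 ?exprn_ge0 ?ltW.
apply: le_trans (Jball_annulus w0 w1 lh h0 lk kb kb0) _.
have inner : Jball s (wd R K) (fun t => h t * pker r (t - s)) <= 4 * (e / 8) * (1 - 1 / 2)^-1.
  rewrite -(subKn Kn); apply: Jball_pker_geometric => //; [exact: leq_subr|exact: ltW|lra|].
  move=> l ln; rewrite expr1n mulr1; apply: hK.
  by rewrite leq_subRL ?(leq_trans ln (leq_subr _ _))// addnC -leq_subRL.
have outer : 4 ^+ K * (1 - r) * D <= e.
  rewrite mulrAC; apply: (@le_trans _ _ ((4 ^+ K * D + 1) * (1 - r))).
    by apply: ler_wpM2r; [exact: ltW|rewrite lerDl].
  by rewrite mulrC -ler_pdivlMr.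
have p2 : 2 <= 2 * pi :> R by have := @pi_ge2 R; lra.
have : 2 * e <= 2 * pi * e by rewrite ler_wpM2r// ltW.
move: inner outer; rewrite -/D; have -> : (1 - 1 / 2)^-1 = 2 :> R by field.
move: (Jball _ _ _) (4 ^+ K * (1 - r) * D) (2 * pi * e) => x y z; lra.
Unshelve. all: by end_near. Qed.

End RadialLimit.

(** * Mean oscillation and Garsia's integral *)

Section GarsiaNorm.
Variable R : realType.
Implicit Types (r s t x : R) (F w : R -> R) (n k l : nat).

(** The second moment about c is the variance plus the squared shift of the centre: the cross term
    vanishes because m is the mean for the weight w. *)
Lemma variance_le F w a b (m c : R) : lint (fun t => F t * w t) ->
  lint (fun t => F t ^+ 2 * w t) -> lint w ->
  J a b (fun t => F t * w t) = m * J a b w ->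
  J a b (fun t => (F t - c) ^+ 2 * w t) =
  J a b (fun t => (F t - m) ^+ 2 * w t) + (m - c) ^+ 2 * J a b w.
Proof.
move=> l1 l2 l0 mE.
have E d : J a b (fun t => (F t - d) ^+ 2 * w t) =
    J a b (fun t => F t ^+ 2 * w t) - 2 * d * (m * J a b w) + d ^+ 2 * J a b w.
  have -> : (fun t => (F t - d) ^+ 2 * w t) =
     (fun t => (F t ^+ 2 * w t - (2 * d) * (F t * w t)) + d ^+ 2 * w t).
    by apply/funext => t; ring.
  have -> := JD a b (lintB l2 (lintZ (2 * d) l1)) (lintZ (d ^+ 2) l0).
  have -> := JB a b l2 (lintZ (2 * d) l1).
  have -> := JZ a b (2 * d) l1.
  by have -> := JZ a b (d ^+ 2) l0; rewrite mE.
by rewrite !E; ring.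
Qed.

Definition mean F s t := (t - s)^-1 * J s t F.

Definition bmo_le F (B : R) := forall s t, s < t -> t - s <= 2 * pi ->
  J s t (fun x => (F x - mean F s t) ^+ 2) <= B * (t - s).

Lemma mean_variance F s t (c : R) : s < t -> lint F -> lint (fun t => F t ^+ 2) ->
  J s t (fun x => (F x - c) ^+ 2) =
  J s t (fun x => (F x - mean F s t) ^+ 2) + (mean F s t - c) ^+ 2 * (t - s).
Proof.
move=> st lF lF2; have st0 : t - s != 0 by rewrite subr_eq0 gt_eqF.
have J1 : J s t (fun=> 1) = t - s by rewrite J_cst ?mul1r// ltW.
have e1 (G : R -> R) : (fun t => G t * 1) = G by apply/funext => x; rewrite mulr1.
have := @variance_le F (fun=> 1) s t (mean F s t) c.
rewrite !e1 J1 => /(_ lF lF2 (lint_cst 1)); apply.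
by rewrite /mean mulrAC mulVf// mul1r.
Qed.

Lemma lint_sub_sq F (c : R) : lint F -> lint (fun t => F t ^+ 2) -> lint (fun t => (F t - c) ^+ 2).
Proof.
move=> lF lF2; have -> : (fun t => (F t - c) ^+ 2) = (fun t => (F t ^+ 2 - (2 * c) * F t) + c ^+ 2).
  by apply/funext => t; ring.
exact: lintD (lintB lF2 (lintZ _ lF)) (lint_cst _).
Qed.

Section BmoToGarsia.
Variables (F : R -> R) (B s : R).
Hypothesis lF : lint F.
Hypothesis lF2 : lint (fun t => F t ^+ 2).
Hypothesis FB : bmo_le F B.

Let m k := mean F (s - wd R k) (s + wd R k).

Let wd_gt0 k : 0 < wd R k.
Proof. by rewrite mulr_gt0 ?pi_gt0// exprn_gt0. Qed.

Let wd_le k : wd R k <= pi.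
Proof. by rewrite ler_piMr ?pi_ge0// exprn_ile1//; lra. Qed.

Let wdS k : wd R k.+1 = wd R k / 2.
Proof. by rewrite /wd exprS; lra. Qed.

Let Jk k : Jball s (wd R k) (fun x => (F x - m k) ^+ 2) <= B * (2 * wd R k).
Proof.
have w0 := wd_gt0 k; have w1 := wd_le k.
have -> : 2 * wd R k = (s + wd R k) - (s - wd R k) by ring.
apply: FB; lra.
Qed.

Let B0 : 0 <= B.
Proof.
have := Jk 0; have := wd_gt0 0 => w0 h.
have : 0 <= B * (2 * wd R 0) by apply: le_trans h; apply: J_ge0 => t; exact: sqr_ge0.
by rewrite pmulr_lge0// mulr_gt0.
Qed.

Let var k c : Jball s (wd R k) (fun x => (F x - c) ^+ 2) =
  Jball s (wd R k) (fun x => (F x - m k) ^+ 2) + (m k - c) ^+ 2 * (2 * wd R k).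
Proof.
have w0 := wd_gt0 k.
have -> : 2 * wd R k = (s + wd R k) - (s - wd R k) by ring.
by apply: mean_variance => //; lra.
Qed.

(** Over the half ball, (F - m k)^2 integrates to at least (m k.+1 - m k)^2 times its length, and to
    at most B times the double length. *)
Let m_step k : (m k.+1 - m k) ^+ 2 <= 2 * B.
Proof.
have w0 := wd_gt0 k; have w1 := wd_gt0 k.+1; have wS := wdS k.
have lk := lint_sub_sq (m k) lF lF2.
have h1 : Jball s (wd R k.+1) (fun x => (F x - m k) ^+ 2) <=
    Jball s (wd R k) (fun x => (F x - m k) ^+ 2).
  by apply: J_le_set => //; [move=> t; exact: sqr_ge0|lra|lra|lra].
have h2 := Jk k.
have h3 : 0 <= Jball s (wd R k.+1) (fun x => (F x - m k.+1) ^+ 2).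
  by apply: J_ge0 => t; exact: sqr_ge0.
rewrite var in h1.
rewrite -(ler_pM2r (_ : 0 < 2 * wd R k.+1)); last by apply: mulr_gt0.
rewrite wS in h1 h3 *.
move: h1 h2 h3; move: (Jball _ _ _) (Jball _ _ _)
  ((m k.+1 - m k) ^+ 2 * (2 * (wd R k / 2))) => x y z.
lra.
Qed.

(** The squared drift d obeys d(l+1) <= (3/2) d(l) + 6 B, from (a - b)^2 <= (3/2) a^2 + 3 b^2, and
    the stated bound solves this recursion. A ratio below 2 is all that [Jball_pker_geometric] can
    sum. *)
Let m_diff n l : (l <= n)%N -> (m (n - l) - m n) ^+ 2 <= 12 * B * ((3 / 2) ^+ l - 1).
Proof.
elim: l => [|l IH] ln; first by rewrite subn0 subrr expr0n expr0 subrr mulr0.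
have h := IH (ltnW ln).
have nl : (n - l = (n - l.+1).+1)%N by rewrite subnS prednK// subn_gt0.
have := m_step (n - l.+1); rewrite -nl => h2.
set x := m (n - l.+1) in h2 *; set y := m (n - l) in h h2; set z := m n in h *.
have : (x - z) ^+ 2 <= 3 / 2 * (y - z) ^+ 2 + 3 * (y - x) ^+ 2.
  have : 0 <= (y - z + 2 * (y - x)) ^+ 2 by exact: sqr_ge0.
  nra.
rewrite [(3 / 2) ^+ l.+1]exprS -/x; move: h h2; move: ((3 / 2) ^+ l) => e; lra.
Qed.

(** The scale n is that of 1 - r, so F is centred at its mean over the arc where the kernel
    concentrates. The constant is 4 * 48 * 4, the last factor being the sum of the series of ratio
    3/4. *)
Lemma bmo_Jball r n : 0 <= r < 1 -> 2^-1 ^+ n.+1 <= 1 - r <= 2^-1 ^+ n ->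
  Jball s pi (fun t => (F t - m n) ^+ 2 * pker r (t - s)) <= 768 * pi * B.
Proof.
move=> rI rn; have lh := lint_sub_sq (m n) lF lF2.
have w0 : wd R 0 = pi by rewrite /wd expr0 mulr1.
have p0 : 0 <= pi :> R := pi_ge0 R.
have h0 t : 0 <= (F t - m n) ^+ 2 by exact: sqr_ge0.
have A0 : 0 <= 48 * pi * B by rewrite !mulr_ge0.
have q2 : 0 <= (3 / 2 : R) < 2 by apply/andP; split; lra.
have hD l : (l <= n)%N -> Jball s (wd R (n - l)) (fun t => (F t - m n) ^+ 2) <=
    48 * pi * B * 2^-1 ^+ (n - l) * (3 / 2) ^+ l.
  move=> ln; rewrite var; have h1 := Jk (n - l); have h2 := m_diff ln.
  have w := wd_gt0 (n - l).
  have h3 : (m (n - l) - m n) ^+ 2 * (2 * wd R (n - l))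
    <= 12 * B * ((3 / 2) ^+ l - 1) * (2 * wd R (n - l)).
    by apply: ler_wpM2r => //; apply: mulr_ge0 => //; exact: ltW.
  have -> : 48 * pi * B * 2^-1 ^+ (n - l) * (3 / 2) ^+ l = 48 * B * (3 / 2) ^+ l * wd R (n - l).
    by rewrite /wd; ring.
  have e1 : 1 <= (3 / 2 : R) ^+ l by apply: exprn_ege1; lra.
  have e2 := mulr_ge0 B0 (ltW w).
  have : 0 <= B * wd R (n - l) * ((3 / 2) ^+ l - 1) by apply: mulr_ge0 => //; lra.
  lra.
have := Jball_pker_geometric (s := s) rI rn (leqnn n) lh h0 A0 q2 hD.
rewrite subnn w0; have -> : (1 - 3 / 2 / 2)^-1 = 4 :> R by field.
by move/le_trans; apply; rewrite le_eqVlt; apply/orP; left; apply/eqP; ring.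
Qed.

End BmoToGarsia.

Lemma J_period_ball s F : lint F -> periodic (F : R -> R) (2 * pi) -> Jball s pi F = J 0 (2 * pi) F.
Proof.
move=> lF pF; rewrite /Jball -(J_period (s - pi) lF pF).
by congr J; lra.
Qed.

Definition garsia_le (u : R[i] -> R) F (S : R) := forall a, normc a < 1 ->
  J 0 (2 * pi) (fun t => (F t - u a) ^+ 2 * dphi (- a) t) <= 2 * pi * S.

Lemma boundary_variance u F a (c : R) : boundary_of u F -> normc a < 1 ->
  J 0 (2 * pi) (fun t => (F t - c) ^+ 2 * dphi (- a) t) =
  J 0 (2 * pi) (fun t => (F t - u a) ^+ 2 * dphi (- a) t) + (u a - c) ^+ 2 * (2 * pi).
Proof.
move=> [lF lF2 pF aF] a1; have na1 : normc (- a) < 1 by rewrite normcN.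
have Jw := J_dphi na1.
rewrite (@variance_le F (dphi (- a)) 0 (2 * pi) (u a) c); first by rewrite Jw.
- exact: lint_dphi.
- exact: lint_dphi.
- exact: lint_cont (dphi_continuous na1).
- by rewrite -aF// Jw mulrC.
Qed.

(** As u a is the mean of F for the kernel at a, replacing it by the mean c over an arc only
    enlarges the integral; then 768 pi B = 2 pi (384 B). *)
Lemma garsia_of_bmo u F B : boundary_of u F -> bmo_le F B -> garsia_le u F (384 * B).
Proof.
move=> hF FB a a1; have [lF lF2 pF aF] := hF.
have [s sE] := polar a; set r := normc a in sE a1 *.
have r0 : 0 <= r := normc_ge0 a.
have rI : 0 <= r < 1 by rewrite r0.
have [||n rn] := @dyadic_scale _ (1 - r); [lra|lra|].
have := bmo_Jball s lF lF2 FB rI rn; set c := mean _ _ _ => h.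
apply: (@le_trans _ _ (J 0 (2 * pi) (fun t => (F t - c) ^+ 2 * dphi (- a) t))).
  rewrite (boundary_variance c hF a1) lerDl mulr_ge0 ?sqr_ge0//.
  by rewrite mulr_ge0// pi_ge0.
apply: (@le_trans _ _ (768 * pi * B)); last by rewrite le_eqVlt; apply/orP; left; apply/eqP; ring.
apply: le_trans h.
have lk := lint_pker s rI (lint_sub_sq c lF lF2).
have pk : periodic (fun t : R => (F t - c) ^+ 2 * pker r (t - s) : R) (2 * pi).
  by move=> t; rewrite pF addrAC pker_2pi.
rewrite (J_period_ball s lk pk) le_eqVlt; apply/orP; left; apply/eqP; apply: J_eq => t _.
by rewrite sE dphi_pker.
Qed.

Lemma sin_abs_le x : `|sin x| <= `|x|.
Proof.
have pos (y : R) : 0 <= y -> `|sin y| <= y.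
  rewrite le_eqVlt => /predU1P[<-|y0]; first by rewrite sin0 normr0.
  have dsin (z : R) : z \in `]0, y[%R -> is_derive z (1 : R) (@sin R) (cos z)
    by move=> _; exact: is_derive_sin.
  have [|c _] := MVT y0 dsin; first exact/continuous_subspaceT/continuous_sin.
  rewrite sin0 !subr0 => ->; rewrite normrM (ger0_norm (ltW y0)).
  by apply: ler_piMl; [exact: ltW|rewrite ler_norml cos_geN1 cos_le1].
by case: (leP 0 x) => x0; [rewrite (ger0_norm x0) pos|
  rewrite -normrN -sinN (ltr0_norm x0) pos// oppr_ge0 ltW].
Qed.

Lemma one_sub_cos_le x : 2 * (1 - cos x) <= x ^+ 2.
Proof.
pose y := x / 2.
have xE : x = y *+ 2 by rewrite -mulr_natl /y; lra.
have h : sin y ^+ 2 <= y ^+ 2.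
  rewrite -(real_normK (num_real (sin y))) -(real_normK (num_real y)).
  by rewrite ler_pXn2r ?nnegrE// sin_abs_le.
have cE : cos x = 2 * cos y ^+ 2 - 1 by rewrite xE cos_mulr2n -[RHS]/(2 * cos y ^+ 2 - 1) mulr_natl.
have x2 : x ^+ 2 = 4 * y ^+ 2 by rewrite /y; field.
rewrite cE x2; have := cos2Dsin2 y; clearbody y; lra.
Qed.

(** With d = h/4 the numerator is at least d and the denominator at most d^2 + 16 d^2, since 2 (1 -
    cos x) <= x^2 <= 16 d^2. Dividing h by 4 keeps the radius 1 - d nonnegative, as pi <= 4. *)
Lemma pker_ge (h x : R) : 0 < h -> h <= pi -> `|x| <= h -> 1 <= 17 * h / 4 * pker (1 - h / 4) x.
Proof.
move=> h0 hp xh; have p4 : pi <= 4 :> R by have := @pihalf_lt2 R; lra.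
have x2 : x ^+ 2 <= h ^+ 2.
  by rewrite -(real_normK (num_real x)) ler_pXn2r ?nnegrE// ltW.
have := one_sub_cos_le x; have := cos_le1 x.
rewrite /pker; set d := h / 4; have hd : h = 4 * d by rewrite /d; lra.
have d0 : 0 < d by rewrite /d; lra.
have d1 : d <= 1 by rewrite /d; lra.
rewrite hd in x2 *; move=> c1 c2; rewrite [leRHS]mulrA.
have den : 0 < (1 - (1 - d)) ^+ 2 + 2 * (1 - d) * (1 - cos x).
  have : 0 < d ^+ 2 by rewrite exprn_gt0.
  have : 0 <= 2 * (1 - d) * (1 - cos x) by rewrite !mulr_ge0 ?subr_ge0.
  have -> : 1 - (1 - d) = d by ring.
  lra.
rewrite ler_pdivlMr// mul1r.
have : (1 - d) * (2 * (1 - cos x)) <= 1 * (16 * d ^+ 2).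
  apply: ler_pM; [lra|lra|lra|nra].
nra.
Qed.

(** The point a lies over the midpoint of the arc with 1 - |a| = h/4, h the half-length, so
    [pker_ge] bounds the arc integral by 17 h/4 times Garsia's. As 2 pi <= 8, this is at most 34 h S
    = 17 S (t - s). *)
Lemma bmo_of_garsia u F S : boundary_of u F -> garsia_le u F S -> bmo_le F (17 * S).
Proof.
move=> hF FS s t st t2; have [lF lF2 pF aF] := hF.
have p4 : pi <= 4 :> R by have := @pihalf_lt2 R; lra.
pose h := (t - s) / 2; pose m := (s + t) / 2.
have h0 : 0 < h by rewrite /h; lra.
have hp : h <= pi by rewrite /h; lra.
have [es et] : s = m - h /\ t = m + h by rewrite /m /h; split; lra.
pose r := 1 - h / 4.
have rI : 0 <= r < 1 by rewrite /r; apply/andP; split; lra.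
have [r0 r1] := andP rI.
pose a := r%:C%C * cis m; have a1 : normc a < 1 by rewrite normc_rM// normc_cis mulr1.
have lk := lint_sub_sq (u a) lF lF2; have lkk := lint_pker m rI lk.
have st0 : 0 <= (mean F s t - u a) ^+ 2 * (t - s) by rewrite mulr_ge0 ?sqr_ge0// subr_ge0 ltW.
have := mean_variance (u a) st lF lF2 => hv.
apply: (@le_trans _ _ (J s t (fun x => (F x - u a) ^+ 2))); first by rewrite hv lerDl.
apply: (@le_trans _ _ (17 * h / 4 * Jball m pi (fun x => (F x - u a) ^+ 2 * pker r (x - m)))).
  apply: (@le_trans _ _ (17 * h / 4 * Jball m h (fun x => (F x - u a) ^+ 2 * pker r (x - m)))).
    rewrite -(JZ _ _ _ lkk) es et /m; apply: (J_le lk (lintZ _ lkk)) => x /andP[x1 x2].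
    rewrite mulrCA -[leLHS]mulr1 ler_wpM2l ?sqr_ge0//; apply: pker_ge => //.
    by rewrite ler_norml; apply/andP; split; rewrite -/m; lra.
  apply: ler_wpM2l; first by rewrite divr_ge0// mulr_ge0// ltW.
  apply: J_le_set => //; [|lra|lra|lra].
  by move=> x; apply: mulr_ge0; [exact: sqr_ge0|exact: ltW (pker_gt0 _ rI)].
have pk : periodic (fun x : R => (F x - u a) ^+ 2 * pker r (x - m) : R) (2 * pi).
  by move=> x; rewrite pF addrAC pker_2pi.
rewrite (J_period_ball m lkk pk).
have := FS a a1; rewrite (_ : J _ _ _ =
  J 0 (2 * pi) (fun x => (F x - u a) ^+ 2 * pker r (x - m))); last first.
  by apply: J_eq => x _; rewrite dphi_pker.
set X := J _ _ _ => hX.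
have X0 : 0 <= X.
  by apply: J_ge0 => x; apply: mulr_ge0; [exact: sqr_ge0|exact: ltW (pker_gt0 _ rI)].
have S0 : 0 <= S.
  have : 0 <= 2 * pi * S by apply: le_trans hX.
  by rewrite pmulr_rge0// mulr_gt0// pi_gt0.
apply: (@le_trans _ _ (17 * h / 4 * (8 * S))).
  apply: ler_wpM2l; first by rewrite divr_ge0// mulr_ge0// ltW.
  by apply: (le_trans hX); rewrite ler_wpM2r//; lra.
have -> : t - s = 2 * h by rewrite /h; lra.
by have := mulr_ge0 (ltW h0) S0; lra.
Qed.

End GarsiaNorm.

(** * Quaternionic boundary functions *)

Section VectorBoundary.
Variable R : realType.
Local Notation H := (quat R).
Local Notation C := (R[i]).
Local Notation mu := (@lebesgue_measure R).
Implicit Types (i j c x : H) (f : H -> H) (F G : R -> H) (a z : C) (r s t : R).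

(** The conjugates of the basis, so that each coordinate is Re (c x) for a constant c, the form in
    which the Poisson formula is available. *)
Definition qunit (k : 'I_4) : H :=
  tnth [tuple 1; Quat 0 (-1) 0 0; Quat 0 0 (-1) 0; Quat 0 0 0 (-1)] k.

Definition coord (k : 'I_4) x : R := qRe (qunit k * x).

Lemma ord4 (k : 'I_4) : k = 0 \/ k = 1 \/ k = 2 \/ k = 3.
Proof.
case: k => -[|[|[|[|//]]]] k4; [left|right; left|right; right; left|right; right; right];
  exact: val_inj.
Qed.

Lemma big_ord4 (V : nmodType) (h : 'I_4 -> V) : \sum_k h k = h 0 + h 1 + h 2 + h 3.
Proof.
rewrite !big_ord_recl big_ord0 addr0 !addrA.
have -> : lift ord0 (ord0 : 'I_3) = 1 by exact: val_inj.
have -> : lift ord0 (lift ord0 (ord0 : 'I_2)) = 2 :> 'I_4 by exact: val_inj.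
by have -> : lift ord0 (lift ord0 (lift ord0 (ord0 : 'I_1))) = 3 :> 'I_4 by exact: val_inj.
Qed.

Lemma coord0 x : coord 0 x = qRe x.
Proof. by rewrite /coord /qunit (tnth_nth 0) /=; ring. Qed.
Lemma coord1 x : coord 1 x = qi x.
Proof. by rewrite /coord /qunit (tnth_nth 0) /=; ring. Qed.
Lemma coord2 x : coord 2 x = qj x.
Proof. by rewrite /coord /qunit (tnth_nth 0) /=; ring. Qed.
Lemma coord3 x : coord 3 x = qk x.
Proof. by rewrite /coord /qunit (tnth_nth 0) /=; ring. Qed.

Lemma coord_sum x : `|x| ^+ 2 = \sum_k coord k x ^+ 2.
Proof.
by rewrite qnorm_sqE big_ord4 coord0 coord1 coord2 coord3.
Qed.

Lemma coordB k x y : coord k (x - y) = coord k x - coord k y.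
Proof. by rewrite /coord mulrBr. Qed.

Lemma J_sum n (a b : R) (h : 'I_n -> R -> R) : (forall k, lint (h k)) ->
  lint (fun t => \sum_k h k t) /\ J a b (fun t => \sum_k h k t) = \sum_k J a b (h k).
Proof.
elim: n h => [|n IH] h lh.
  have e : (fun t : R => \sum_k h k t) = (fun=> 0) by apply/funext => t; rewrite big_ord0.
  rewrite e big_ord0; split; first exact: lint_cst.
  by rewrite /J /Rintegral integral0.
have [l E] := IH (fun k => h (lift ord0 k)) (fun k => lh _).
have e : (fun t : R => \sum_k h k t) = (fun t => h ord0 t + \sum_k h (lift ord0 k) t).
  by apply/funext => t; rewrite big_ord_recl.
rewrite e big_ord_recl; split; first exact: lintD (lh _) l.
by rewrite (JD _ _ (lh _) l) E.
Qed.

Lemma qReM_coord c x : qRe (c * x) =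
  qRe c * coord 0 x - qi c * coord 1 x - qj c * coord 2 x - qk c * coord 3 x.
Proof. by rewrite coord0 coord1 coord2 coord3. Qed.

Lemma boundary_of_lin (u v : C -> R) (A B : R -> R) (k l : R) :
  boundary_of u A -> boundary_of v B ->
  boundary_of (fun z => k * u z + l * v z) (fun t => k * A t + l * B t).
Proof.
move=> [lA lA2 pA aA] [lB lB2 pB aB].
have lAB : lint (fun t => k * A t + l * B t) := lintD (lintZ k lA) (lintZ l lB).
split => //.
- apply: (@lint_le _ _ (fun t => (2 * k ^+ 2) * A t ^+ 2 + (2 * l ^+ 2) * B t ^+ 2)).
  + by apply: measurable_funX; case: lAB.
  + move=> t; rewrite ger0_norm ?sqr_ge0//; have := sqr_ge0 (k * A t - l * B t); lra.
  + exact: lintD (lintZ _ lA2) (lintZ _ lB2).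
- by move=> t; rewrite pA pB.
- move=> a a1; transitivity (k * (2 * pi * u a) + l * (2 * pi * v a)); first by ring.
  have na : normc (- a) < 1 by rewrite normcN.
  have l1 := lint_dphi na lA; have l2 := lint_dphi na lB.
  rewrite aA// aB// -(JZ _ _ _ l1) -(JZ _ _ _ l2) -(JD _ _ (lintZ _ l1) (lintZ _ l2)).
  by apply: J_eq => t _; ring.
Qed.

(** Quantifying over all c makes multiplication of f by constants, on either side, a mere change of
    c. *)
Definition bdata i f F := forall c : H,
  boundary_of (fun z => qRe (c * f (emb i z))) (fun t => qRe (c * F t)).

Lemma bdata_coord i f F : (forall k : 'I_4,
  boundary_of (fun z => coord k (f (emb i z))) (fun t => coord k (F t))) -> bdata i f F.
Proof.
move=> h c.
have := boundary_of_lin 1 1 (boundary_of_lin (qRe c) (- qi c) (h 0) (h 1))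
  (boundary_of_lin (- qj c) (- qk c) (h 2) (h 3)).
set u1 := (fun z => _); set F1 := (fun t => _).
have -> : u1 = (fun z => qRe (c * f (emb i z))).
  by apply/funext => z; rewrite /u1 qReM_coord; ring.
have -> // : F1 = (fun t => qRe (c * F t)).
by apply/funext => t; rewrite /F1 qReM_coord; ring.
Qed.

Lemma bdata_lint_coord i f F k : bdata i f F -> lint (fun t => coord k (F t)).
Proof. by move=> /(_ (qunit k))[]. Qed.

Lemma bdata_periodic i f F t : bdata i f F -> F (t + 2 * pi) = F t.
Proof.
move=> h; have p k : coord k (F (t + 2 * pi)) = coord k (F t).
  by have [_ _ p _] := h (qunit k); exact: p t.
apply: quat_eq; [have := p 0|have := p 1|have := p 2|have := p 3];
  by rewrite ?coord0 ?coord1 ?coord2 ?coord3.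
Qed.

Lemma bdata_lint_sq i f F c : bdata i f F -> lint (fun t => `|F t - c| ^+ 2).
Proof.
move=> h; have lk k : lint (fun t => coord k (F t - c) ^+ 2).
  have [l1 l2 _ _] := h (qunit k); have := lint_sub_sq (coord k c) l1 l2.
  by under eq_fun do rewrite -coordB.
by under eq_fun do rewrite coord_sum; exact: (J_sum 0 0 lk).1.
Qed.

Lemma cvg_coord (T : Type) (Fl : set_system T) (FF : Filter Fl) (g : T -> H) x :
  (forall k, coord k (g t) @[t --> Fl] --> coord k x) -> g t @[t --> Fl] --> x.
Proof.
move=> h; apply/cvgrPdist_le => e e0.
have e2 : 0 < e / 2 by rewrite divr_gt0.
have hk k : \forall t \near Fl, `|coord k x - coord k (g t)| <= e / 2.
  by have /cvgrPdist_le/(_ _ e2) := h k.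
apply: filterS2 (filterI (hk 0) (hk 1)) (filterI (hk 2) (hk 3)) => t [h0 h1] [h2 h3].
rewrite -(@ler_pXn2r _ 2)// ?nnegrE ?(ltW e0)// coord_sum big_ord4.
have sq (y : R) : `|y| <= e / 2 -> y ^+ 2 <= (e / 2) ^+ 2.
  by move=> hy; rewrite -(real_normK (num_real y)) ler_pXn2r ?nnegrE// ltW.
rewrite -!coordB in h0 h1 h2 h3.
have := sq _ h0; have := sq _ h1; have := sq _ h2; have := sq _ h3.
have -> : (e / 2) ^+ 2 = e ^+ 2 / 4 by field.
lra.
Qed.

(** Almost every t is a Lebesgue point of all four coordinates at once. *)
Lemma bdata_radial i f F : bdata i f F ->
  {ae mu, forall t : measurableTypeR R, f (r *: qexp i t) @[r --> (1 : R)^'-] --> F t}.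
Proof.
move=> h.
have leb k : {ae mu, forall t : measurableTypeR R, lebesgue_pt (fun t => coord k (F t)) t}.
  apply: lebesgue_differentiation; have [mF iF] := bdata_lint_coord k h.
  split => //; first exact: openT.
  move=> K _ cK; have [B [_ hB]] := compact_bounded cK.
  have hK : K `<=` `[- (B + 1), B + 1].
    move=> x Kx; have := hB (B + 1); rewrite ltrDl => /(_ ltr01 x Kx) /=.
    by rewrite in_itv /= ler_norml.
  have /integrableP[mI] := iF (- (B + 1)) (B + 1); apply: le_lt_trans.
  apply: ge0_subset_integral => //; first exact: compact_measurable.
  by apply/measurable_EFinP; apply: measurableT_comp => //; exact/measurable_EFinP.
have FF := ae_filter_ringOfSetsType mu.
have L01 := @filterI _ _ FF _ _ (leb 0) (leb 1).
have L23 := @filterI _ _ FF _ _ (leb 2) (leb 3).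
apply: (@filterS2 _ _ FF _ _ _ _ L01 L23) => t [h0 h1] [h2 h3].
apply: cvg_coord => k.
have hk : lebesgue_pt (fun t => coord k (F t)) t.
  by have [->|[->|[->|->]]] := ord4 k.
have := poisson_radial_limit (h (qunit k)) hk; apply: cvg_trans.
apply: near_eq_cvg; apply: nearW => r.
by rewrite /coord qexpE embZ.
Qed.

Lemma bdata_bval i f F : bdata i f F -> {ae mu, forall t : measurableTypeR R, bval f i t = F t}.
Proof. by move=> h; apply: filterS (bdata_radial h) => t ht; exact: cvg_lim. Qed.

Section HardySpace.
Variables (i : H) (f : H -> H).
Hypothesis hi : qsphere R i.
Hypothesis hf : slice_hyperholomorphic f.

Let u k z := coord k (f (emb i z)).

Let hu k : poisson_disc (u k).
Proof. exact: slice_hyperholomorphic_poisson. Qed.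

Definition qcircle_sq r := J 0 (2 * pi) (fun t => `|f (r *: qexp i t)| ^+ 2).

Let lu k r : 0 <= r < 1 -> lint (fun t => u k (r%:C%C * cis t) ^+ 2).
Proof. by move=> rI; case: (hu k) => c _ _; exact: lintMc (c r rI) (lint_cont (c r rI)). Qed.

Let sumE r : (fun t => `|f (r *: qexp i t)| ^+ 2) =
  (fun t => \sum_k u k (r%:C%C * cis t) ^+ 2).
Proof. by apply/funext => t; rewrite coord_sum qexpE -embZ. Qed.

Lemma lint_qcircle r : 0 <= r < 1 -> lint (fun t => `|f (r *: qexp i t)| ^+ 2).
Proof.
by move=> rI; rewrite sumE; exact: (J_sum 0 0 (fun k => lu k rI)).1.
Qed.

Lemma qcircle_sqE r : 0 <= r < 1 -> qcircle_sq r = \sum_k circle_sq (u k) r.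
Proof.
move=> rI; rewrite /qcircle_sq sumE.
exact: (J_sum 0 (2 * pi) (fun k => lu k rI)).2.
Qed.

Lemma qcircle_sq_le r' r : 0 <= r' -> r' <= r -> r < 1 -> qcircle_sq r' <= qcircle_sq r.
Proof.
move=> r0 rr r1; rewrite !qcircle_sqE ?r0 ?r1 ?(le_trans r0 rr) ?(le_lt_trans rr r1)//.
by apply: ler_sum => k _; exact: circle_sq_le.
Qed.

Let m r : \bar R := ((((2 * pi)^-1)%:E *
  \int[mu]_(t in `[0%R, (2 * pi)%R]) (`|f (r *: qexp i t)| ^+ 2)%:E)%E).

Let mE r : 0 <= r < 1 -> m r = ((2 * pi)^-1 * qcircle_sq r)%:E.
Proof. by move=> rI; rewrite /m -(JE _ _ (lint_qcircle rI)) EFinM. Qed.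

Let V0 : 0 < (2 * pi : R)^-1.
Proof. by rewrite invr_gt0 mulr_gt0// pi_gt0. Qed.

Let pos r : 0 <= r -> r < 1 -> 0 <= r < 1. Proof. by move=> -> ->. Qed.

(* If the circle integrals were unbounded, monotonicity would make the limit infinite. *)
Lemma qcircle_sq_bounded : (lim (m r @[r --> (1 : R)^'-]) < +oo)%E ->
  exists B, forall r, 0 <= r < 1 -> qcircle_sq r <= B.
Proof.
move=> hlim; apply: contrapT => hB.
have unb A : exists2 r, 0 <= r < 1 & A < qcircle_sq r.
  apply: contrapT => nA; apply: hB; exists A => r rI; rewrite leNgt; apply/negP => h.
  by apply: nA; exists r.
move: hlim; have -> : lim (m r @[r --> (1 : R)^'-]) = +oo%E; last by [].
apply/cvg_lim => //; apply/cvgeyPge => A.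
have [r0 /andP[r00 r01] hr0] := unb (2 * pi * A).
near=> r.
have r0r : r0 <= r by near: r; exact: nbhs_left_ge.
have r1 : r < 1 by near: r; exact: nbhs_left_lt.
rewrite mE ?pos ?(le_trans r00)// lee_fin -ler_pdivrMl// invrK.
by apply: (le_trans (ltW hr0)); exact: qcircle_sq_le.
Unshelve. all: by end_near. Qed.

(** Monotonicity in r shows that the limit exists; otherwise [lim] would be a default value about
    which the bound says nothing. *)
Lemma lim_qcircle_le B : (forall r, 0 <= r < 1 -> qcircle_sq r <= B) ->
  (lim (m r @[r --> (1 : R)^'-]) <= ((2 * pi)^-1 * B)%:E)%E.
Proof.
move=> hB; have cm : cvg ((2 * pi)^-1 * qcircle_sq r @[r --> (1 : R)^'-]).
  apply: nondecreasing_at_left_is_cvgr.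
    near=> x => r r'; rewrite !in_itv /= => /andP[xr r1] /andP[xr' r'1] rr.
    apply: ler_wpM2l; first exact: ltW.
    apply: qcircle_sq_le => //; apply: le_trans (ltW xr).
    by near: x; apply: nbhs_left_ge.
  near=> x; exists ((2 * pi)^-1 * B) => _ [r /= /itvP rI <-].
  apply: ler_wpM2l; first exact: ltW.
  apply: hB; rewrite rI andbT; apply: (@le_trans _ _ x); last by rewrite rI.
  by near: x; apply: nbhs_left_ge.
have mc : m r @[r --> (1 : R)^'-] --> (lim ((2 * pi)^-1 * qcircle_sq r @[r --> (1 : R)^'-]))%:E.
  move/cvg_ex: cm => [l hl]; rewrite (cvg_lim _ hl)//.
  apply: (@cvg_trans _ (((2 * pi)^-1 * qcircle_sq r)%:E @[r --> (1 : R)^'-])).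
    apply: near_eq_cvg; near=> r; rewrite mE//.
    by apply/andP; split; near: r; [apply: nbhs_left_ge|exact: nbhs_left_lt].
  by apply: cvg_EFin => //; exact: nearW.
rewrite (cvg_lim _ mc)// lee_fin; apply: limr_le => //.
near=> r; apply: ler_wpM2l; first exact: ltW.
apply: hB; by apply/andP; split; near: r; [apply: nbhs_left_ge|exact: nbhs_left_lt].
Unshelve. all: by end_near. Qed.

Lemma bounded_bdata B : (forall r, 0 <= r < 1 -> qcircle_sq r <= B) -> exists F, bdata i f F.
Proof.
move=> hB; have uB k r : 0 <= r < 1 -> circle_sq (u k) r <= B.
  move=> rI; apply: le_trans (hB r rI); rewrite qcircle_sqE// (bigD1 k)//= lerDl.
  by apply: sumr_ge0 => l _; apply: J_ge0 => t; exact: sqr_ge0.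
have [F hF] := choice (fun k => poisson_boundary (hu k) (uB k)).
exists (fun t => Quat (F 0 t) (F 1 t) (F 2 t) (F 3 t)).
apply: bdata_coord => k.
have -> : (fun t => coord k (Quat (F 0 t) (F 1 t) (F 2 t) (F 3 t))) = F k; last exact: hF.
apply/funext => t.
by have [->|[->|[->|->]]] := ord4 k; rewrite ?coord0 ?coord1 ?coord2 ?coord3.
Qed.

Lemma bdata_qcircle_le F : bdata i f F ->
  exists B, forall r, 0 <= r < 1 -> qcircle_sq r <= B.
Proof.
move=> hF; exists (\sum_k J 0 (2 * pi) (fun t => coord k (F t) ^+ 2)) => r rI.
rewrite qcircle_sqE//; apply: ler_sum => k _.
exact: circle_sq_boundary (hu k) (hF (qunit k)) rI.
Qed.

End HardySpace.

Lemma hardy2_bdata i f : qsphere R i -> hardy2 f -> exists F, bdata i f F.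
Proof.
move=> hi [hf hsup]; have [|B hB] := @qcircle_sq_bounded i f hi hf.
  by apply: le_lt_trans hsup; apply: ereal_sup_ubound; exists i.
exact: bounded_bdata hB.
Qed.

(** One slice controls all: by [slice_change], |f| at r e^(jt) is at most the sum of |f| at r e^(it)
    and r e^(-it), and squaring costs 2 + 2. *)
Lemma bdata_hardy2 i f F : qsphere R i -> slice_hyperholomorphic f -> bdata i f F -> hardy2 f.
Proof.
move=> hi hf hF; split => //; have [B hB] := bdata_qcircle_le hi hf hF.
apply: (@le_lt_trans _ _ ((2 * pi)^-1 * (4 * B))%:E); last exact: ltry.
apply: ge_ereal_sup => _ [j hj <-]; apply: lim_qcircle_le => // r rI.
have [r0 r1] := andP rI.
have [a_le b_le] := half_le1 hi hj.
have li := lint_qcircle hi hf rI.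
have lN : lint (fun t => `|f (r *: qexp i (- t))| ^+ 2).
  exact: (lint_opp li).
have pw t : `|f (r *: qexp j t)| ^+ 2 <=
    2 * `|f (r *: qexp i t)| ^+ 2 + 2 * `|f (r *: qexp i (- t))| ^+ 2.
  have z1 : normc (r%:C%C * cis t) < 1 by rewrite normc_rM// normc_cis mulr1.
  rewrite !qexpE -!embZ (slice_change hf hi hj z1).
  have -> : conjc (r%:C%C * cis t) = r%:C%C * cis (- t).
    apply/eqP; rewrite eq_complex /= cosN sinN.
    by apply/andP; split; apply/eqP; ring.
  set X := f _; set Y := f _; rewrite !scalerAl.
  set p := 2^-1 *: _ in a_le *; set q := 2^-1 *: _ in b_le *.
  have h : `|p * X + q * Y| <= `|X| + `|Y|.
    apply: le_trans (ler_normD _ _) _; rewrite !qnormM.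
    by apply: lerD; apply: ler_piMl.
  have : `|p * X + q * Y| ^+ 2 <= (`|X| + `|Y|) ^+ 2.
    by rewrite ler_pXn2r ?nnegrE ?addr_ge0.
  have := sqr_ge0 (`|X| - `|Y|); lra.
have le1 : qcircle_sq j f r <= 2 * qcircle_sq i f r + 2 * qcircle_sq i f r.
  apply: le_trans (J_le _ _ (fun t _ => pw t)) _; first exact: lint_qcircle.
    exact: lintD (lintZ _ li) (lintZ _ lN).
  rewrite (JD _ _ (lintZ _ li) (lintZ _ lN)) (JZ _ _ _ li) (JZ _ _ _ lN).
  have mi := proj1 li.
  have e : J 0 (2 * pi) (fun t => `|f (r *: qexp i (- t))| ^+ 2) = qcircle_sq i f r.
    rewrite -(J_opp _ _ mi) oppr0.
    have per : periodic (fun t : R => `|f (r *: qexp i t)| ^+ 2 : R) (2 * pi).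
      by move=> t; rewrite !qexpE cis_2pi.
    by have := J_period (- (2 * pi)) li per; rewrite addNr.
  by rewrite e.
have := hB r rI; lra.
Qed.

End VectorBoundary.

Arguments qunit {R} k.

(** * Oscillation and Garsia's integral of quaternionic functions *)

Section Oscillation.
Variable R : realType.
Local Notation H := (quat R).
Local Notation C := (R[i]).
Local Notation mu := (@lebesgue_measure R).
Implicit Types (i j c : H) (f : H -> H) (F G : R -> H) (a z w : C) (r s t : R).

Definition vmean F s t : H := (t - s)^-1 *: Quat (J s t (fun x => qRe (F x)))
  (J s t (fun x => qi (F x))) (J s t (fun x => qj (F x))) (J s t (fun x => qk (F x))).

Definition osc F s t : R := (t - s)^-1 * J s t (fun x => `|F x - vmean F s t| ^+ 2).

(** The term of [star_seminorm] at z after the circle change of variables ([star_term]), with a free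
    constant c in place of f(z). *)
Definition gar F z c : R :=
  (2 * pi)^-1 * J 0 (2 * pi) (fun t => `|F t - c| ^+ 2 * dphi (- z) t).

Lemma coord_vmean k F s t : coord k (vmean F s t) = mean (fun x => coord k (F x)) s t.
Proof.
by have [->|[->|[->|->]]] := ord4 k; rewrite ?coord0 ?coord1 ?coord2 ?coord3 /=;
  congr (_ * J _ _ _); apply/funext => x; rewrite ?coord0 ?coord1 ?coord2 ?coord3.
Qed.

Lemma J_normsq i f F c (a b : R) (w : R -> R) : bdata i f F -> continuous w ->
  J a b (fun t => `|F t - c| ^+ 2 * w t) =
  \sum_k J a b (fun t => (coord k (F t) - coord k c) ^+ 2 * w t).
Proof.
move=> hF cw; have lk k : lint (fun t => (coord k (F t) - coord k c) ^+ 2 * w t).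
  have [l1 l2 _ _] := hF (qunit k); under eq_fun do rewrite mulrC.
  by apply: lintMc => //; exact: lint_sub_sq (coord k c) l1 l2.
have [_ <-] := J_sum a b lk; apply: J_eq => t _.
by rewrite coord_sum mulr_suml; apply: eq_bigr => k _; rewrite coordB.
Qed.

Lemma J_normsq1 i f F c (a b : R) : bdata i f F ->
  J a b (fun t => `|F t - c| ^+ 2) = \sum_k J a b (fun t => (coord k (F t) - coord k c) ^+ 2).
Proof.
move=> hF; have c1 : continuous (fun _ : R => 1 : R) by move=> ?; exact: cvg_cst.
have := J_normsq c a b hF c1; under eq_fun do rewrite mulr1.
by move=> ->; apply: eq_bigr => k _; apply: J_eq => t _; rewrite mulr1.
Qed.

Lemma osc_min i f F c s t : bdata i f F -> s < t ->
  (t - s) * osc F s t <= J s t (fun x => `|F x - c| ^+ 2).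
Proof.
move=> hF st; rewrite /osc mulrA mulfV ?mul1r; last by rewrite subr_eq0 gt_eqF.
rewrite !(J_normsq1 _ _ _ hF); apply: ler_sum => k _.
have [l1 l2 _ _] := hF (qunit k).
have := mean_variance (coord k c) st l1 l2; rewrite coord_vmean => ->.
by rewrite lerDl mulr_ge0 ?sqr_ge0// subr_ge0 ltW.
Qed.

Lemma osc_ge0 F s t : s < t -> 0 <= osc F s t.
Proof.
move=> st; apply: mulr_ge0; first by rewrite invr_ge0 subr_ge0 ltW.
by apply: J_ge0 => x; exact: sqr_ge0.
Qed.

Lemma gar_ge0 F z c : normc z < 1 -> 0 <= gar F z c.
Proof.
move=> z1; rewrite mulr_ge0 ?invr_ge0 ?mulr_ge0 ?pi_ge0//.
apply: J_ge0 => t; apply: mulr_ge0; first exact: sqr_ge0.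
by apply: ltW; apply: dphi_gt0; rewrite normcN.
Qed.

Let gt0_2pi : 0 < 2 * pi :> R. Proof. by rewrite mulr_gt0// pi_gt0. Qed.

Lemma garE i f F z c : bdata i f F -> normc z < 1 -> 2 * pi * gar F z c =
  \sum_k J 0 (2 * pi) (fun t => (coord k (F t) - coord k c) ^+ 2 * dphi (- z) t).
Proof.
move=> hF z1; rewrite /gar mulrA mulfV ?mul1r; last exact: lt0r_neq0.
by apply: (J_normsq _ _ _ hF); apply: dphi_continuous; rewrite normcN.
Qed.

(** Each real coordinate is treated alone, so the constant 17 of [bmo_of_garsia] is paid four
    times. *)
Lemma osc_of_gar i f F (S : R) : bdata i f F ->
  (forall z, normc z < 1 -> gar F z (f (emb i z)) <= S) ->
  forall s t, s < t -> t - s <= 2 * pi -> osc F s t <= 68 * S.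
Proof.
move=> hF hS s t st t2.
have hk k : bmo_le (fun t => coord k (F t)) (17 * S).
  apply: bmo_of_garsia (hF (qunit k)) _ => z z1.
  have /(ler_wpM2l (ltW gt0_2pi)) := hS z z1; rewrite (garE _ hF z1).
  apply: le_trans; rewrite (bigD1 k)//= lerDl; apply: sumr_ge0 => l _.
  apply: J_ge0 => x; apply: mulr_ge0; first exact: sqr_ge0.
  by apply: ltW; apply: dphi_gt0; rewrite normcN.
have ts : 0 < t - s by rewrite subr_gt0.
rewrite /osc mulrC ler_pdivrMr// (J_normsq1 _ _ _ hF).
apply: (@le_trans _ _ (\sum_(k < 4) 17 * S * (t - s))).
  by apply: ler_sum => k _; rewrite coord_vmean; exact: hk.
by rewrite sumr_const card_ord -mulr_natl; lra.
Qed.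

Lemma gar_of_osc i f F (B : R) : bdata i f F ->
  (forall s t, s < t -> t - s <= 2 * pi -> osc F s t <= B) ->
  forall z, normc z < 1 -> gar F z (f (emb i z)) <= 1536 * B.
Proof.
move=> hF hB z z1.
have hk k : garsia_le (fun z => coord k (f (emb i z))) (fun t => coord k (F t)) (384 * B).
  apply: garsia_of_bmo (hF (qunit k)) _ => s t st t2.
  have ts : 0 < t - s by rewrite subr_gt0.
  have := hB s t st t2; rewrite /osc mulrC ler_pdivrMr// (J_normsq1 _ _ _ hF).
  apply: le_trans; rewrite (bigD1 k)//= -coord_vmean lerDl; apply: sumr_ge0 => l _.
  by apply: J_ge0 => x; exact: sqr_ge0.
rewrite -(ler_pM2l gt0_2pi) (garE _ hF z1).
apply: (@le_trans _ _ (\sum_(k < 4) 2 * pi * (384 * B))).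
  by apply: ler_sum => k _; exact: hk.
by rewrite sumr_const card_ord -mulr_natl; lra.
Qed.

Lemma gar_mean i f F z c : bdata i f F -> normc z < 1 ->
  gar F z c = gar F z (f (emb i z)) + `|f (emb i z) - c| ^+ 2.
Proof.
move=> hF z1; apply: (mulfI (lt0r_neq0 gt0_2pi)); rewrite [RHS]mulrDr !(garE _ hF z1).
rewrite coord_sum mulr_sumr -big_split; apply: eq_bigr => k _ /=.
by rewrite (boundary_variance (coord k c) (hF (qunit k)) z1) coordB; congr (_ + _); exact: mulrC.
Qed.

Let ae_set F (g : R -> H) (A : set (measurableTypeR R)) (k : H -> \bar R) :
  measurable A -> {ae mu, forall t : measurableTypeR R, g t = F t} ->
  (\int[mu]_(t in A) k (g t) = \int[mu]_(t in A) k (F t))%E.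
Proof.
move=> mA gF; apply: ae_eq_integral_gen => //.
by apply: filterS gF => t /= -> _.
Qed.

Let J_open s t (h : R -> R) : lint h -> \int[mu]_(x in `]s, t[) h x = J s t h.
Proof.
move=> [mh ih].
have mI (A : set (measurableTypeR R)) : measurable_fun A (EFin \o h).
  by apply/measurable_EFinP; exact: measurable_funS mh.
rewrite /J /Rintegral; congr fine.
by rewrite (integral_itv_bndo_bndc (mI _)) (integral_itv_obnd_cbnd (mI _)).
Qed.

Lemma osc2_bdata i f F s t : bdata i f F -> osc2 f i s t = (osc F s t)%:E.
Proof.
move=> hF; have hb := bdata_bval hF.
have mI : measurable (`]s, t[%classic : set (measurableTypeR R)) by exact: measurable_itv.
have lc k : lint (fun x => coord k (F x)) by exact: bdata_lint_coord hF.
have bm : bmean f i s t = vmean F s t.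
  rewrite /bmean /qRintegral /vmean; congr (_ *: Quat _ _ _ _); rewrite -J_open.
  - by rewrite /Rintegral (ae_set (fun x => (qRe x)%:E) mI hb).
  - by have := lc 0; under eq_fun do rewrite coord0.
  - by rewrite /Rintegral (ae_set (fun x => (qi x)%:E) mI hb).
  - by have := lc 1; under eq_fun do rewrite coord1.
  - by rewrite /Rintegral (ae_set (fun x => (qj x)%:E) mI hb).
  - by have := lc 2; under eq_fun do rewrite coord2.
  - by rewrite /Rintegral (ae_set (fun x => (qk x)%:E) mI hb).
  - by have := lc 3; under eq_fun do rewrite coord3.
rewrite /osc2 bm /osc EFinM; congr (_ * _)%E.
rewrite (ae_set (fun x => (`|x - vmean F s t| ^+ 2)%:E) mI hb).
have [mh _] := bdata_lint_sq (vmean F s t) hF.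
have mI' (A : set (measurableTypeR R)) : measurable_fun A (fun x => (`|F x - vmean F s t| ^+ 2)%:E).
  by apply/measurable_EFinP; exact: measurable_funS mh.
rewrite (integral_itv_bndo_bndc (mI' _)) (integral_itv_obnd_cbnd (mI' _)).
by rewrite -JE//; exact: bdata_lint_sq hF.
Qed.

(** By [J_phi] the two sides are the integrals of h along T_w T_z and along T_c, c = T_w z, which
    differ by a rotation of the circle. *)
Lemma J_phi_comp (h : R -> R) w z : lint h -> periodic (h : R -> R) (2 * pi) ->
  normc w < 1 -> normc z < 1 ->
  J 0 (2 * pi) (fun t => h (phi w t) * dphi (- z) t) =
  J 0 (2 * pi) (fun t => h t * dphi (- (Tc w z)) t).
Proof.
move=> lh ph w1 z1; have wz : normc (Tc w z) < 1 by exact: Tc_lt1.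
have [s hs] := phi_comp w1 z1.
rewrite -(J_phi z1 (lint_phi w1 lh) (periodic_phi w ph)) -(J_phi wz lh ph).
rewrite -(J_rotate s (lint_phi wz lh) (periodic_phi (Tc w z) ph)).
by apply: J_eq => t _; exact: cis_periodic.
Qed.

Lemma bdata_icomp i f F w : qsphere R i -> normc w < 1 -> bdata i f F ->
  bdata i (icomp i f (moebius i (emb i w))) (fun t => F (phi w t)).
Proof.
move=> hi w1 hF c; have [lF lF2 pF aF] := hF c; split.
- exact: (lint_phi w1 lF).
- exact: (lint_phi w1 lF2).
- exact: (periodic_phi w pF).
- move=> z z1; rewrite icomp_emb// aF; last exact: Tc_lt1.
  by rewrite -(J_phi_comp lF pF w1 z1).
Qed.

Lemma gar_icomp i f F w z c : normc w < 1 -> bdata i f F -> normc z < 1 ->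
  gar (fun t => F (phi w t)) z c = gar F (Tc w z) c.
Proof.
move=> w1 hF z1; rewrite /gar; congr (_ * _).
have ph : periodic (fun t : R => `|F t - c| ^+ 2 : R) (2 * pi).
  by move=> t; rewrite (bdata_periodic t hF).
exact: (J_phi_comp (bdata_lint_sq c hF) ph w1 z1).
Qed.

Lemma star_term i f F z : qsphere R i -> normc z < 1 -> bdata i f F ->
  (((2 * pi)^-1)%:E * \int[mu]_(t in `[(- pi)%R, pi])
     (`|bval (icomp i f (moebius i (emb i z))) i t - f (emb i z)| ^+ 2)%:E)%E =
  (gar F z (f (emb i z)))%:E.
Proof.
move=> hi z1 hF; set c := f _.
have hG := bdata_icomp hi z1 hF; have hb := bdata_bval hG.
have mI : measurable (`[- pi, pi]%classic : set (measurableTypeR R)) by exact: measurable_itv.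
rewrite (ae_set (fun x => (`|x - c| ^+ 2)%:E) mI hb).
have lh := bdata_lint_sq c hG.
rewrite -(JE _ _ lh) -EFinM /gar; congr (_ * _)%:E.
have ph : periodic (fun t : R => `|F t - c| ^+ 2 : R) (2 * pi).
  by move=> t; rewrite (bdata_periodic t hF).
rewrite -(J_phi z1 (bdata_lint_sq c hF) ph).
have := J_period (- pi) lh (periodic_phi z ph).
by rewrite (_ : - pi + 2 * pi = pi)//; lra.
Qed.

(** t -> F(-t) is the boundary function of z -> f(conj z), because reflection carries the Poisson
    kernel at conj z to the one at z. *)
Lemma bdata_slice i j f F : qsphere R i -> qsphere R j -> slice_hyperholomorphic f ->
  bdata i f F -> bdata j f (fun t => 2^-1 *: ((1 - j * i) * F t) +
    2^-1 *: ((1 + j * i) * F (- t))).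
Proof.
move=> hi hj hf hF c.
pose p := c * (2^-1 *: (1 - j * i)); pose q := c * (2^-1 *: (1 + j * i)).
have e (x y : H) : qRe (c * (2^-1 *: ((1 - j * i) * x) + 2^-1 *: ((1 + j * i) * y))) =
    1 * qRe (p * x) + 1 * qRe (q * y).
  by rewrite /p /q -!mulrA -!scalerAl mulrDr !mul1r.
have hq : boundary_of (fun z => qRe (q * f (emb i (conjc z)))) (fun t => qRe (q * F (- t))).
  have [lF lF2 pF aF] := hF q; split.
  - exact: (lint_opp lF).
  - exact: (lint_opp lF2).
  - move=> t; have := pF (- t - 2 * pi); rewrite subrK => ->.
    by congr (qRe (q * F _)); ring.
  - move=> z z1; rewrite aF ?normc_conj//.
    have na : normc (- conjc z) < 1 by rewrite normcN normc_conj.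
    have lk := lint_dphi na lF.
    have pk : periodic (fun t : R => qRe (q * F t) * dphi (- conjc z) t : R) (2 * pi).
      by move=> t; rewrite pF dphi_2pi.
    have := J_period (- (2 * pi)) lk pk; rewrite addNr => <-.
    have := J_opp 0 (2 * pi) (proj1 lk); rewrite oppr0 => ->.
    apply: J_eq => t _; congr (_ * _); rewrite !dphiE !normcN normc_conj; congr (_ / _ ^+ 2).
    rewrite -[LHS]normc_conj; congr normc; case: (z) => x y.
    apply/eqP; rewrite eq_complex /= cosN sinN.
    by apply/andP; split; apply/eqP; ring.
have := boundary_of_lin 1 1 (hF p) hq.
set A := (fun z => _); set B := (fun t => _).
have -> // : B = (fun t => qRe (c * (2^-1 *: ((1 - j * i) * F t) +
  2^-1 *: ((1 + j * i) * F (- t))))).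
  by apply/funext => t; rewrite e.
move=> [l1 l2 l3 l4]; split => // z z1.
by rewrite (slice_change hf hi hj z1) e; exact: l4.
Qed.

(** The mean on C_j is replaced, by [osc_min], with the same combination of the means of F over (s,
    t) and (-t, -s). Squaring a sum of two terms gives 2 + 2. *)
Lemma osc_slice i j f F (B : R) : qsphere R i -> qsphere R j -> slice_hyperholomorphic f ->
  bdata i f F -> (forall s t, s < t -> t - s <= 2 * pi -> osc F s t <= B) ->
  forall s t, s < t -> t - s <= 2 * pi ->
  osc (fun t => 2^-1 *: ((1 - j * i) * F t) + 2^-1 *: ((1 + j * i) * F (- t))) s t <= 4 * B.
Proof.
move=> hi hj hf hF hB s t st t2.
have hG := bdata_slice hi hj hf hF; set G := (fun t : R => _) in hG *.
have [a_le b_le] := half_le1 hi hj.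
have ts : 0 < t - s by rewrite subr_gt0.
pose m := vmean F s t; pose n := vmean F (- t) (- s).
pose c := 2^-1 *: (1 - j * i) * m + 2^-1 *: (1 + j * i) * n.
rewrite -(ler_pM2l ts); apply: le_trans (osc_min c hG st) _.
have lm := bdata_lint_sq m hF; have ln := bdata_lint_sq n hF.
have ln' : lint (fun x => `|F (- x) - n| ^+ 2) := lint_opp ln.
apply: (@le_trans _ _ (J s t (fun x => 2 * `|F x - m| ^+ 2 + 2 * `|F (- x) - n| ^+ 2))).
  apply: J_le; [exact: bdata_lint_sq hG|exact: lintD (lintZ _ lm) (lintZ _ ln')|].
  move=> x _; rewrite /G /c.
  set p := 2^-1 *: (1 - j * i) in a_le *; set q := 2^-1 *: (1 + j * i) in b_le *.
  have -> : 2^-1 *: ((1 - j * i) * F x) + 2^-1 *: ((1 + j * i) * F (- x)) - (p * m + q * n) =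
     p * (F x - m) + q * (F (- x) - n).
    by rewrite !scalerAl opprD addrACA !mulrBr.
  have h : `|p * (F x - m) + q * (F (- x) - n)| <= `|F x - m| + `|F (- x) - n|.
    apply: le_trans (ler_normD _ _) _; rewrite !qnormM.
    by apply: lerD; apply: ler_piMl.
  have : `|p * (F x - m) + q * (F (- x) - n)| ^+ 2 <= (`|F x - m| + `|F (- x) - n|) ^+ 2.
    by rewrite ler_pXn2r ?nnegrE ?addr_ge0.
  have := sqr_ge0 (`|F x - m| - `|F (- x) - n|); lra.
rewrite (JD _ _ (lintZ _ lm) (lintZ _ ln')) (JZ _ _ _ lm) (JZ _ _ _ ln').
have e2 := J_opp s t (proj1 ln); rewrite -e2.
have h1 := hB s t st t2.
have st' : - t < - s by rewrite ltrN2.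
have ts' : - s - - t = t - s by ring.
have h2 := hB (- t) (- s) st'; rewrite ts' in h2; have {}h2 := h2 t2.
rewrite /osc mulrC ler_pdivrMr// -/m in h1.
rewrite /osc ts' mulrC ler_pdivrMr// -/n in h2.
move: h1 h2; set X := J s t _; set Y := J (- t) _ _.
by move: X Y => X Y; lra.
Qed.

(** Re is a trace, Re (c x q) = Re (q c x), so the right factor q moves into the free constant. *)
Lemma boundary_mulr i f F q : bdata i f F -> bdata i (fun x => f x * q) (fun t => F t * q).
Proof.
move=> hF c; have tr (x : H) : qRe (c * (x * q)) = qRe (q * c * x).
  by rewrite /=; ring.
have -> : (fun z => qRe (c * (f (emb i z) * q))) = (fun z => qRe (q * c * f (emb i z))).
  by apply/funext => z; rewrite tr.
have -> : (fun t => qRe (c * (F t * q))) = (fun t => qRe (q * c * F t)).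
  by apply/funext => t; rewrite tr.
exact: hF.
Qed.

Lemma bdataD i f g F G : bdata i f F -> bdata i g G ->
  bdata i (f \+ g) (fun t => F t + G t).
Proof.
move=> hF hG c; have := boundary_of_lin 1 1 (hF c) (hG c).
set A := (fun z => _); set B := (fun t => _).
have -> : A = (fun z => qRe (c * (f \+ g) (emb i z))).
  by apply/funext => z; rewrite /A !mul1r -[(f \+ g) _]/(f (emb i z) + g (emb i z)) mulrDr.
have -> // : B = (fun t => qRe (c * (F t + G t))).
by apply/funext => t; rewrite /B !mul1r mulrDr.
Qed.

End Oscillation.

(** * The seminorms *)

Section Seminorms.
Variable R : realType.
Local Notation H := (quat R).
Local Notation C := (R[i]).
Implicit Types (i j q : H) (f g : H -> H) (F G : R -> H) (z w : C) (x y : R) (S : \bar R).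

Lemma poweR_half_le S x : (0 <= S)%E -> 0 <= x ->
  (poweR S 2^-1 <= x%:E)%E = (S <= (x ^+ 2)%:E)%E.
Proof.
case: S => [s| |//]; last by rewrite poweRyr ?invr_eq0//  !leye_eq.
rewrite lee_fin => s0 x0; rewrite poweR_EFin powR12_sqrt// !lee_fin.
by rewrite -{1}(ger0_norm x0) -sqrtr_sqr ler_sqrt ?sqr_ge0.
Qed.

Lemma le_of_fin S x : (0 <= S)%E -> (S <= x%:E)%E -> exists2 y, 0 <= y & S = y%:E.
Proof. by case: S => [s| |]// s0 _; exists s. Qed.

(** Turns the square root of an extended supremum into a family of real inequalities. The point 0
    witnesses that the supremum is nonnegative. *)
Lemma star_le i f F x : qsphere R i -> bdata i f F -> 0 <= x ->
  (star_seminorm i f <= x%:E)%E <->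
  (forall z, normc z < 1 -> gar F z (f (emb i z)) <= x ^+ 2).
Proof.
move=> hi hF x0; rewrite /star_seminorm poweR_half_le//; last first.
  apply: (@le_trans _ _ (gar F 0 (f (emb i 0)))%:E).
    by rewrite lee_fin gar_ge0// normc0.
  apply: ereal_sup_ubound; exists (emb i 0).
    by apply/(qdisc_sliceP _ hi); exists 0 => //; rewrite normc0.
  by apply: star_term => //; rewrite normc0.
split=> [h z z1|h].
  rewrite -lee_fin -(star_term hi z1 hF); apply: le_trans h.
  by apply: ereal_sup_ubound; exists (emb i z) => //; apply/(qdisc_sliceP _ hi); exists z.
apply: ge_ereal_sup => _ [a /(qdisc_sliceP _ hi)[z -> z1] <-].
by rewrite (star_term hi z1 hF) lee_fin; exact: h.
Qed.

Lemma bmosh_slice_le i f F x : bdata i f F -> 0 <= x ->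
  (bmosh_slice f i <= x%:E)%E <->
  (forall s t, s < t -> t - s <= 2 * pi -> osc F s t <= x ^+ 2).
Proof.
move=> hF x0; rewrite /bmosh_slice poweR_half_le//; last first.
  have pp : 0 < 2 * pi :> R by rewrite mulr_gt0// pi_gt0.
  apply: (@le_trans _ _ (osc F 0 (2 * pi))%:E); first by rewrite lee_fin osc_ge0.
  by apply: ereal_sup_ubound; exists (0, 2 * pi) => /=; [rewrite subr0|rewrite (osc2_bdata _ _ hF)].
split=> [h s t st t2|h].
  rewrite -lee_fin -(osc2_bdata s t hF); apply: le_trans h.
  by apply: ereal_sup_ubound; exists (s, t).
apply: ge_ereal_sup => _ [[s t] [/= st t2] <-].
by rewrite (osc2_bdata s t hF) lee_fin; exact: h.
Qed.

Lemma star_ge0 i f : (0 <= star_seminorm i f)%E.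
Proof. exact: poweR_ge0. Qed.

Lemma bmosh_slice_ge0 i f : (0 <= bmosh_slice f i)%E.
Proof. exact: poweR_ge0. Qed.

Lemma star_le_bmosh i f F x : qsphere R i -> bdata i f F -> 0 <= x ->
  (bmosh_slice f i <= x%:E)%E -> (star_seminorm i f <= (40 * x)%:E)%E.
Proof.
move=> hi hF x0 /(bmosh_slice_le hF x0) h.
apply/(star_le hi hF); first by rewrite mulr_ge0.
move=> z z1; apply: le_trans (gar_of_osc hF h z1) _.
(* 1536 <= 40^2. *)
by rewrite exprMn; have := sqr_ge0 x; lra.
Qed.

Lemma bmosh_le_star i f F x : qsphere R i -> slice_hyperholomorphic f -> bdata i f F ->
  0 <= x -> (star_seminorm i f <= x%:E)%E -> (bmosh_seminorm f <= (18 * x)%:E)%E.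
Proof.
move=> hi hf hF x0 /(star_le hi hF x0) h.
have hosc := osc_of_gar hF h.
apply: ge_ereal_sup => _ [j hj <-].
apply/(bmosh_slice_le (bdata_slice hi hj hf hF)); first by rewrite mulr_ge0.
move=> s t st t2; apply: le_trans (osc_slice hi hj hf hF hosc st t2) _.
(* 4 * 68 = 272 <= 18^2. *)
by rewrite exprMn; have := sqr_ge0 x; lra.
Qed.

Lemma BMOSH_data i f : qsphere R i -> BMOSH R f -> exists F x,
  [/\ bdata i f F, slice_hyperholomorphic f, 0 <= x & star_seminorm i f = x%:E].
Proof.
move=> hi [hh hb]; have [F hF] := hardy2_bdata hi hh.
have bi : (bmosh_slice f i <= bmosh_seminorm f)%E by apply: ereal_sup_ubound; exists i.
have [b b0 bE] : exists2 b, 0 <= b & bmosh_slice f i = b%:E.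
  have := bmosh_slice_ge0 i f; have := le_lt_trans bi hb.
  by case: (bmosh_slice f i) => [b| |]// _ b0; exists b.
have h := star_le_bmosh hi hF b0 (eq_ind_r (fun S => (S <= b%:E)%E) (lexx _) bE).
have [x x0 xE] := le_of_fin (star_ge0 i f) h.
by exists F, x; split => //; case: hh.
Qed.

Lemma gar_mulr F q z (c : H) : normc z < 1 -> lint (fun t => `|F t - c| ^+ 2) ->
  gar (fun t => F t * q) z (c * q) = `|q| ^+ 2 * gar F z c.
Proof.
move=> z1 lF; rewrite /gar mulrCA; congr (_ * _).
have na : normc (- z) < 1 by rewrite normcN.
have lk := lint_dphi na lF.
rewrite -(JZ _ _ _ lk); apply: J_eq => t _.
by rewrite -mulrBl qnormM exprMn; ring.
Qed.

Lemma star_mulr_le i f F q x : qsphere R i -> bdata i f F -> 0 <= x ->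
  (star_seminorm i f <= x%:E)%E -> (star_seminorm i (fun v : H => (f v * q)%R) <= (x * `|q|)%:E)%E.
Proof.
move=> hi hF x0 /(star_le hi hF x0) h.
apply/(star_le hi (boundary_mulr q hF)); first by rewrite mulr_ge0.
move=> z z1; rewrite (gar_mulr _ z1 (bdata_lint_sq _ hF)) exprMn mulrC.
by rewrite ler_wpM2r ?sqr_ge0//; exact: h.
Qed.

(* The cross term is absorbed with weights such that
   (1 + y/x) x^2 + (1 + x/y) y^2 = (x + y)^2. *)
Lemma gar_add i f g F G z x y : bdata i f F -> bdata i g G -> normc z < 1 -> 0 < x -> 0 < y ->
  gar F z (f (emb i z)) <= x ^+ 2 -> gar G z (g (emb i z)) <= y ^+ 2 ->
  gar (fun t => F t + G t) z (f (emb i z) + g (emb i z)) <= (x + y) ^+ 2.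
Proof.
move=> hF hG z1 x0 y0 hx hy; have na : normc (- z) < 1 by rewrite normcN.
set c := f _ in hx *; set d := g _ in hy *.
have lF := bdata_lint_sq c hF; have lG := bdata_lint_sq d hG.
have lFG := bdata_lint_sq (c + d) (bdataD hF hG).
have lk (h : R -> R) : lint h -> lint (fun t => h t * dphi (- z) t) by exact: lint_dphi.
have pp : 0 <= (2 * pi : R)^-1 by rewrite invr_ge0 mulr_ge0// pi_ge0.
have p1 : 0 <= 1 + y / x by rewrite addr_ge0// divr_ge0// ltW.
have p2 : 0 <= 1 + x / y by rewrite addr_ge0// divr_ge0// ltW.
apply: (@le_trans _ _ ((1 + y / x) * gar F z c + (1 + x / y) * gar G z d)); last first.
  have -> : (x + y) ^+ 2 = (1 + y / x) * x ^+ 2 + (1 + x / y) * y ^+ 2.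
    by field; rewrite (lt0r_neq0 x0) (lt0r_neq0 y0).
  by apply: lerD; apply: ler_wpM2l.
rewrite /gar !(mulrCA _ (2 * pi)^-1) -mulrDr ler_wpM2l//.
rewrite -(JZ _ _ _ (lk _ lF)) -(JZ _ _ _ (lk _ lG))
  -(JD _ _ (lintZ _ (lk _ lF)) (lintZ _ (lk _ lG))).
apply: (J_le (lk _ lFG) (lintD (lintZ _ (lk _ lF)) (lintZ _ (lk _ lG)))) => t _.
have d0 : 0 <= dphi (- z) t by apply: ltW; exact: dphi_gt0 na.
suff : `|F t + G t - (c + d)| ^+ 2 <= (1 + y / x) * `|F t - c| ^+ 2 + (1 + x / y) * `|G t - d| ^+ 2.
  by move=> /(ler_wpM2r d0) hh; apply: (le_trans hh); rewrite mulrDl -!mulrA.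
rewrite opprD addrACA; set u := F t - c; set v := G t - d.
have h : `|u + v| ^+ 2 <= (`|u| + `|v|) ^+ 2.
  by rewrite ler_pXn2r ?nnegrE ?addr_ge0// ler_normD.
apply: (le_trans h).
have : 0 <= (y * `|u| - x * `|v|) ^+ 2 / (x * y) by rewrite divr_ge0 ?sqr_ge0 ?mulr_ge0 ?ltW.
have -> : (y * `|u| - x * `|v|) ^+ 2 / (x * y) =
    y / x * `|u| ^+ 2 - 2 * `|u| * `|v| + x / y * `|v| ^+ 2.
  by field; rewrite (lt0r_neq0 x0) (lt0r_neq0 y0).
lra.
Qed.

Lemma star_add_le i f g F G x y : qsphere R i -> bdata i f F -> bdata i g G ->
  0 <= x -> 0 <= y -> (star_seminorm i f <= x%:E)%E -> (star_seminorm i g <= y%:E)%E ->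
  (star_seminorm i (f \+ g)%R <= (x + y)%:E)%E.
Proof.
move=> hi hF hG x0 y0 /(star_le hi hF x0) hx /(star_le hi hG y0) hy.
apply/(star_le hi (bdataD hF hG)); first by rewrite addr_ge0.
move=> z z1; set A := gar _ _ _.
have A0 : 0 <= A by exact: gar_ge0.
have xy : 0 <= x + y by rewrite addr_ge0.
rewrite -(sqr_sqrtr A0) ler_pXn2r ?nnegrE ?sqrtr_ge0//.
(* [gar_add] divides by x and y, which may be 0 here, so both are first enlarged by e/2. *)
apply/ler_addgt0Pr => e e0.
have e2 : 0 < e / 2 by rewrite divr_gt0.
have xe : 0 < x + e / 2 by rewrite ltr_wpDl.
have ye : 0 < y + e / 2 by rewrite ltr_wpDl.
have sq (a : R) : 0 <= a -> a ^+ 2 <= (a + e / 2) ^+ 2.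
  by move=> a0; rewrite ler_pXn2r ?nnegrE ?addr_ge0// ?lerDl ltW.
have := gar_add hF hG z1 xe ye (le_trans (hx z z1) (sq x x0)) (le_trans (hy z z1) (sq y y0)).
have -> : x + e / 2 + (y + e / 2) = x + y + e by lra.
have xye : 0 <= x + y + e by rewrite addr_ge0// ltW.
by move=> h; rewrite -(ger0_norm xye) -sqrtr_sqr ler_wsqrtr.
Qed.

Lemma star_icomp_le i f F w x : qsphere R i -> normc w < 1 -> bdata i f F -> 0 <= x ->
  (star_seminorm i (icomp i f (moebius i (emb i w))) <= x%:E)%E <->
  (star_seminorm i f <= x%:E)%E.
Proof.
move=> hi w1 hF x0; have hG := bdata_icomp hi w1 hF.
have nw : normc (- w) < 1 by rewrite normcN.
have gE z : normc z < 1 -> gar (fun t => F (phi w t)) z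
  (icomp i f (moebius i (emb i w)) (emb i z)) =
    gar F (Tc w z) (f (emb i (Tc w z))).
  by move=> z1; rewrite (gar_icomp _ w1 hF z1) icomp_emb.
split=> [/(star_le hi hG x0) h|/(star_le hi hF x0) h].
  apply/(star_le hi hF x0) => z z1; have z1' := Tc_lt1 nw z1.
  by have := h _ z1'; rewrite (gE _ z1') TcK// ltW.
apply/(star_le hi hG x0) => z z1; rewrite (gE _ z1).
by apply: h; exact: Tc_lt1.
Qed.

Lemma star_seminorm_on i : qsphere R i -> is_seminorm_on (BMOSH R) (star_seminorm i).
Proof.
move=> hi; split.
- move=> f /(BMOSH_data hi)[F [x [_ _ x0 ->]]].
  by rewrite lee_fin x0 ltry.
- move=> f g /(BMOSH_data hi)[F [x [hF _ x0 xE]]] /(BMOSH_data hi)[G [y [hG _ y0 yE]]].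
  rewrite xE yE -EFinD; apply: (star_add_le hi hF hG x0 y0); first by rewrite xE.
  by rewrite yE.
- move=> f q /(BMOSH_data hi)[F [x [hF _ x0 xE]]].
  rewrite xE -EFinM.
  have le1 : (star_seminorm i (fun v : H => (f v * q)%R) <= (x * `|q|)%:E)%E.
    by apply: (star_mulr_le q hi hF x0); rewrite xE.
  have [y y0 yE] := le_of_fin (star_ge0 i _) le1.
  apply/eqP; rewrite eq_le le1 /= yE lee_fin.
  have [->|q0] := eqVneq q 0; first by rewrite normr0 mulr0.
  (* The reverse inequality is the first one applied to f q and the factor q^-1. *)
  have := star_mulr_le q^-1 hi (boundary_mulr q hF) y0; rewrite yE => /(_ (lexx _)).
  have -> : (fun v : H => f v * q * q^-1) = f.
    by apply/funext => v; rewrite -mulrA divrr ?mulr1// unitfE.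
  rewrite xE lee_fin => h.
  have qn : 0 < `|q| by rewrite normr_gt0.
  have qv : `|q^-1| = `|q|^-1.
    apply: (mulfI (lt0r_neq0 qn)); rewrite -qnormM divrr ?unitfE// qnorm1 mulfV//.
    exact: lt0r_neq0.
  by rewrite qv ler_pdivlMr// in h.
Qed.

(** Membership of the composite in BMOSH comes back from its star bound: [bmosh_le_star] controls
    the oscillation on every slice. *)
Lemma star_invariant i a f : qsphere R i -> qdisc_slice i a -> BMOSH R f ->
  BMOSH R (icomp i f (moebius i a)) /\
  star_seminorm i (icomp i f (moebius i a)) = star_seminorm i f.
Proof.
move=> hi /(qdisc_sliceP _ hi)[w -> w1] /(BMOSH_data hi)[F [x [hF hf x0 xE]]].
have hG := bdata_icomp hi w1 hF.
have hg := slice_hyperholomorphic_icomp hi hf w1.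
have le1 : (star_seminorm i (icomp i f (moebius i (emb i w))) <= x%:E)%E.
  by apply/(star_icomp_le hi w1 hF x0); rewrite xE.
split.
  split; first exact: bdata_hardy2 hi hg hG.
  by apply: le_lt_trans (bmosh_le_star hi hg hG x0 le1) _; exact: ltry.
apply/eqP; rewrite eq_le xE le1 /= -xE.
have [y y0 yE] := le_of_fin (star_ge0 i _) le1.
rewrite yE; have := proj1 (star_icomp_le hi w1 hF y0); apply.
by rewrite yE.
Qed.

(** At z = 0 the kernel is 1, so the integral of |F|^2 vanishes. At any other z the kernel is
    bounded, hence the integral about the constant 0 vanishes too, and by [gar_mean] it contains
    |f(z)|^2. The other slices follow by [slice_change]. *)
Lemma slice_hyperholomorphic_eq0 i f F v : qsphere R i -> slice_hyperholomorphic f ->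
  bdata i f F -> f 0 = 0 -> (star_seminorm i f <= 0)%E -> qdisc v -> f v = 0.
Proof.
move=> hi hf hF f0 /(star_le hi hF (lexx 0)) h.
have n0 : normc (0 : C) < 1 by rewrite normc0.
have lF := bdata_lint_sq 0 hF.
have d0 t : dphi (- (0 : C)) t = 1.
  by rewrite dphiE oppr0 rmorph0 mul0r addr0 normc0 normc1 expr0n expr1n subr0 divr1.
have pp : 0 < 2 * pi :> R by rewrite mulr_gt0// pi_gt0.
have V0 : 0 < (2 * pi : R)^-1 by rewrite invr_gt0.
have J0 : J 0 (2 * pi) (fun t => `|F t - 0| ^+ 2) <= 0.
  have := h 0 n0; rewrite emb0 f0 expr0n /= /gar pmulr_rle0//.
  by under J_eq do rewrite d0 mulr1.
have z0 z : normc z < 1 -> f (emb i z) = 0.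
  move=> z1; have na : normc (- z) < 1 by rewrite normcN.
  have [K K0 hK] := bounded_dphi na.
  have hm := gar_mean 0 hF z1; have hz := gar_ge0 F (f (emb i z)) z1.
  have : gar F z 0 <= 0.
    rewrite /gar pmulr_rle0//.
    apply: (@le_trans _ _ (K * J 0 (2 * pi) (fun t => `|F t - 0| ^+ 2))); last first.
      by rewrite mulr_ge0_le0.
    rewrite -(JZ _ _ _ lF); apply: J_le; last first.
    - move=> t _; rewrite [K * _]mulrC ler_wpM2l ?sqr_ge0//.
      by apply: le_trans (hK t); exact: ler_norm.
    - exact: lintZ.
    - exact: lint_dphi.
  rewrite hm subr0 => h2; apply/eqP; rewrite -normr_eq0 -sqrf_eq0 eq_le sqr_ge0 andbT.
  lra.
move=> vD; rewrite (quat_slice v) -[slice _ _ _]/(emb (idir v) (Complex (qRe v) `|qIm v|)).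
have v1 : normc (Complex (qRe v) `|qIm v|) < 1 by rewrite normc_lt1; exact: qdisc_idir.
rewrite (slice_change hf hi (idir_sphere v) v1) !z0 ?normc_conj//.
by rewrite !mulr0 !scaler0 addr0.
Qed.

Lemma star_norm_on i : qsphere R i -> is_norm_on (BMOSH R) (star_norm i).
Proof.
move=> hi; have [s1 s2 s3] := star_seminorm_on hi; split; first split.
- move=> f /[dup] /s1 /andP[h1 h2] _; rewrite /star_norm adde_ge0 ?lee_fin//=.
  by rewrite lte_add_pinfty// ltry.
- move=> f g hf hg; rewrite /star_norm addeACA leeD//; last exact: s2.
  by rewrite -EFinD lee_fin ler_normD.
- move=> f q hf; have [F [x [_ _ x0 xE]]] := BMOSH_data hi hf.
  rewrite /star_norm (s3 _ _ hf) xE qnormM -!EFinM -!EFinD; congr _%:E.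
  by rewrite mulrDl.
- move=> f hf N0 v vD; have [F [x [hF hsh x0 xE]]] := BMOSH_data hi hf.
  move: N0; rewrite /star_norm xE -EFinD => -[/eqP].
  rewrite paddr_eq0// normr_eq0 => /andP[/eqP f0 /eqP xx].
  by apply: (slice_hyperholomorphic_eq0 hi hsh hF f0 _ vD); rewrite xE xx.
Qed.

Lemma star_bmosh_equivalent i : qsphere R i ->
  equivalent_on (BMOSH R) (star_norm i) (@bmosh_norm R).
Proof.
move=> hi; exists 18^-1, 40; split => // f hf.
have [F [x [hF hsh x0 xE]]] := BMOSH_data hi hf.
have hb : (bmosh_seminorm f <= (18 * x)%:E)%E.
  by apply: bmosh_le_star hi hsh hF x0 _; rewrite xE.
have bi : (bmosh_slice f i <= bmosh_seminorm f)%E by apply: ereal_sup_ubound; exists i.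
have [b b0 bE] := le_of_fin (le_trans (bmosh_slice_ge0 i f) bi) hb.
rewrite bE in hb bi; have := star_le_bmosh hi hF b0 bi.
rewrite /star_norm /bmosh_norm xE bE -!EFinD -!EFinM !lee_fin in hb * => hx.
have f0 := normr_ge0 (f 0); apply/andP; split; lra.
Qed.

End Seminorms.

Theorem lemma4p11 (R : realType) (i : quat R) (hi : qsphere R i) :
  [/\ is_seminorm_on (BMOSH R) (star_seminorm i),
      (forall (a : quat R) (f : quat R -> quat R),
         qdisc_slice i a -> BMOSH R f ->
         BMOSH R (icomp i f (moebius i a)) /\
         star_seminorm i (icomp i f (moebius i a)) = star_seminorm i f),
      is_norm_on (BMOSH R) (star_norm i) &
      equivalent_on (BMOSH R) (star_norm i) (@bmosh_norm R)].
Proof.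
split; [exact: star_seminorm_on|by move=> a f; exact: star_invariant|
  exact: star_norm_on|exact: star_bmosh_equivalent].
Qed.
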